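(* Let $\Sigma_t$, $t\in(-\infty,0]$, be a complete almost calibrated Lagrangian mean curvature flow in $\mathbb{C}^2$. Suppose that there are constants $0<c<C<\infty$, independent of $t$ and $R$, such that $$cR^2\le \mu_t(\Sigma_t\cap B_R(0))\le CR^2$$ for all $R>0$ and all $t\in(-\infty,0]$. Assume further that $\sup_{t\in(-\infty,0]}\sup_{\Sigma_t}|A|^2=1$. Set $$h^2=\sup_{t\in(-\infty,0]}\sup_{\Sigma_t}|H|^2,\qquad \delta=\inf_{t\in(-\infty,0]}\inf_{\Sigma_t}\cos\theta .$$ Then $\delta e^{h^2/2}\le 1$.
   Context: $\mathbb{C}^2=\mathbb{R}^4$ carries the Euclidean metric, its standard Kähler form $\omega$, and the parallel holomorphic $(2,0)$-form $\Omega=dz_1\wedge dz_2$. Surfaces are smooth, oriented, real two-dimensional immersed surfaces. A mean curvature flow $\Sigma_t$ is a smooth family of immersions $F(\cdot,t):\Sigma\to\mathbb{C}^2$ with image $\Sigma_t$ satisfying $\partial F/\partial t=H$, where $H$ is the mean curvature vector of $\Sigma_t$ (the trace of the second fundamental form). $A$ denotes the second fundamental form of $\Sigma_t$. $\mu_t$ denotes the area measure of $\Sigma_t$ for the induced metric, and $B_R(0)$ is the Euclidean ball of radius $R$ centered at $0$. A surface $\Sigma$ is Lagrangian if $\omega|_\Sigma=0$; in that case $\Omega|_\Sigma=e^{i\theta}d\mu_\Sigma$, where $d\mu_\Sigma$ is the area element of the induced metric and $\theta$ is a multivalued function called the Lagrangian angle (so $\cos\theta$ is a well-defined function on $\Sigma$).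 A Lagrangian surface is almost calibrated if $\cos\theta>0$ on it; an almost calibrated Lagrangian mean curvature flow is a mean curvature flow for which every $\Sigma_t$ is Lagrangian and almost calibrated. *)

(* Defs.v *)
From HB Require Import structures.
From mathcomp Require Import all_boot all_order all_algebra.
From mathcomp Require Import all_classical all_reals all_analysis.
From mathcomp Require Import complex ring lra.

Set Implicit Arguments.
Unset Strict Implicit.
Unset Printing Implicit Defensive.

Import Order.TTheory GRing.Theory Num.Theory.
Import numFieldNormedType.Exports.
Local Open Scope classical_set_scope.
Local Open Scope ring_scope.

(** * Smooth maps between finite-dimensional spaces *)

Section Smooth.
Context {R : realType} {V W : normedModType R}.

(* For finite-dimensional [V] and open [U] this is the usual class C^n. *)
Fixpoint Cn_on (n : nat) (U : set V) (f : V -> W) : Prop :=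
  if n is m.+1 then
    (forall x, U x -> differentiable f x) /\
    (forall v : V, Cn_on m U (fun x => 'D_v f x))
  else forall x, U x -> {for x, continuous f}.

(* On a set that need not be open, smoothness means having smooth local
   extensions; this is what is meant at the final time t = 0. *)
Definition smooth_on (A : set V) (f : V -> W) : Prop :=
  forall x, A x -> exists (U : set V) (g : V -> W),
    [/\ open U, U x, forall n, Cn_on n U g
      & forall y, U y -> A y -> f y = g y].

End Smooth.

(** * Oriented smooth surfaces *)

Section Surface.
Context {R : realType}.

Definition e_ (a : 'I_2) : R * R := if a == 0 then (1, 0) else (0, 1).

Definition jacobian2 (psi : R * R -> R * R) (x : R * R) : 'M[R]_2 :=
  \matrix_(a, b) (let v := 'D_(e_ a) psi x in if b == 0 then v.1 else v.2).

(* A Hausdorff space with a countable oriented smooth atlas (equivalently, a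
   second countable oriented surface).  Charts are given with both directions:
   [spar i] maps the open set [sdom i] of R^2 homeomorphically onto an open
   subset of the surface, with inverse [scoord i].  A finite atlas is obtained
   by taking [sdom i] empty for all large i. *)
Record surface := Surface {
  carrier :> topologicalType;
  sdom : nat -> set (R * R);
  spar : nat -> R * R -> carrier;
  scoord : nat -> carrier -> R * R;
  surface_hausdorff : hausdorff_space carrier;
  sdom_open : forall i, open (sdom i);
  simg_open : forall i, open (spar i @` sdom i);
  sparK : forall i x, sdom i x -> scoord i (spar i x) = x;
  spar_continuous : forall i x, sdom i x -> {for x, continuous (spar i)};
  scoord_continuous : forall i p, (spar i @` sdom i) p ->
    {for p, continuous (scoord i)};
  scover : forall p : carrier, exists i, (spar i @` sdom i) p;
  stransition_smooth : forall i j,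
    smooth_on [set x | sdom i x /\ (spar j @` sdom j) (spar i x)]
              (scoord j \o spar i);
  stransition_oriented : forall i j x,
    sdom i x -> (spar j @` sdom j) (spar i x) ->
    0 < \det (jacobian2 (scoord j \o spar i) x)
}.

Arguments spar {s}.
Arguments scoord {s}.

Definition simg (S : surface) (i : nat) : set S := spar i @` sdom S i.

End Surface.
Arguments surface R : clear implicits.
Arguments spar {R s}.
Arguments scoord {R s}.
Arguments simg {R} S i _.

(** * Linear algebra of C^2 = R^4 *)

Section C2.
Context {R : realType}.

(* The vector (x1, y1, x2, y2) stands for (x1 + i y1, x2 + i y2).  The norm that
   the library puts on ['rV[R]_4] is the sup norm, hence the explicit Euclidean
   norm [enorm] below; the two define the same topology and smooth maps. *)
Notation R4 := 'rV[R]_4.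

Definition dot (u v : R4) : R := \sum_k u 0 k * v 0 k.
Definition enorm (u : R4) : R := Num.sqrt (dot u u).
Definition eball (r : R) : set R4 := [set u | enorm u < r].

Definition z1 (u : R4) : R[i] := (u 0 (inord 0) +i* u 0 (inord 1))%C.
Definition z2 (u : R4) : R[i] := (u 0 (inord 2) +i* u 0 (inord 3))%C.

(* dx1 /\ dy1 + dx2 /\ dy2 *)
Definition omega (u v : R4) : R :=
    (u 0 (inord 0) * v 0 (inord 1) - u 0 (inord 1) * v 0 (inord 0))
  + (u 0 (inord 2) * v 0 (inord 3) - u 0 (inord 3) * v 0 (inord 2)).

(* dz1 /\ dz2 *)
Definition Omega (u v : R4) : R[i] := z1 u * z2 v - z2 u * z1 v.

End C2.

(** * Local geometry of a parametrized surface [X : R^2 -> R^4] *)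

Section Local.
Context {R : realType}.
Notation R4 := 'rV[R]_4.
Implicit Types (X : R * R -> R4) (x : R * R).

Definition dpar X (a : 'I_2) x : R4 := 'D_(e_ a) X x.
Definition ddpar X (a b : 'I_2) x : R4 := 'D_(e_ b) (dpar X a) x.

Definition differential X x : 'M[R]_(2, 4) := \matrix_(a, k) dpar X a x 0 k.

Definition metric X x : 'M[R]_2 := \matrix_(a, b) dot (dpar X a x) (dpar X b x).
Definition imetric X x : 'M[R]_2 := invmx (metric X x).
Definition area_density X x : R := Num.sqrt (\det (metric X x)).

Definition normal_part X x (v : R4) : R4 :=
  v - \sum_a \sum_b (imetric X x a b * dot v (dpar X a x)) *: dpar X b x.

Definition second_ff X x (a b : 'I_2) : R4 := normal_part X x (ddpar X a b x).

Definition mean_curv X x : R4 :=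
  \sum_a \sum_b imetric X x a b *: second_ff X x a b.

Definition normA2 X x : R :=
  \sum_a \sum_b \sum_c \sum_d imetric X x a c * imetric X x b d *
    dot (second_ff X x a b) (second_ff X x c d).

Definition normH2 X x : R := dot (mean_curv X x) (mean_curv X x).

Definition lagrangian_at X x : Prop :=
  forall a b, omega (dpar X a x) (dpar X b x) = 0.

(* Omega restricted to the surface is e^{i theta} times the area form, both
   evaluated on the positively oriented coordinate frame. *)
Definition lagrangian_angle X x (theta : R) : Prop :=
  Omega (dpar X 0 x) (dpar X 1 x) =
    (cos theta +i* sin theta)%C * (area_density X x)%:C%C.

Lemma det_mx2 (M : 'M[R]_2) : \det M = M 0 0 * M 1 1 - M 0 1 * M 1 0.
Proof.
rewrite (expand_det_row _ 0) !big_ord_recl big_ord0 /cofactor !det_mx11 !mxE.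
have -> : lift 0 0 = 1 :> 'I_2 by apply/val_inj.
have -> : lift 1 0 = 0 :> 'I_2 by apply/val_inj.
by rewrite /= expr0 expr1 mul1r addr0 mulN1r mulrN.
Qed.

Lemma dotE (u v : R4) : dot u v =
  u 0 (inord 0) * v 0 (inord 0) + u 0 (inord 1) * v 0 (inord 1) +
  u 0 (inord 2) * v 0 (inord 2) + u 0 (inord 3) * v 0 (inord 3).
Proof.
rewrite /dot (eq_bigr (fun k : 'I_4 => u 0 (inord k) * v 0 (inord k))); last first.
  by move=> k _; rewrite inord_val.
by rewrite !big_ord_recl big_ord0 addr0 !addrA.
Qed.

Lemma lagrange_C2 (u v : R4) :
  dot u u * dot v v - dot u v * dot v u =
  complex.Re (Omega u v) ^+ 2 + complex.Im (Omega u v) ^+ 2 + omega u v ^+ 2.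
Proof.
rewrite !dotE /omega /Omega /z1 /z2.
move: (u 0 (inord 0)) (u 0 (inord 1)) (u 0 (inord 2)) (u 0 (inord 3)) => a b c d.
move: (v 0 (inord 0)) (v 0 (inord 1)) (v 0 (inord 2)) (v 0 (inord 3)) => e f g h.
simpc => /=.
ring.
Qed.

(* The Lagrangian angle exists at every point of a Lagrangian surface, since
   |Omega(u, v)|^2 + omega(u, v)^2 is the Gram determinant of (u, v). *)
Lemma lagrangian_angle_exists X x :
  lagrangian_at X x -> exists theta, lagrangian_angle X x theta.
Proof.
move=> /(_ 0 1) lag.
set u := dpar X 0 x; set v := dpar X 1 x.
set d := \det (metric X x).
set z := Omega u v.
have dE : complex.Re z ^+ 2 + complex.Im z ^+ 2 = d.
  by rewrite /d det_mx2 !mxE -/u -/v lagrange_C2 lag expr0n addr0.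
have d0 : 0 <= d by rewrite -dE addr_ge0 ?sqr_ge0.
suff [theta [cE sE]] : exists theta,
    complex.Re z = cos theta * Num.sqrt d /\ complex.Im z = sin theta * Num.sqrt d.
  exists theta; rewrite /lagrangian_angle -/u -/v -/z /area_density -/d.
  by case: (z) cE sE => a b /= -> ->; simpc.
have [d00|dn0] := eqVneq d 0.
  exists 0; move: dE; rewrite d00 sqrtr0 !mulr0 => /eqP.
  by rewrite paddr_eq0 ?sqr_ge0 // !sqrf_eq0 => /andP[/eqP -> /eqP ->].
have sd0 : Num.sqrt d != 0 by rewrite sqrtr_eq0 -ltNge lt_neqAle eq_sym dn0.
set a := complex.Re z / Num.sqrt d; set b := complex.Im z / Num.sqrt d.
have ab : a ^+ 2 + b ^+ 2 = 1.
  by rewrite !expr_div_n -mulrDl dE sqr_sqrtr // divff.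
have a1 : -1 <= a <= 1.
  rewrite -ler_norml -(@expr_le1 _ 2) // real_normK ?num_real //.
  by rewrite -ab lerDl sqr_ge0.
have sb : Num.sqrt (1 - a ^+ 2) = `|b|.
  by rewrite -ab [a ^+ 2 + _]addrC addrK sqrtr_sqr.
exists (if 0 <= b then acos a else - acos a).
have -> : cos (if 0 <= b then acos a else - acos a) = a.
  by case: ifP => _; rewrite ?cosN acosK // in_itv.
have -> : sin (if 0 <= b then acos a else - acos a) = b.
  case: ifPn => b0; rewrite ?sinN sin_acos // sb; first by rewrite ger0_norm.
  by rewrite ltr0_norm ?opprK // ltNge.
by rewrite !divfK.
Qed.

End Local.

(** * Immersed surfaces in C^2 *)

Section Immersed.
Context {R : realType} (S : surface R).
Notation R4 := 'rV[R]_4.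
Implicit Types (f : S -> R4).

Definition immersion f : Prop :=
  forall i, smooth_on (sdom S i) (f \o spar i) /\
    forall x, sdom S i x -> row_free (differential (f \o spar i) x).

Definition lagrangian f : Prop :=
  forall i x, sdom S i x -> lagrangian_at (f \o spar i) x.

(* The set of values of cos theta on the surface. *)
Definition cos_angles f : set R :=
  [set c | exists i x theta, [/\ sdom S i x,
     lagrangian_angle (f \o spar i) x theta & c = cos theta]].

Definition almost_calibrated f : Prop := forall c, cos_angles f c -> 0 < c.

(* The area of B for the metric induced by f.  The chart images are made
   disjoint by removing from the k-th one all the earlier ones; the value does
   not depend on the atlas.  Area is measured on the abstract surface, so the
   image is counted with multiplicity. *)
Definition area f (B : set S) : \bar R :=
  (\sum_(0 <= k <oo)
     \int[lebesgue_measure \x lebesgue_measure]_(x in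
        [set x | [/\ sdom S k x, B (spar k x)
                   & forall j, (j < k)%N -> ~ simg S j (spar k x)]])
       (area_density (f \o spar k) x)%:E)%E.

Definition smooth_curve (gamma : R -> S) : Prop :=
  forall s, s \in `[0, 1] -> exists i (W : set R),
    [/\ open W, W s,
        forall r, W r -> r \in `[0, 1] -> simg S i (gamma r)
      & smooth_on (W `&` `[0, 1]) (scoord i \o gamma)].

Definition curve_length f (gamma : R -> S) : \bar R :=
  (\int[lebesgue_measure]_(s in `]0%R, 1%R[) (enorm ('D_1 (f \o gamma) s))%:E)%E.

(* Distance of the induced metric; +oo between different components.  Smooth
   curves may have zero velocity, so they give the same infimum as piecewise
   smooth ones. *)
Definition dist f (p q : S) : \bar R :=
  ereal_inf [set curve_length f gamma | gamma in
    [set gamma | [/\ smooth_curve gamma, gamma 0 = p & gamma 1 = q]]].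

Definition complete_metric f : Prop :=
  forall u : nat -> S,
    (forall e : R, 0 < e -> exists N : nat, forall m n : nat,
       (N <= m)%N -> (N <= n)%N -> (dist f (u m) (u n) < e%:E)%E) ->
    exists p, forall e : R, 0 < e -> exists N : nat, forall n : nat,
       (N <= n)%N -> (dist f (u n) p < e%:E)%E.

End Immersed.

(** * Mean curvature flow for t in (-oo, 0] *)

Section Flow.
Context {R : realType} (S : surface R).
Notation R4 := 'rV[R]_4.

(* Only the values [F t] with t <= 0 matter.  The time derivative is the limit
   of difference quotients over times in (-oo, 0], one-sided at t = 0. *)
Definition ancient_mcf (F : R -> S -> R4) : Prop :=
  [/\ forall i, smooth_on [set tx : R * (R * R) | tx.1 <= 0 /\ sdom S i tx.2]
                          (fun tx => F tx.1 (spar i tx.2)),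
      forall t, t <= 0 -> immersion (F t)
    & forall t i x, t <= 0 -> sdom S i x ->
        (s^-1 *: (F (t + s) (spar i x) - F t (spar i x)))
          @[s --> within [set s | t + s <= 0] (dnbhs 0)]
        --> mean_curv (F t \o spar i) x].

(* Supremum and infimum over space-time, taken in the extended reals. *)
Definition sup_normA2 (F : R -> S -> R4) : \bar R :=
  ereal_sup [set a | exists t i x, [/\ t <= 0, sdom S i x
                       & a = (normA2 (F t \o spar i) x)%:E]].

Definition sup_normH2 (F : R -> S -> R4) : \bar R :=
  ereal_sup [set a | exists t i x, [/\ t <= 0, sdom S i x
                       & a = (normH2 (F t \o spar i) x)%:E]].

Definition inf_cos_angle (F : R -> S -> R4) : \bar R :=
  ereal_inf [set a | exists t c, [/\ t <= 0, cos_angles (F t) c & a = c%:E]].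

End Flow.

(* Main.v *)
(** Write theta for the Lagrangian angle, psi = - ln (cos theta) and, for a < 1,
    u = a |H|^2 / 2 + psi.  Along the flow theta solves the heat equation and
    |d theta| = |H|, so that psi satisfies (d/dt - Delta) psi <= - |H|^2, while
    |A| <= 1 gives (d/dt - Delta) |H|^2 / 2 <= |H|^2.  Hence u is a subsolution,
    with (d/dt - Delta) u <= - (1 - a) |H|^2.

    Let (p0, t0) nearly maximize u over the times t < 0.  Since |A| <= 1, the
    orthogonal projection to the tangent plane at p0 is invertible over a disc of
    fixed radius: completeness allows every ray of the disc to be lifted, because
    the Jacobian of the projection varies slowly along the lift.  The closed disc
    lifts to a compact sheet.  Over this sheet and a short time interval ending at
    t0, the function u - k |F - F(p0, t0)|^2 + l t attains its maximum; for k and l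
    proportional to the defect of (p0, t0), that maximum is not on the parabolic
    boundary, as |H|^2 <= 2 bounds the speed of the flow.  There the maximum
    principle gives (1 - a) |H|^2 <= 4 k + l, hence u <= sup psi + o(1).  Therefore
    sup u <= - ln delta for every a < 1, and a -> 1 gives |H|^2 / 2 <= - ln delta. *)
Require Import Defs.
From HB Require Import structures.
From mathcomp Require Import all_boot all_order all_algebra.
From mathcomp Require Import all_classical all_reals all_analysis.
From mathcomp Require Import complex ring lra.

Set Implicit Arguments.
Unset Strict Implicit.
Unset Printing Implicit Defensive.

Import Order.TTheory GRing.Theory Num.Theory.
Import numFieldNormedType.Exports.
Local Open Scope classical_set_scope.
Local Open Scope ring_scope.

(** * Calculus of smooth maps *)

(** The immersions need not be proper: a Euclidean ball may meet infinitely many branches of the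
    surface, and a maximum over it need not exist. One branch is isolated instead, as a graph over
    the tangent plane of p0 at time t0. The quantity followed along a lifted ray is the squared
    Jacobian J of the projection, because its derivative is at most sqrt 8 times the speed of the
    projected ray whatever the value of J; so J, which is 1 at p0, stays above 1/2 over a disc of
    radius 1/8. The angle theta exists only pointwise, so the computation uses tan theta, a quotient
    of smooth functions, and psi = ln (1 + tan^2 theta) / 2. The inequality for |H|^2 avoids the
    evolution of the metric and of A: (det g) |H|^2 is expressed by derivatives of F in fixed
    coordinate directions, and this identity is differentiated in time. The maximum principle runs
    at times t < 0, where space-time is open and time derivatives are two-sided. At t = 0 the bound
    comes from the displacement of points over short times. *)

Section SmoothFunctions.
Context {R : realType}.
Implicit Types (V W : normedModType R).

Lemma near_eq_differentiable V W (f g : V -> W) (x : V) :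
  (\near x, f x = g x) -> differentiable f x -> differentiable g x.
Proof.
move=> fg df; have fgx : f x = g x by exact: (nbhs_singleton fg).
have [dfc /eqaddoP dfo] := (diff_locallyP _ _).1 df.
have sg : \forall h \near (0 : V), f (h + x) = g (h + x).
  have : shift x h @[h --> (0 : V)] --> nbhs x.
    rewrite -[X in _ --> nbhs X]add0r.
    by apply: cvgD; [exact: cvg_id|exact: cvg_cst].
  by move=> /(_ _ fg).
have dgo : g \o shift x = cst (g x) + 'd f x +o_ 0 id.
  apply/eqaddoP => e e0; have := dfo _ e0; apply: filterS2 sg => h /= sgh.
  by rewrite !fctE /= sgh fgx.
by apply/diff_locallyP; rewrite (diff_unique dfc dgo).
Unshelve. all: by end_near. Qed.

Lemma Cn_on_continuous V W n (U : set V) (f : V -> W) :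
  Cn_on n U f -> forall x, U x -> {for x, continuous f}.
Proof.
case: n => [//|n] [df _] x Ux.
exact/differentiable_continuous/df.
Qed.

Lemma Cn_on_sub V W n (U U' : set V) (f : V -> W) :
  U' `<=` U -> Cn_on n U f -> Cn_on n U' f.
Proof.
move=> sub; elim: n f => [|n IH] f /=; first by move=> cf x /sub /cf.
by move=> [df Df]; split=> [x /sub /df //|v]; apply: IH.
Qed.

Lemma Cn_onW V W n (U : set V) (f : V -> W) : Cn_on n.+1 U f -> Cn_on n U f.
Proof.
elim: n f => [|n IH] f; first by move=> [df _] x /df/differentiable_continuous.
by move=> [df Df]; split=> // v; apply: IH.
Qed.

Lemma Cn_on_local V W n (U : set V) (f : V -> W) :
  (forall x, U x -> exists2 A, nbhs x A & Cn_on n A f) -> Cn_on n U f.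
Proof.
elim: n f => [|n IH] f loc /=.
  by move=> x /loc[A Ax cf]; apply: cf; exact: nbhs_singleton.
split=> [x /loc[A Ax [df _]]|v]; first by apply: df; exact: nbhs_singleton.
by apply: IH => x /loc[A Ax [_ Df]]; exists A => //; exact: Df.
Qed.

Lemma Cn_on_eq V W n (U : set V) (f g : V -> W) : open U ->
  (forall x, U x -> f x = g x) -> Cn_on n U f -> Cn_on n U g.
Proof.
move=> oU; elim: n f g => [|n IH] f g fg /=.
  move=> cf x Ux; have xU : nbhs x U by exact: open_nbhs_nbhs.
  rewrite /prop_for /continuous_at -fg//.
  apply: cvg_trans (cf _ Ux); apply: near_eq_cvg.
  by apply: filterS xU => y /fg.
have nfg x : U x -> \near x, f x = g x.
  by move=> Ux; apply: filterS (open_nbhs_nbhs (conj oU Ux)) => y /fg.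
move=> [df Df]; split=> [x Ux|v].
  exact: near_eq_differentiable (nfg _ Ux) (df _ Ux).
by apply: IH (Df v) => x Ux; apply: near_eq_derive (nfg _ Ux).
Qed.

Lemma derive_lin_comp V W W' (L : {linear W -> W'}) (f : V -> W) x v :
  continuous L -> differentiable f x -> 'D_v (L \o f) x = L ('D_v f x).
Proof.
move=> cL df.
have dL : differentiable L (f x) by exact: linear_differentiable.
rewrite deriveE; last exact: differentiable_comp.
by rewrite diff_comp //= diff_lin // deriveE.
Qed.

Lemma Cn_on_lin V W W' (L : {linear W -> W'}) n (U : set V) (f : V -> W) :
  open U -> continuous L -> Cn_on n U f -> Cn_on n U (L \o f).
Proof.
move=> oU cL; elim: n f => [|n IH] f /=.
  by move=> cf x Ux; apply: continuous_comp; [exact: cf|exact: cL].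
move=> [df Df]; split=> [x Ux|v].
  by apply: differentiable_comp; [exact: df|exact: linear_differentiable].
apply: (Cn_on_eq oU) (IH _ (Df v)) => x Ux.
by rewrite derive_lin_comp //; exact: df.
Qed.

Lemma Cn_on_cst V W n (U : set V) (w : W) : Cn_on n U (cst w).
Proof.
elim: n w => [|n IH] w /=; first by move=> x _; exact: cst_continuous.
split=> [x _|v]; first exact: differentiable_cst.
have -> : 'D_v (cst w : V -> W) = cst 0 by apply/funext => x; rewrite derive_cst.
exact: IH.
Qed.

Lemma Cn_on_id V n (U : set V) : Cn_on n U (@idfun V).
Proof.
case: n => [|n] /=; first by move=> x _; exact: cvg_id.
split=> [x _|v].
  by have /@ex_diff := @is_diff_id _ V x.
have -> : 'D_v (@idfun V) = cst v by apply/funext => x; rewrite derive_id.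
exact: Cn_on_cst.
Qed.

Lemma Cn_onD V W n (U : set V) (f g : V -> W) : open U ->
  Cn_on n U f -> Cn_on n U g -> Cn_on n U (fun x => f x + g x).
Proof.
move=> oU; elim: n f g => [|n IH] f g /=.
  by move=> cf cg x Ux; apply: cvgD; [exact: cf|exact: cg].
move=> [df Df] [dg Dg]; split=> [x Ux|v].
  by apply: differentiableD; [exact: df|exact: dg].
apply: (Cn_on_eq oU) (IH _ _ (Df v) (Dg v)) => x Ux.
by rewrite deriveD //; apply: diff_derivable; [exact: df|exact: dg].
Qed.

Lemma Cn_onM V n (U : set V) (f g : V -> R) : open U ->
  Cn_on n U f -> Cn_on n U g -> Cn_on n U (fun x => f x * g x).
Proof.
move=> oU; elim: n f g => [|n IH] f g.
  by move=> cf cg x Ux; apply: cvgM; [exact: cf|exact: cg].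
move=> cf cg; have [cf' cg'] := (Cn_onW cf, Cn_onW cg).
case: cf cg => [df Df] [dg Dg]; split=> [x Ux|v].
  by apply: differentiableM; [exact: df|exact: dg].
apply: (Cn_on_eq oU) (Cn_onD oU (IH _ _ cf' (Dg v)) (IH _ _ cg' (Df v))) => x Ux.
by rewrite deriveM //; apply: diff_derivable; [exact: df|exact: dg].
Qed.

Lemma Cn_onN V n (U : set V) (f : V -> R) : open U ->
  Cn_on n U f -> Cn_on n U (fun x => - f x).
Proof.
move=> oU cf; apply: (Cn_on_eq oU) (Cn_onM oU (Cn_on_cst n U (-1 : R)) cf) => x _.
by rewrite mulN1r.
Qed.

Lemma Cn_onV V n (U : set V) (f : V -> R) : open U -> (forall x, U x -> f x != 0) ->
  Cn_on n U f -> Cn_on n U (fun x => (f x)^-1).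
Proof.
move=> oU f0; elim: n => [|n IH].
  by move=> cf x Ux; apply: cvgV; [exact: f0|exact: cf].
move=> cf; have /IH cf' := Cn_onW cf.
case: cf => [df Df]; split=> [x Ux|v].
  by apply: differentiableV; [exact: df|exact: f0].
have cf2 := Cn_onN oU (Cn_onM oU (Cn_onM oU cf' cf') (Df v)).
apply: (Cn_on_eq oU) cf2 => x Ux.
rewrite deriveV //; [|exact: f0|exact/diff_derivable/df].
by rewrite -invfM -expr2 -mulNr.
Qed.

Lemma Cn_on_pair V W W' n (U : set V) (f : V -> W) (g : V -> W') : open U ->
  Cn_on n U f -> Cn_on n U g -> Cn_on n U (fun x => (f x, g x)).
Proof.
move=> oU; elim: n f g => [|n IH] f g /=.
  by move=> cf cg x Ux; apply: cvg_pair; [exact: cf|exact: cg].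
move=> [df Df] [dg Dg]; split=> [x Ux|v].
  by apply: differentiable_pair; [exact: df|exact: dg].
apply: (Cn_on_eq oU) (IH _ _ (Df v) (Dg v)) => x Ux.
have [df' dg'] := (df _ Ux, dg _ Ux).
rewrite [in RHS]deriveE; last exact: differentiable_pair.
by rewrite diff_pair // !deriveE.
Qed.

Lemma Cn_on_fst V W W' n (U : set V) (f : V -> W * W') : open U ->
  Cn_on n U f -> Cn_on n U (fun x => (f x).1).
Proof.
move=> oU cf.
have lin1 : linear (fst : (W * W')%type -> W) by move=> a [x y] [x' y'].
pose fstM := GRing.isLinear.Build _ _ _ _ _ lin1.
pose fstL : {linear _ -> _} := HB.pack (fst : (W * W')%type -> W) fstM.
by apply: (@Cn_on_lin _ _ _ fstL) cf => // x; exact: cvg_fst.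
Qed.

Lemma Cn_on_snd V W W' n (U : set V) (f : V -> W * W') : open U ->
  Cn_on n U f -> Cn_on n U (fun x => (f x).2).
Proof.
move=> oU cf.
have lin2 : linear (snd : (W * W')%type -> W') by move=> a [x y] [x' y'].
pose sndM := GRing.isLinear.Build _ _ _ _ _ lin2.
pose sndL : {linear _ -> _} := HB.pack (snd : (W * W')%type -> W') sndM.
by apply: (@Cn_on_lin _ _ _ sndL) cf => // x; exact: cvg_snd.
Qed.

Lemma derive_fst V W W' (f : V -> W * W') x v :
  differentiable f x -> ('D_v f x).1 = 'D_v (fst \o f) x.
Proof.
move=> df.
have lin1 : linear (fst : (W * W')%type -> W) by move=> a [y z] [y' z'].
pose fstM := GRing.isLinear.Build _ _ _ _ _ lin1.
pose fstL : {linear _ -> _} := HB.pack (fst : (W * W')%type -> W) fstM.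
by rewrite (@derive_lin_comp _ _ _ fstL) // => y; exact: cvg_fst.
Qed.

Lemma derive_snd V W W' (f : V -> W * W') x v :
  differentiable f x -> ('D_v f x).2 = 'D_v (snd \o f) x.
Proof.
move=> df.
have lin2 : linear (snd : (W * W')%type -> W') by move=> a [y z] [y' z'].
pose sndM := GRing.isLinear.Build _ _ _ _ _ lin2.
pose sndL : {linear _ -> _} := HB.pack (snd : (W * W')%type -> W') sndM.
by rewrite (@derive_lin_comp _ _ _ sndL) // => y; exact: cvg_snd.
Qed.

Lemma e_E (w : R * R) : w = w.1 *: e_ 0 + w.2 *: e_ 1.
Proof.
case: w => a b; rewrite /e_ /=.
by apply/eqP; rewrite -pair_eqE /= !scaler0 addr0 add0r [_%:A]mulr1 [_%:A]mulr1 !eqxx.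
Qed.

Lemma derive_e W (f : R * R -> W) x (w : R * R) : differentiable f x ->
  'D_w f x = w.1 *: 'D_(e_ 0) f x + w.2 *: 'D_(e_ 1) f x.
Proof. by move=> df; rewrite !deriveE // {1}(e_E w) linearD !linearZ. Qed.

Lemma derive_comp V W W' (x : V -> W) (f : W -> W') s v :
  differentiable x s -> differentiable f (x s) ->
  'D_v (f \o x) s = 'D_('D_v x s) f (x s).
Proof.
move=> dx df; rewrite !deriveE //; last exact: differentiable_comp.
by rewrite diff_comp.
Qed.

(** The inner map is planar, so the chain rule is a sum over the two partial derivatives of [f]. The
    induction is applied to these partial derivatives, hence the assumption on [f] at every
    order. *)
Lemma Cn_on_planar_comp V n (U : set V) (D : set (R * R)) (x : V -> R * R)
    (f : R * R -> R) : open U -> (forall s, U s -> D (x s)) ->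
  (forall m, Cn_on m D f) -> Cn_on n U x -> Cn_on n U (f \o x).
Proof.
move=> oU UD; elim: n f => [|n IH] f cf cx.
  move=> s Us; apply: continuous_comp; first exact: cx.
  exact: (cf 0%N _ (UD _ Us)).
have [df _] := cf 1%N; have [dx Dx] := cx; have cx' := Cn_onW cx.
split=> [s Us|v].
  by apply: differentiable_comp; [exact: dx|exact/df/UD].
have cD a : Cn_on n U ('D_(e_ a) f \o x).
  by apply: IH => // m; have [_] := cf m.+1; exact.
apply: (Cn_on_eq oU) (Cn_onD oU
  (Cn_onM oU (Cn_on_fst oU (Dx v)) (cD 0)) (Cn_onM oU (Cn_on_snd oU (Dx v)) (cD 1))).
move=> s Us; rewrite [RHS](@derive_comp _ _ _ x f); [|exact: dx|exact/df/UD].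
by rewrite [in RHS]derive_e; last exact/df/UD.
Qed.

Lemma is_derive_line V W (f : V -> W) x v s : differentiable f (x + s *: v) ->
  is_derive s 1 (fun r => f (x + r *: v)) ('D_v f (x + s *: v)).
Proof.
move=> df.
have dl : is_diff s (fun r : R => x + r *: v) ( *:%R^~ v).
  have -> : (fun r : R => x + r *: v) = cst x + ( *:%R^~ v : R -> V) by [].
  by apply: is_diff_eq; rewrite add0r.
apply: DeriveDef.
  by apply/diff_derivable/differentiable_comp; [exact: ex_diff|].
have vE : 'D_1 (fun r : R => x + r *: v) s = v.
  by rewrite deriveE ?diff_val ?scale1r //; exact: ex_diff.
by rewrite (@derive_comp _ _ _ (fun r : R => x + r *: v) f s 1) ?vE //; exact: ex_diff.
Qed.

End SmoothFunctions.

(** * Symmetry of second derivatives and derivative tests at a maximum *)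

Section SecondOrder.
Context {R : realType}.
Implicit Types (V W : normedModType R).

Lemma mvt (f df : R -> R) (a b : R) : a < b ->
  (forall x, a <= x <= b -> is_derive x 1 f (df x)) ->
  exists2 c, a < c < b & f b - f a = df c * (b - a).
Proof.
move=> ab fdf; have [x||c cab cE] := @MVT R f df a b ab.
- by rewrite in_itv /= => /andP[ax xb]; apply: fdf; rewrite !ltW.
- apply: derivable_within_continuous => x; rewrite in_itv /= => xab.
  by have [] := fdf _ xab.
by exists c => //; move: cab; rewrite in_itv.
Qed.

(** The mean value theorem is used twice: in the direction [u] for the increment [a] of [f] along
    [v], then in the direction [v] for ['D_u f]. *)
Lemma second_difference V (f : V -> R) (N : set V) (x u v : V) (h : R) : 0 < h ->
  Cn_on 2 N f -> (forall s r, 0 <= s <= h -> 0 <= r <= h -> N (x + s *: u + r *: v)) ->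
  exists2 y, N y & f (x + h *: u + h *: v) - f (x + h *: u) - f (x + h *: v) + f x
    = 'D_v ('D_u f) y * h * h.
Proof.
move=> h0 [df Df] Nxy.
have [dDf _] := Df u.
have hh : 0 <= h <= h by rewrite lexx ltW.
have h00 : 0 <= (0 : R) <= h by rewrite lexx ltW.
pose a s := f (x + h *: v + s *: u) - f (x + s *: u).
have der s : 0 <= s <= h -> is_derive s 1 a
    ('D_u f (x + h *: v + s *: u) - 'D_u f (x + s *: u)).
  move=> sh; apply: is_deriveB; apply: is_derive_line; apply: df.
    by rewrite -addrA [h *: v + _]addrC addrA; exact: Nxy.
  by rewrite -[_ + s *: u]addr0 -(scale0r v); exact: Nxy.
have [s s0h sE] := @mvt a _ 0 h h0 der.
have sh : 0 <= s <= h by case/andP: s0h => s0 sh; rewrite !ltW.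
have der2 r : 0 <= r <= h -> is_derive r 1
    (fun r => 'D_u f (x + s *: u + r *: v)) ('D_v ('D_u f) (x + s *: u + r *: v)).
  by move=> rh; apply: is_derive_line; apply: dDf; exact: Nxy.
have [r r0h rE] := @mvt _ _ 0 h h0 der2.
exists (x + s *: u + r *: v).
  by apply: Nxy => //; case/andP: r0h => r0 rh; rewrite !ltW.
move: sE rE; rewrite /a !subr0 !scale0r !addr0 => sE rE.
have -> : x + h *: u + h *: v = x + h *: v + h *: u by rewrite addrAC.
rewrite [x + s *: u + h *: v]addrAC in rE.
by rewrite -rE -sE; ring.
Qed.

Lemma eq_of_near_values V (A B : V -> R) (x : V) :
  {for x, continuous A} -> {for x, continuous B} ->
  (forall N, nbhs x N -> exists y z, [/\ N y, N z & A z = B y]) -> A x = B x.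
Proof.
move=> cA cB near_val; apply/eqP; rewrite -subr_eq0 -normr_eq0.
rewrite eq_le normr_ge0 andbT; apply/ler_addgt0Pl => e e0; rewrite addr0.
have e20 : 0 < e / 2 by rewrite divr_gt0.
have nA : \forall y \near x, `|A x - A y| < e / 2.
  by have /cvgrPdist_lt/(_ _ e20) := cA.
have nB : \forall y \near x, `|B x - B y| < e / 2.
  by have /cvgrPdist_lt/(_ _ e20) := cB.
have [y [z [[_ By] [Az _] zy]]] := near_val _ (filterI nA nB).
have -> : A x - B x = (A x - A z) - (B x - B y) by rewrite zy; ring.
by rewrite (le_trans (ler_normB _ _)) // [e]splitr ltW // ltrD.
Qed.

Lemma nbhs_parallelogram V (N : set V) (x u v : V) : nbhs x N ->
  exists2 h : R, 0 < h &
    forall s r, 0 <= s <= h -> 0 <= r <= h -> N (x + s *: u + r *: v).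
Proof.
move=> nN.
have cl : (x + p.1 *: u + p.2 *: v) @[p --> ((0, 0) : R * R)] --> x.
  rewrite -[X in _ --> nbhs X](addr0 x) -[X in _ --> nbhs X]addr0.
  apply: cvgD; first apply: cvgD; first exact: cvg_cst.
    by rewrite -(scale0r u); apply: cvgZr_tmp; exact: cvg_fst.
  by rewrite -(scale0r v); apply: cvgZr_tmp; exact: cvg_snd.
have /nbhs_ballP[d /= d0 dN] := cl _ nN.
have h0 : 0 < d / 2 by rewrite divr_gt0.
exists (d / 2) => // s r sh rh.
have lt z : 0 <= z <= d / 2 -> `|0 - z| < d.
  move=> /andP[z0 zd]; rewrite sub0r normrN ger0_norm //.
  by apply: le_lt_trans zd _; rewrite ltr_pdivrMr // ltr_pMr // ltr1n.
by apply: (dN (s, r)); split; apply: lt.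
Qed.

(** The mixed second difference is symmetric in [u] and [v], so in every neighbourhood of [x] some
    value of one mixed derivative is also a value of the other. Continuity then identifies them at
    [x]. *)
Lemma derive_sym V (f : V -> R) (U : set V) (x u v : V) : open U -> U x ->
  Cn_on 2 U f -> 'D_u ('D_v f) x = 'D_v ('D_u f) x.
Proof.
move=> oU Ux cf; have [_ Df] := cf.
apply: (@eq_of_near_values _ ('D_u ('D_v f)) ('D_v ('D_u f)) x) => [||N nN].
- by have [_ cD] := Df v; exact: (cD u).
- by have [_ cD] := Df u; exact: (cD v).
have nNU : nbhs x (N `&` U) by apply: filterI nN _; exact: open_nbhs_nbhs.
have [h h0 Nh] := nbhs_parallelogram u v nNU.
have [h' h'0 Nh'] := nbhs_parallelogram v u nNU.
pose k := Num.min h h'; have k0 : 0 < k by rewrite lt_min h0 h'0.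
have cN : Cn_on 2 (N `&` U) f by apply: Cn_on_sub cf => y [].
have [|y [Ny _] yE] := @second_difference _ f _ x u v k k0 cN.
  move=> s r /andP[s0 sk] /andP[r0 rk]; apply: Nh; apply/andP; split => //.
    by rewrite (le_trans sk) // ge_min lexx.
  by rewrite (le_trans rk) // ge_min lexx.
have [|z [Nz _] zE] := @second_difference _ f _ x v u k k0 cN.
  move=> s r /andP[s0 sk] /andP[r0 rk]; apply: Nh'; apply/andP; split => //.
    by rewrite (le_trans sk) // ge_min lexx orbT.
  by rewrite (le_trans rk) // ge_min lexx orbT.
exists y, z; split; [exact: Ny|exact: Nz|].
have kn0 : k != 0 by rewrite gt_eqF.
apply: (mulIf kn0); apply: (mulIf kn0); apply: (etrans (esym zE)).
apply: (etrans _ yE).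
by rewrite [x + _ *: v + _ *: u]addrAC; ring.
Qed.

Lemma is_derive_near_quotient (f : R -> R) (t l : R) (P : set R) :
  is_derive t 1 f l -> nbhs l P ->
  \forall h \near (0 : R), h != 0 -> P (h^-1 * (f (h + t) - f t)).
Proof.
move=> [dvf <-] lP.
have : \forall h \near 0^', P (h^-1 *: ((f \o shift t) (h *: 1) - f t)).
  exact: (dvf _ lP).
rewrite near_withinE; apply: filterS => h /= hP /hP.
by rewrite [_%:A]mulr1.
Qed.

(** The time half of the parabolic maximum principle: later times are not compared, hence a sign for
    the derivative and not a zero. *)
Lemma local_max_left (f : R -> R) (t l : R) : is_derive t 1 f l ->
  (\forall s \near t, s <= t -> f s <= f t) -> 0 <= l.
Proof.
move=> fl ft; rewrite leNgt; apply/negP => l0.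
have nl : nbhs l [set y : R | y < 0] by exact: lt_nbhsl.
have ft0 : \forall h \near (0 : R), h <= 0 -> f (h + t) <= f t.
  have sh : shift t h @[h --> (0 : R)] --> nbhs t.
    rewrite -[X in _ --> nbhs X]add0r.
    by apply: cvgD; [exact: cvg_id|exact: cvg_cst].
  have ft' : \forall h \near (0 : R), h + t <= t -> f (h + t) <= f t := sh _ ft.
  by apply: filterS ft' => h H h0; apply: H; rewrite gerDr.
have [d /= d0 dP] := (nbhs_ballP _ _).1 (filterI (is_derive_near_quotient fl nl) ft0).
have d2 : 0 < d / 2 by rewrite divr_gt0.
have [] := dP (- (d / 2)).
  rewrite /ball /= sub0r opprK gtr0_norm //.
  by rewrite ltr_pdivrMr // ltr_pMr // ltr1n.
rewrite oppr_eq0 gt_eqF // => /(_ isT) /= + /(_ _)/wrap[].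
  by rewrite oppr_le0 ltW.
move=> q fle; suff : 0 <= (- (d / 2))^-1 * (f (- (d / 2) + t) - f t).
  by rewrite leNgt q.
by apply: mulr_le0; rewrite ?invr_le0 ?oppr_le0 ?subr_le0 // ltW.
Qed.

(** The spatial half: if [l] were positive, [g] would be positive just to the right of 0 and [f]
    would increase there. *)
Lemma local_max_second (f g : R -> R) (l : R) :
  (\forall s \near (0 : R), is_derive (s : R) 1 f (g s)) -> is_derive (0 : R) 1 g l ->
  (\forall s \near (0 : R), f s <= f 0) -> g 0 = 0 /\ l <= 0.
Proof.
move=> fg gl fmax.
have [d /= d0 dP] := (nbhs_ballP _ _).1 (filterI fg fmax).
have dlt s : s \in `]- d, d[ -> ball 0 d s.
  by rewrite in_itv /= /ball /= sub0r normrN ltr_norml.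
have g0 : g 0 = 0.
  have i0 : 0 \in `]- d, d[%R by rewrite in_itv /= oppr_lt0 d0.
  have [||||_ f0] := @derive1_at_max _ f (- d) d 0 => //.
  - by rewrite ge0_cp // ltW.
  - by move=> s /dlt/dP[[]].
  - by move=> s /dlt/dP[].
  by have [[_ <-] _] := dP 0 (dlt _ i0).
split=> //; rewrite leNgt; apply/negP => l0.
have nl : nbhs l [set y : R | 0 < y] by exact: lt_nbhsr.
have [e /= e0 eP] := (nbhs_ballP _ _).1 (is_derive_near_quotient gl nl).
pose h := Num.min d e / 2.
have h0 : 0 < h by rewrite divr_gt0 // lt_min d0 e0.
have hm : h < Num.min d e.
  by rewrite /h ltr_pdivrMr // ltr_pMr ?ltr1n // lt_min d0.
have [hd he] : h < d /\ h < e by move: hm; rewrite lt_min => /andP.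
have gpos c : 0 < c <= h -> 0 < g c.
  move=> /andP[c0 ch]; have := eP c.
  rewrite /ball /= sub0r normrN gtr0_norm // (le_lt_trans ch) // => /(_ isT).
  by rewrite gt_eqF // => /(_ isT); rewrite addr0 g0 subr0 pmulr_rgt0 // invr_gt0.
have dh x : 0 <= x <= h -> is_derive x 1 f (g x).
  move=> /andP[x0 xh]; have [|//] := dP x.
  by rewrite /ball /= sub0r normrN ger0_norm // (le_lt_trans xh).
have [c /andP[c0 ch] cE] := mvt h0 dh.
have [|_ /= fh] := dP h; first by rewrite /ball /= sub0r normrN gtr0_norm.
have : 0 < f h - f 0 by rewrite cE subr0 mulr_gt0 // gpos // c0 ltW.
by rewrite subr_gt0 ltNge fh.
Qed.

End SecondOrder.

(** * Linear algebra of C^2 *)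

Section BilinearForms.
Context {R : realType}.
Implicit Types (V : normedModType R) (u v : 'rV[R]_4) (B : 'rV[R]_4 -> 'rV[R]_4 -> R).

(** Shared by [dot], [omega], [ReOmega] and [ImOmega], so that expansion and the product rule are
    proved once for all four. *)
Record bilin B : Prop := Bilin {
  bilDl : forall u u' v, B (u + u') v = B u v + B u' v;
  bilDr : forall u v v', B u (v + v') = B u v + B u v';
  bilZl : forall a u v, B (a *: u) v = a * B u v;
  bilZr : forall a u v, B u (a *: v) = a * B u v }.

Lemma bil0l B v : bilin B -> B 0 v = 0.
Proof. by move=> bB; rewrite -(scale0r (0 : 'rV_4)) bilZl // mul0r. Qed.

Lemma bil0r B v : bilin B -> B v 0 = 0.
Proof. by move=> bB; rewrite -(scale0r (0 : 'rV_4)) bilZr // mul0r. Qed.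

Lemma bilNl B u v : bilin B -> B (- u) v = - B u v.
Proof. by move=> bB; rewrite -scaleN1r bilZl // mulN1r. Qed.

Lemma bilNr B u v : bilin B -> B u (- v) = - B u v.
Proof. by move=> bB; rewrite -scaleN1r bilZr // mulN1r. Qed.

Lemma bilBl B u u' v : bilin B -> B (u - u') v = B u v - B u' v.
Proof. by move=> bB; rewrite bilDl // bilNl. Qed.

Lemma bilBr B u v v' : bilin B -> B u (v - v') = B u v - B u v'.
Proof. by move=> bB; rewrite bilDr // bilNr. Qed.

Lemma bilE B u v : bilin B ->
  B u v = \sum_i \sum_j u 0 i * v 0 j * B (delta_mx 0 i) (delta_mx 0 j).
Proof.
move=> bB; rewrite {1}(row_sum_delta u).
rewrite (big_morph (B^~ v) (fun x y => bilDl bB x y v) (bil0l v bB)).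
apply: eq_bigr => i _; rewrite bilZl // {1}(row_sum_delta v).
rewrite (big_morph (B _) (fun x y => bilDr bB _ x y) (bil0r _ bB)) mulr_sumr.
by apply: eq_bigr => j _; rewrite bilZr // mulrA.
Qed.

Lemma Cn_on_coord V n (U : set V) (f : V -> 'rV[R]_4) j :
  open U -> Cn_on n U f -> Cn_on n U (fun x => f x 0 j).
Proof.
move=> oU; elim: n f => [|n IH] f /=.
  move=> cf x Ux; apply: (@continuous_comp _ _ _ f (fun M : 'rV_4 => M 0 j)).
    exact: cf.
  exact: coord_continuous.
move=> [df Df]; split=> [x Ux|v].
  apply: (@differentiable_comp _ _ _ _ f (fun M : 'rV_4 => M 0 j)); first exact: df.
  exact: differentiable_coord.
apply: (Cn_on_eq oU) (IH _ (Df v)) => x Ux.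
by rewrite derive_mx ?mxE //; exact/diff_derivable/df.
Qed.

Lemma Cn_on_sum V n (U : set V) m (f : 'I_m -> V -> R) :
  open U -> (forall i, Cn_on n U (f i)) -> Cn_on n U (fun x => \sum_i f i x).
Proof.
move=> oU; elim: m f => [|m IH] f cf.
  apply: (Cn_on_eq oU) (Cn_on_cst n U 0) => x _ /=.
  by rewrite big_ord0.
apply: (Cn_on_eq oU) (Cn_onD oU (cf ord0) (IH _ (fun i => cf (lift ord0 i)))) => x _.
by rewrite big_ord_recl.
Qed.

Lemma Cn_on_bil V n (U : set V) B (f g : V -> 'rV[R]_4) : bilin B ->
  open U -> Cn_on n U f -> Cn_on n U g -> Cn_on n U (fun x => B (f x) (g x)).
Proof.
move=> bB oU cf cg.
pose h x := \sum_i \sum_j f x 0 i * g x 0 j * B (delta_mx 0 i) (delta_mx 0 j).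
apply: (@Cn_on_eq _ _ _ _ _ h) => // [x _|]; first by rewrite [RHS]bilE.
apply: Cn_on_sum => // i; apply: Cn_on_sum => // j.
by do 2?[apply: Cn_onM => //]; [exact: Cn_on_coord|exact: Cn_on_coord|exact: Cn_on_cst].
Qed.

Lemma is_derive_coord V (f : V -> 'rV[R]_4) x w df j :
  is_derive x w f df -> is_derive x w (fun y => f y 0 j) (df 0 j).
Proof.
move=> [dvf <-]; rewrite derive_mx // mxE; apply/derivableP.
by move/derivable_mxP : dvf.
Qed.

Lemma is_derive_bil V B (f g : V -> 'rV[R]_4) x w df dg : bilin B ->
  is_derive x w f df -> is_derive x w g dg ->
  is_derive x w (fun y => B (f y) (g y)) (B df (g x) + B (f x) dg).
Proof.
move=> bB fd gd.
have -> : (fun y => B (f y) (g y)) = \sum_i \sum_j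
   (fun y => f y 0 i * g y 0 j * B (delta_mx 0 i) (delta_mx 0 j)).
  apply/funext => y; rewrite bilE // fct_sumE; apply: eq_bigr => i _.
  by rewrite fct_sumE.
rewrite (bilE df) // (bilE (f x)) // -big_split /=.
apply: is_derive_sum => i; rewrite -big_split /=; apply: is_derive_sum => j.
have fi := is_derive_coord i fd; have gj := is_derive_coord j gd.
set c := B _ _.
have fij : is_derive x w (fun y => f y 0 i * g y 0 j) _ := is_deriveM fi gj.
apply: (is_derive_eq (is_deriveM fij (is_derive_cst c x w))).
rewrite scaler0 add0r /GRing.scale /=; ring.
Qed.

Lemma dot_bil : bilin (@dot R).
Proof.
by split=> [u u' v|u v v'|a u v|a u v]; rewrite !dotE !mxE; ring.
Qed.

Lemma omega_bil : bilin (@omega R).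
Proof.
by split=> [u u' v|u v v'|a u v|a u v]; rewrite /omega !mxE; ring.
Qed.

Definition ReOmega u v : R := complex.Re (Omega u v).
Definition ImOmega u v : R := complex.Im (Omega u v).

Lemma ReOmegaE u v : ReOmega u v =
  u 0 (inord 0) * v 0 (inord 2) - u 0 (inord 1) * v 0 (inord 3)
  - (u 0 (inord 2) * v 0 (inord 0) - u 0 (inord 3) * v 0 (inord 1)).
Proof. by rewrite /ReOmega /Omega /z1 /z2; simpc. Qed.

Lemma ImOmegaE u v : ImOmega u v =
  u 0 (inord 0) * v 0 (inord 3) + u 0 (inord 1) * v 0 (inord 2)
  - (u 0 (inord 2) * v 0 (inord 1) + u 0 (inord 3) * v 0 (inord 0)).
Proof. by rewrite /ImOmega /Omega /z1 /z2; simpc. Qed.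

Lemma ReOmega_bil : bilin ReOmega.
Proof.
by split=> [u u' v|u v v'|a u v|a u v]; rewrite !ReOmegaE !mxE; ring.
Qed.

Lemma ImOmega_bil : bilin ImOmega.
Proof.
by split=> [u u' v|u v v'|a u v|a u v]; rewrite !ImOmegaE !mxE; ring.
Qed.

Lemma dotC u v : dot u v = dot v u.
Proof. by rewrite !dotE; ring. Qed.

Lemma dot_ge0 u : 0 <= dot u u.
Proof. by rewrite dotE; nra. Qed.

Lemma dot_eq0 u : dot u u = 0 -> u = 0.
Proof.
rewrite /dot => /eqP; rewrite psumr_eq0; last by move=> k _; rewrite -expr2 sqr_ge0.
move=> /allP u0; apply/rowP => k; rewrite mxE.
by have /implyP/(_ isT) := u0 k (mem_index_enum _); rewrite mulf_eq0 orbb => /eqP.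
Qed.

Lemma omegaC u v : omega u v = - omega v u.
Proof. by rewrite /omega; ring. Qed.

(** By the Lagrange identity on C^2 the defect is |Omega(u, v)|^2 + omega(u, v)^2. *)
Lemma cauchy_schwarz u v : dot u v ^+ 2 <= dot u u * dot v v.
Proof.
rewrite -subr_ge0 -[X in X - _]addr0.
have -> : dot u u * dot v v + 0 - dot u v ^+ 2 =
  complex.Re (Omega u v) ^+ 2 + complex.Im (Omega u v) ^+ 2 + omega u v ^+ 2.
  by rewrite -lagrange_C2 (dotC v u) expr2 addr0.
by rewrite !addr_ge0 // sqr_ge0.
Qed.

End BilinearForms.

(** * Orthonormal frames of a plane in C^2 *)

Section Frames.
Context {R : realType}.
Implicit Types (X : R * R -> 'rV[R]_4) (x : R * R) (u v : 'rV[R]_4).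

Lemma sum2 (W : nmodType) (f : 'I_2 -> W) : \sum_a f a = f 0 + f 1.
Proof.
rewrite !big_ord_recl big_ord0 addr0; congr (_ + f _).
exact/val_inj.
Qed.

Lemma sum22 (W : nmodType) (f : 'I_2 -> 'I_2 -> W) :
  \sum_a \sum_b f a b = f 0 0 + f 0 1 + (f 1 0 + f 1 1).
Proof. by rewrite !sum2. Qed.

Lemma ord2 (a : 'I_2) : a = 0 \/ a = 1.
Proof. by case: a => [[|[|//]] ia]; [left|right]; exact/val_inj. Qed.

(** The normal component of [v] as soon as [e0], [e1] are orthonormal. *)
Definition npart (e0 e1 v : 'rV[R]_4) := v - dot v e0 *: e0 - dot v e1 *: e1.

Definition free2 u v := forall a b : R, a *: u + b *: v = 0 -> a = 0 /\ b = 0.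

Lemma row_free2 (D : 'I_2 -> 'rV[R]_4) :
  row_free (\matrix_(a, k) D a 0 k) -> free2 (D 0) (D 1).
Proof.
move=> fr a b ab0.
pose v : 'rV[R]_2 := \row_i (if i == 0 then a else b).
have : v *m (\matrix_(a, k) D a 0 k) = 0 *m (\matrix_(a, k) D a 0 k).
  rewrite mul0mx -[RHS]ab0; apply/rowP => k.
  by rewrite mxE sum2 !mxE.
by move/(row_free_inj fr)/rowP => v0; have := v0 0; have := v0 1; rewrite !mxE.
Qed.

Lemma row_free_dpar X x : row_free (differential X x) -> free2 (dpar X 0 x) (dpar X 1 x).
Proof. exact: (@row_free2 (dpar X ^~ x)). Qed.

(** The vector <v, v> u - <u, v> v has squared length <v, v> times the Gram determinant; a zero
    determinant would thus give a linear relation. *)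
Lemma free2_gram_gt0 u v : free2 u v -> 0 < dot u u * dot v v - dot u v ^+ 2.
Proof.
move=> fr; have dB := @dot_bil R.
rewrite lt_def subr_ge0 cauchy_schwarz andbT; apply/eqP => G0.
have : dot (dot v v *: u - dot u v *: v) (dot v v *: u - dot u v *: v) = 0.
  rewrite !(bilBl _ _ _ dB, bilBr _ _ _ dB, bilZl dB, bilZr dB) (dotC v u).
  transitivity (dot v v * (dot u u * dot v v - dot u v ^+ 2)); first by ring.
  by rewrite G0 mulr0.
move/dot_eq0 => /eqP; rewrite -scaleNr => /eqP/fr[v0 _].
have [_ /eqP] : (0 : R) = 0 /\ (1 : R) = 0.
  by apply: fr; rewrite scale0r add0r scale1r; exact: dot_eq0 v0.
by rewrite oner_eq0.
Qed.

Definition gram2 (D : 'I_2 -> 'rV[R]_4) : 'M[R]_2 := \matrix_(a, b) dot (D a) (D b).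

Lemma det_gram2 D : \det (gram2 D) = dot (D 0) (D 0) * dot (D 1) (D 1) - dot (D 0) (D 1) ^+ 2.
Proof. by rewrite det_mx2 !mxE (dotC (D 1)) expr2. Qed.

(** The adjugate of the Gram matrix divided by its determinant. *)
Definition igram2 (D : 'I_2 -> 'rV[R]_4) : 'M[R]_2 := (\det (gram2 D))^-1 *:
  \matrix_(a, b) (if a == 0 then if b == 0 then dot (D 1) (D 1) else - dot (D 0) (D 1)
                 else if b == 0 then - dot (D 0) (D 1) else dot (D 0) (D 0)).

Lemma invmx_gram2 D : free2 (D 0) (D 1) -> invmx (gram2 D) = igram2 D.
Proof.
move=> fr; have G0 : \det (gram2 D) != 0 by rewrite gt_eqF // det_gram2 free2_gram_gt0.
have unitG : gram2 D \in unitmx by rewrite unitmxE unitfE.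
suff MG : igram2 D *m gram2 D = 1%:M by rewrite -[LHS]mul1mx -MG mulmxK.
rewrite /igram2; apply/matrixP => a b; rewrite mxE sum2 !mxE.
move: G0; rewrite det_gram2.
have [->|->] := ord2 a; have [->|->] := ord2 b; rewrite /= ?(dotC (D 1) (D 0));
move: (dot (D 0) (D 0)) (dot (D 0) (D 1)) (dot (D 1) (D 1)) => p q r G0;
by field.
Qed.

(* [l] plays the role of an inverse square root of the metric: its rows are the
   coordinates of a tangent orthonormal frame. *)
Lemma exists_onframe (D : 'I_2 -> 'rV[R]_4) : free2 (D 0) (D 1) ->
  exists l : 'M[R]_2, [/\ \det l != 0,
    forall k k', dot (\sum_a l k a *: D a) (\sum_a l k' a *: D a) = (k == k')%:R &
    forall a b, invmx (gram2 D) a b = \sum_k l k a * l k b].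
Proof.
move=> fr; have dB := @dot_bil R.
have G0 := free2_gram_gt0 fr; rewrite (invmx_gram2 fr) /igram2 det_gram2.
move: G0; set G := _ - _ => G0.
set p := dot (D 0) (D 0); set q := dot (D 0) (D 1); set r := dot (D 1) (D 1).
have GE : G = p * r - q ^+ 2 by [].
have p0 : 0 < p.
  rewrite lt_def dot_ge0 andbT; apply/eqP => pz.
  by move: G0; rewrite GE pz mul0r sub0r oppr_gt0 ltNge sqr_ge0.
have sqrt_pos y : 0 < y -> exists2 z : R, z != 0 & z ^+ 2 = y.
  move=> y0; exists (Num.sqrt y); first by rewrite sqrtr_eq0 -ltNge.
  by rewrite sqr_sqrtr // ltW.
have [s s0 s2] := sqrt_pos p p0.
have [d d0 d2] := sqrt_pos _ (mulr_gt0 p0 G0).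
(* Gram-Schmidt: the rows normalize D 0, of squared length p = s^2, and p D 1 - q D 0, of squared
   length p G = d^2. *)
pose l : 'M[R]_2 := \matrix_(a, b) (if a == 0 then if b == 0 then s^-1 else 0
  else if b == 0 then - q / d else p / d).
exists l; split.
- by rewrite det_mx2 !mxE /= mul0r subr0 !mulf_neq0 ?invr_eq0 // gt_eqF.
- move=> k k'; rewrite !sum2.
  rewrite !(bilDl dB, bilDr dB, bilZl dB, bilZr dB) (dotC (D 1) (D 0)).
  rewrite -/p -/q -/r !mxE.
  have [->|->] := ord2 k; have [->|->] := ord2 k'; rewrite /= ?mulr0 ?mul0r ?addr0.
  + by rewrite -s2; field.
  + by field; rewrite ?s0 ?d0.
  + by field; rewrite ?s0 ?d0.
  + transitivity (p * G / d ^+ 2); first by rewrite GE; field.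
    by rewrite d2 divff // mulf_neq0 ?gt_eqF.
- move=> a b; rewrite sum2 !mxE.
  have [->|->] := ord2 a; have [->|->] := ord2 b; 
    rewrite /= ?mulr0 ?mul0r ?addr0 ?add0r.
  + transitivity (s ^- 2 + q ^+ 2 / d ^+ 2); last by field; rewrite s0 d0.
    by rewrite d2 s2 GE; field; rewrite -?GE ?gt_eqF.
  + transitivity (- (q * p) / d ^+ 2); last by field; rewrite ?s0 ?d0.
    by rewrite d2; field; rewrite -?GE ?gt_eqF.
  + transitivity (- (q * p) / d ^+ 2); last by field; rewrite ?s0 ?d0.
    by rewrite d2; field; rewrite -?GE ?gt_eqF.
  + transitivity (p ^+ 2 / d ^+ 2); last by field; rewrite ?s0 ?d0.
    by rewrite d2; field; rewrite -?GE ?gt_eqF.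
Qed.

Lemma npart_lin (e0 e1 : 'rV[R]_4) (a : R) u v :
  npart e0 e1 (a *: u + v) = a *: npart e0 e1 u + npart e0 e1 v.
Proof.
have dB := @dot_bil R; rewrite /npart !(bilDl dB, bilZl dB).
by apply/rowP => j; rewrite !mxE; ring.
Qed.

Lemma npart0 (e0 e1 : 'rV[R]_4) : npart e0 e1 0 = 0.
Proof. by rewrite /npart !(bil0l _ (@dot_bil R)) !scale0r !subr0. Qed.

Lemma npartZ (e0 e1 : 'rV[R]_4) a u : npart e0 e1 (a *: u) = a *: npart e0 e1 u.
Proof. by rewrite -[a *: u]addr0 npart_lin npart0 addr0. Qed.

Lemma npartD (e0 e1 u v : 'rV[R]_4) :
  npart e0 e1 (u + v) = npart e0 e1 u + npart e0 e1 v.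
Proof. by rewrite -[in LHS](scale1r u) npart_lin scale1r. Qed.

Lemma npart_sum2 (e0 e1 : 'rV[R]_4) (c : 'I_2 -> 'I_2 -> R) (h : 'I_2 -> 'I_2 -> 'rV[R]_4) :
  npart e0 e1 (\sum_a \sum_b c a b *: h a b) =
  \sum_a \sum_b c a b *: npart e0 e1 (h a b).
Proof. by rewrite !sum2 !npartD !npartZ. Qed.

Section ChangeOfFrame.
Variables (D : 'I_2 -> 'rV[R]_4) (h : 'I_2 -> 'I_2 -> 'rV[R]_4) (l g : 'M[R]_2).
Hypothesis gE : forall a b, g a b = \sum_k l k a * l k b.
Let E k := \sum_a l k a *: D a.
Let hh k m := \sum_a \sum_b (l k a * l m b) *: h a b.

(** With g = l^T l, every contraction with the inverse metric of the frame [D] becomes a plain sum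
    over the frame [E]. This and the next two lemmas apply it to the tangential projection, the
    trace and the squared norm. *)
Lemma normal_part_frame v :
  v - \sum_a \sum_b (g a b * dot v (D a)) *: D b = npart (E 0) (E 1) v.
Proof.
have dB := @dot_bil R.
rewrite /npart /E !sum2 !gE !sum2 !(bilDr dB, bilZr dB).
by apply/rowP => j; rewrite !mxE; ring.
Qed.

Lemma trace_frame : \sum_a \sum_b g a b *: npart (E 0) (E 1) (h a b) =
  npart (E 0) (E 1) (hh 0 0) + npart (E 0) (E 1) (hh 1 1).
Proof.
rewrite /hh !sum2 !gE !sum2 !npartD !npartZ.
by apply/rowP => j; rewrite !mxE; ring.
Qed.

Lemma norm_frame (n : 'I_2 -> 'I_2 -> 'rV[R]_4) :
  let nn k m := \sum_a \sum_b (l k a * l m b) *: n a b in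
  \sum_a \sum_b \sum_c \sum_d g a c * g b d * dot (n a b) (n c d) =
  \sum_k \sum_m dot (nn k m) (nn k m).
Proof.
have dB := @dot_bil R.
move=> nn; rewrite /nn !sum2 !gE !sum2 !(bilDr dB, bilZr dB, bilDl dB, bilZl dB).
ring.
Qed.

End ChangeOfFrame.

End Frames.

Local Opaque derive.

(** * Frames and curvature of a parametrized surface *)

Section SmoothParametrization.
Context {R : realType}.
Implicit Types (V : normedModType R) (X : R * R -> 'rV[R]_4) (x : R * R).

Lemma derive_coord V (f : V -> 'rV[R]_4) (x w : V) j :
  derivable f x w -> ('D_w f x) 0 j = 'D_w (fun y => f y 0 j) x.
Proof. by move=> df; rewrite derive_mx // mxE. Qed.

Lemma derive_sym_rV V (f : V -> 'rV[R]_4) (U : set V) (x u v : V) :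
  open U -> U x -> Cn_on 2 U f -> 'D_u ('D_v f) x = 'D_v ('D_u f) x.
Proof.
move=> oU Ux cf.
have swap a b j : ('D_a ('D_b f) x) 0 j = 'D_a ('D_b (fun y => f y 0 j)) x.
  have [df Df] := cf; have [dDf _] := Df b.
  rewrite derive_coord; last exact/diff_derivable/dDf.
  apply: near_eq_derive; apply: filterS (open_nbhs_nbhs (conj oU Ux)) => y Uy.
  by rewrite derive_coord //; exact/diff_derivable/df.
apply/rowP => j; apply: (etrans (swap u v j)); apply: (etrans _ (esym (swap v u j))).
exact: derive_sym oU Ux (Cn_on_coord j oU cf).
Qed.

Lemma derive2_e X (U : set (R * R)) x (v w : R * R) : open U -> U x -> Cn_on 2 U X ->
  'D_v ('D_w X) x = w.1 *: (v.1 *: ddpar X 0 0 x + v.2 *: ddpar X 0 1 x)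
                  + w.2 *: (v.1 *: ddpar X 1 0 x + v.2 *: ddpar X 1 1 x).
Proof.
move=> oU Ux [dX DX].
have dD a : differentiable (dpar X a) x by have [+ _] := DX (e_ a); exact.
have -> : 'D_v ('D_w X) x = 'D_v (w.1 *: dpar X 0 + w.2 *: dpar X 1) x.
  apply: near_eq_derive; apply: filterS (open_nbhs_nbhs (conj oU Ux)) => y Uy.
  by rewrite derive_e //; exact: dX.
have dd a : is_derive x v (dpar X a) (v.1 *: ddpar X a 0 x + v.2 *: ddpar X a 1 x).
  by split; [exact/diff_derivable/dD|exact/derive_e/dD].
by have [_ ->] := is_deriveD (is_deriveZ w.1 (dd 0)) (is_deriveZ w.2 (dd 1)).
Qed.

(** The directions [w 0], [w 1] are constant vectors of the parameter plane whose images are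
    orthonormal at the single point [x]. Derivatives along them therefore commute, and the second
    fundamental form is the normal part of ordinary second derivatives. *)
Record onframe X x (w : 'I_2 -> R * R) : Prop := OnFrame {
  onframe_det : (w 0).1 * (w 1).2 - (w 0).2 * (w 1).1 != 0;
  onframe_dot : forall k k', dot ('D_(w k) X x) ('D_(w k') X x) = (k == k')%:R;
  onframe_normal : forall v, normal_part X x v = npart ('D_(w 0) X x) ('D_(w 1) X x) v;
  onframe_mean : mean_curv X x =
    npart ('D_(w 0) X x) ('D_(w 1) X x) ('D_(w 0) ('D_(w 0) X) x) +
    npart ('D_(w 0) X x) ('D_(w 1) X x) ('D_(w 1) ('D_(w 1) X) x);
  onframe_normA2 : normA2 X x = \sum_k \sum_m
    dot (npart ('D_(w 0) X x) ('D_(w 1) X x) ('D_(w m) ('D_(w k) X) x))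
        (npart ('D_(w 0) X x) ('D_(w 1) X x) ('D_(w m) ('D_(w k) X) x)) }.

Lemma exists_onframe_at X (U : set (R * R)) x : open U -> U x -> Cn_on 2 U X ->
  row_free (differential X x) -> exists w, onframe X x w.
Proof.
move=> oU Ux cX fr.
have [l [l0 lon lE]] := @exists_onframe _ (dpar X ^~ x) (row_free_dpar fr).
pose w k := (l k 0, l k 1).
have dX : differentiable X x by case: cX => + _; exact.
have DE k : 'D_(w k) X x = \sum_a l k a *: dpar X a x by rewrite derive_e // sum2.
have D2E k m : 'D_(w m) ('D_(w k) X) x = \sum_a \sum_b (l k a * l m b) *: ddpar X a b x.
  have := derive2_e (w m) (w k) oU Ux cX; rewrite /w /=.
  move: ('D_(l m 0, l m 1) _ x) => d2 ->; move: (ddpar X) => dd.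
  by rewrite !sum2 !scalerDr !scalerA.
have NE v : normal_part X x v = npart ('D_(w 0) X x) ('D_(w 1) X x) v.
  rewrite !DE -(normal_part_frame _ lE); congr (_ - _).
exists w; split.
- by rewrite det_mx2 in l0.
- by move=> k k'; rewrite !DE lon.
- exact: NE.
- rewrite !D2E !DE -(trace_frame _ _ lE); apply: eq_bigr => a _; apply: eq_bigr => b _.
  by congr (_ *: _); rewrite -!DE -NE.
- rewrite /normA2 (norm_frame lE); apply: eq_bigr => k _; apply: eq_bigr => m _.
  suff -> : npart ('D_(w 0) X x) ('D_(w 1) X x) ('D_(w m) ('D_(w k) X) x) =
     \sum_a \sum_b (l k a * l m b) *: second_ff X x a b by [].
  rewrite D2E npart_sum2; apply: eq_bigr => a _; apply: eq_bigr => b _.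
  by congr (_ *: _); exact/esym/NE.
Qed.

End SmoothParametrization.

Local Transparent derive.

(** * Pointwise identities behind the evolution equations *)

Section PointwiseIdentities.
Context {R : realType}.
Implicit Types (u v x : 'rV[R]_4).

(** The complex structure of C^2, multiplication by i. *)
Definition Jmul u : 'rV[R]_4 := \row_(k < 4) nth 0
  [:: - u 0 (inord 1); u 0 (inord 0); - u 0 (inord 3); u 0 (inord 2)] k.

Lemma dot_Jmul u v : dot (Jmul u) v = omega u v.
Proof. by rewrite dotE /omega !mxE !inordK //=; ring. Qed.

Lemma dot_JmulJmul u v : dot (Jmul u) (Jmul v) = dot u v.
Proof. by rewrite !dotE !mxE !inordK //=; ring. Qed.

Lemma parseval (r : 'I_4 -> 'rV[R]_4) v :
  (forall i j, dot (r i) (r j) = (i == j)%:R) -> \sum_i dot v (r i) ^+ 2 = dot v v.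
Proof.
move=> on; pose O : 'M[R]_4 := \matrix_(i, k) r i 0 k.
have OO : O^T *m O = 1%:M.
  apply: mulmx1C; apply/matrixP => i j; rewrite mxE [RHS]mxE -on /dot.
  by apply: eq_bigr => k _; rewrite !mxE.
have -> : dot v v = (v *m (O^T *m O) *m v^T) 0 0.
  by rewrite OO mulmx1 mxE; apply: eq_bigr => k _; rewrite mxE.
rewrite mulmxA -mulmxA mxE; apply: eq_bigr => i _; rewrite expr2; congr (_ * _).
  by rewrite mxE; apply: eq_bigr => k _; rewrite !mxE.
by rewrite mxE; apply: eq_bigr => k _; rewrite !mxE mulrC.
Qed.

(** On a Lagrangian plane e0, e1, J e0, J e1 is an orthonormal basis of R^4, and the components of a
    normal vector on the last two are omega(e0, v) and omega(e1, v). For v = H this is |d theta| =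
    |H|. *)
Lemma lagrangian_parseval e0 e1 v :
  dot e0 e0 = 1 -> dot e1 e1 = 1 -> dot e0 e1 = 0 -> omega e0 e1 = 0 ->
  dot v e0 = 0 -> dot v e1 = 0 -> omega e0 v ^+ 2 + omega e1 v ^+ 2 = dot v v.
Proof.
move=> e00 e11 e01 o01 v0 v1.
pose r (i : 'I_4) := nth 0 [:: e0; e1; Jmul e0; Jmul e1] i.
rewrite -(@parseval r v); last first.
  have o00 u : omega u u = 0 by rewrite /omega; ring.
  have o10 : omega e1 e0 = 0 by rewrite omegaC o01 oppr0.
  move=> [[|[|[|[|//]]]] ?] [[|[|[|[|//]]]] ?]; rewrite /r /= ?dot_JmulJmul;
    by rewrite ?dot_Jmul ?(dotC _ (Jmul _)) ?dot_Jmul ?e00 ?e11 ?o01 ?o10 ?o00 ?(dotC e1 e0) ?e01.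
rewrite !big_ord_recl big_ord0 /r /= v0 v1 !(dotC v) !dot_Jmul; ring.
Qed.

(** The left side is the imaginary part of Omega(x, v) times the conjugate of Omega(u, v): it is
    |Omega(u, v)|^2 times the rate of change of the argument of Omega(u, v) when [u] moves with
    velocity [x]. In [Omega_second] it is [v] that moves. *)
Lemma Omega_first u v x : omega u v = 0 ->
  ReOmega u v * ImOmega x v - ImOmega u v * ReOmega x v =
  omega u x * dot v v - omega v x * dot u v.
Proof.
move=> o; transitivity (omega u x * dot v v - omega v x * dot u v - dot x v * omega u v).
  by rewrite !ReOmegaE !ImOmegaE /omega !dotE; ring.
by rewrite o mulr0 subr0.
Qed.

Lemma Omega_second u v x : omega u v = 0 ->
  ReOmega u v * ImOmega u x - ImOmega u v * ReOmega u x =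
  omega v x * dot u u - omega u x * dot u v.
Proof.
move=> o; transitivity (omega v x * dot u u - omega u x * dot u v + dot x u * omega u v).
  by rewrite !ReOmegaE !ImOmegaE /omega !dotE; ring.
by rewrite o mulr0 addr0.
Qed.

Lemma Omega_norm u v : omega u v = 0 ->
  ReOmega u v ^+ 2 + ImOmega u v ^+ 2 = dot u u * dot v v - dot u v ^+ 2.
Proof.
move=> o; rewrite [RHS](_ : _ = dot u u * dot v v - dot u v * dot v u).
  by rewrite lagrange_C2 o expr0n addr0.
by rewrite (dotC v u) expr2.
Qed.

Lemma bessel e0 e1 v : dot e0 e0 = 1 -> dot e1 e1 = 1 -> dot e0 e1 = 0 ->
  dot v e0 ^+ 2 + dot v e1 ^+ 2 <= dot v v.
Proof.
move=> e00 e11 e01; have dB := @dot_bil R.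
have := dot_ge0 (v - dot v e0 *: e0 - dot v e1 *: e1).
rewrite !(bilBl _ _ _ dB, bilBr _ _ _ dB, bilZl dB, bilZr dB).
rewrite (dotC e1 e0) (dotC e0 v) (dotC e1 v) e00 e11 e01 => h.
by rewrite -subr_ge0 (le_trans h) // le_eqVlt; apply/orP; left; apply/eqP; ring.
Qed.

Lemma dot_npart e0 e1 v x : dot v e0 = 0 -> dot v e1 = 0 ->
  dot v (npart e0 e1 x) = dot v x.
Proof.
move=> v0 v1; have dB := @dot_bil R.
by rewrite /npart !(bilBr _ _ _ dB, bilZr dB) v0 v1 !mulr0 !subr0.
Qed.

Lemma npart_tangent e0 e1 u v (a b : R) :
  dot e0 e0 = 1 -> dot e1 e1 = 1 -> dot e0 e1 = 0 ->
  dot (npart e0 e1 u + npart e0 e1 v) (a *: e0 + b *: e1) = 0.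
Proof.
move=> e00 e11 e01; have dB := @dot_bil R; rewrite /npart.
rewrite !(bilDr dB, bilZr dB, bilDl dB, bilNl _ _ dB, bilZl dB).
by rewrite (dotC e1 e0) e00 e11 e01; ring.
Qed.

Lemma omega_npart e0 e1 u v : omega u e0 = 0 -> omega u e1 = 0 ->
  omega u (npart e0 e1 v) = omega u v.
Proof.
move=> o0 o1; have oB := @omega_bil R; rewrite /npart.
by rewrite !(bilBr _ _ _ oB, bilZr oB) o0 o1 !mulr0 !subr0.
Qed.

(* The trace of the second fundamental form in the frame [a e0 + b e1], [c e0 + d e1],
   cleared of the denominator of the inverse metric. *)
Lemma trace_any_frame e0 e1 x00 x01 x11 h (a b c d : R) :
  dot e0 e0 = 1 -> dot e1 e1 = 1 -> dot e0 e1 = 0 ->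
  h = npart e0 e1 x00 + npart e0 e1 x11 -> dot h e0 = 0 -> dot h e1 = 0 ->
  let y0 := a *: e0 + b *: e1 in let y1 := c *: e0 + d *: e1 in
  (dot y0 y0 * dot y1 y1 - dot y0 y1 ^+ 2) * dot h h =
  dot y1 y1 * dot h (a *: (a *: x00 + b *: x01) + b *: (a *: x01 + b *: x11))
  - 2 * dot y0 y1 * dot h (a *: (c *: x00 + d *: x01) + b *: (c *: x01 + d *: x11))
  + dot y0 y0 * dot h (c *: (c *: x00 + d *: x01) + d *: (c *: x01 + d *: x11)).
Proof.
move=> e00 e11 e01 hE h0 h1 y0 y1; have dB := @dot_bil R.
have -> : dot h h = dot h x00 + dot h x11.
  by rewrite {2}hE (bilDr dB) !(dot_npart _ h0 h1).
rewrite /y0 /y1 !(bilDr dB, bilZr dB, bilDl dB, bilZl dB) (dotC e1 e0) e00 e11 e01.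
ring.
Qed.

Section Evolution.
Variables (e0 e1 X00 X01 X11 H H0 H1 Ht H00 H11 : 'rV[R]_4).
Hypotheses (e00 : dot e0 e0 = 1) (e11 : dot e1 e1 = 1) (e01 : dot e0 e1 = 0).
Hypotheses (He0 : dot H e0 = 0) (He1 : dot H e1 = 0).
Hypothesis HX : H = npart e0 e1 X00 + npart e0 e1 X11.

(** In coordinates orthonormal at the point, the Laplace-Beltrami operator of the surface maps phi
    to phi00 + phi11 + b0 phi0 + b1 phi1; [b0] and [b1] are the traced Christoffel symbols with a
    minus sign. *)
Let b0 := - dot (X00 + X11) e0.
Let b1 := - dot (X00 + X11) e1.

Lemma trace_decomp : X00 + X11 = H - b0 *: e0 - b1 *: e1.
Proof.
rewrite HX /npart /b0 /b1 !(bilDl (@dot_bil R)).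
by apply/rowP => j; rewrite !mxE; ring.
Qed.

(** The five relations before the last hypothesis come from differentiating <H, X_v> = 0, the last
    hypothesis from the trace identity. Together they say that the heat operator sends |H|^2 / 2 to
    2 S - |H0|^2 - |H1|^2, where S is the sum of the <H, X_ij>^2 over all i, j. The tangential parts
    of H0 and H1 already have squared lengths adding up to S, so Bessel leaves S, and Cauchy-Schwarz
    bounds S by |H|^2 |A|^2. *)
Lemma normH2_evolution :
  dot H0 e0 = - dot H X00 -> dot H0 e1 = - dot H X01 ->
  dot H1 e0 = - dot H X01 -> dot H1 e1 = - dot H X11 ->
  dot Ht e0 = - dot H H0 -> dot Ht e1 = - dot H H1 ->
  2 * (dot H0 e0 + dot H1 e1) * dot H H + 2 * dot H Ht =
    2 * dot H1 e1 * dot H X00 + (dot Ht X00 + dot H H00)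
    - 2 * (dot H0 e1 + dot H1 e0) * dot H X01
    + 2 * dot H0 e0 * dot H X11 + (dot Ht X11 + dot H H11) ->
  2 * dot H Ht - 2 * (dot H0 H0 + dot H1 H1) - 2 * (dot H H00 + dot H H11)
    - b0 * (2 * dot H H0) - b1 * (2 * dot H H1)
  <= 2 * dot H H * (dot (npart e0 e1 X00) (npart e0 e1 X00)
     + 2 * dot (npart e0 e1 X01) (npart e0 e1 X01)
     + dot (npart e0 e1 X11) (npart e0 e1 X11)).
Proof.
have dB := @dot_bil R.
move=> h00 h01 h10 h11 t0 t1; rewrite h00 h01 h10 h11 => tE.
have HH : dot H H = dot H X00 + dot H X11.
  by rewrite {2}HX (bilDr dB) !dot_npart.
have HtS : dot Ht X00 + dot Ht X11 = dot H Ht + b0 * dot H H0 + b1 * dot H H1.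
  rewrite -(bilDr dB) trace_decomp !(bilBr _ _ _ dB, bilZr dB) t0 t1 (dotC Ht H).
  ring.
have B0 := bessel H0 e00 e11 e01; have B1 := bessel H1 e00 e11 e01.
rewrite h00 h01 in B0; rewrite h10 h11 in B1.
have C00 := cauchy_schwarz H (npart e0 e1 X00).
have C01 := cauchy_schwarz H (npart e0 e1 X01).
have C11 := cauchy_schwarz H (npart e0 e1 X11).
rewrite (dot_npart X00 He0 He1) in C00.
rewrite (dot_npart X01 He0 He1) in C01.
rewrite (dot_npart X11 He0 He1) in C11.
rewrite HH in tE.
move: tE HtS B0 B1 C00 C01 C11.
set n00 := dot (npart e0 e1 X00) _; set n01 := dot (npart e0 e1 X01) _.
set n11 := dot (npart e0 e1 X11) _.
move: (dot H X00) (dot H X01) (dot H X11) => x00 x01 x11.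
move: (dot H H) (dot H0 H0) (dot H1 H1) => q q0 q1.
move: (dot H Ht) (dot H H0) (dot H H1) (dot H H00) (dot H H11) => ht k0 k1 k00 k11.
move: (dot Ht X00) (dot Ht X11) n00 n01 n11 b0 b1 => y0 y1 n00 n01 n11 c0 c1 tE HtS B0 B1 C00 C01 C11.
have ID : ht - k00 - k11 - c0 * k0 - c1 * k1 =
    2 * x00 ^+ 2 + 2 * x11 ^+ 2 + 4 * x01 ^+ 2.
  have -> : ht = 2 * ht - ht by ring.
  have -> : 2 * ht = - (2 * (- x00 + - x11) * (x00 + x11))
    + (2 * (- x11) * x00 + (y0 + k00) - 2 * (- x01 + - x01) * x01
      + 2 * (- x00) * x11 + (y1 + k11)) by rewrite -tE; ring.
  have -> : y0 = ht + c0 * k0 + c1 * k1 - y1 by rewrite -HtS; ring.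
  ring.
apply: (@le_trans _ _ (2 * (x00 ^+ 2 + 2 * x01 ^+ 2 + x11 ^+ 2))); last first.
  rewrite -mulrA ler_pM2l //.
  have -> : q * (n00 + 2 * n01 + n11) = q * n00 + 2 * (q * n01) + q * n11 by ring.
  by move: C00 C01 C11; move: (q * n00) (q * n01) (q * n11) => ? ? ?; lra.
suff : (ht - k00 - k11 - c0 * k0 - c1 * k1) - (q0 + q1) <= x00 ^+ 2 + 2 * x01 ^+ 2 + x11 ^+ 2.
  by lra.
rewrite ID; move: B0 B1; rewrite !sqrrN; lra.
Qed.

(** With T = tan theta, the left side is the heat operator applied to psi = ln (1 + T^2) / 2. The
    terms omega(e_k, H_k) cancel, and omega(X00 + X11, H) is absorbed by the first-order part of the
    Laplacian because omega(H, H) = 0: this is the heat equation for theta. The gradient terms are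
    left, with |d theta|^2 = |H|^2. *)
Lemma psi_evolution (T : R) : omega e0 e1 = 0 ->
  T * (omega e0 H0 + omega e1 H1)
    - ((1 + T ^+ 2) * omega e0 H ^+ 2 + T * (omega X00 H + omega e0 H0))
    - ((1 + T ^+ 2) * omega e1 H ^+ 2 + T * (omega X11 H + omega e1 H1))
    - b0 * (T * omega e0 H) - b1 * (T * omega e1 H)
  = - (1 + T ^+ 2) * dot H H.
Proof.
move=> o01; have oB := @omega_bil R.
rewrite -(lagrangian_parseval e00 e11 e01 o01 He0 He1).
have : omega X00 H + omega X11 H = - b0 * omega e0 H - b1 * omega e1 H.
  rewrite -(bilDl oB) trace_decomp !(bilBl _ _ _ oB, bilZl oB).
  by rewrite [omega H H](_ : _ = 0) ?sub0r; [ring|rewrite /omega; ring].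
move=> oE; have -> : omega X00 H = - b0 * omega e0 H - b1 * omega e1 H - omega X11 H.
  by rewrite -oE addrK.
ring.
Qed.

End Evolution.

End PointwiseIdentities.

(** * Evolution equations in a chart *)

Section Slices.
Context {R : realType}.
Implicit Types (V W : normedModType R).
Local Notation space_time := (R * (R * R))%type.

Lemma derive_slice W (f : space_time -> W) (t : R) (x v : R * R) :
  'D_v (fun y => f (t, y)) x = 'D_((0, v) : space_time) f (t, x).
Proof.
rewrite /derive; set g1 := fun h => h^-1 *: _; set g2 := fun h => h^-1 *: _.
suff -> : g1 = g2 by [].
apply/funext => h; rewrite /g1 /g2 /=.
by congr (_ *: (f _ - _)); apply/eqP; rewrite -pair_eqE /= scaler0 add0r !eqxx.
Qed.

Lemma derive_slice_time W (f : space_time -> W) (t : R) (x : R * R) :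
  'D_1 (fun s => f (s, x)) t = 'D_((1, 0) : space_time) f (t, x).
Proof.
rewrite /derive; set g1 := fun h => h^-1 *: _; set g2 := fun h => h^-1 *: _.
suff -> : g1 = g2 by [].
apply/funext => h; rewrite /g1 /g2 /=.
by congr (_ *: (f _ - _)); apply/eqP; rewrite -pair_eqE /= scaler0 add0r !eqxx.
Qed.

Lemma continuous_slice (t : R) : continuous (fun x : R * R => (t, x)).
Proof.
move=> x.
have ct : (fun _ : R * R => t) @ x --> t by exact: cvg_cst.
have ci : (fun y : R * R => y) @ x --> x by exact: cvg_id.
exact: (cvg_pair ct ci).
Qed.

Lemma open_slice (A : set space_time) (t : R) : open A -> open [set x | A (t, x)].
Proof.
move=> oA; apply: (@open_comp _ _ (fun x : R * R => (t, x))) => // x _.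
exact: continuous_slice.
Qed.

Lemma Cn_on_slice W n (A : set space_time) (f : space_time -> W) (t : R) :
  Cn_on n A f -> Cn_on n [set x | A (t, x)] (fun x => f (t, x)).
Proof.
elim: n f => [|n IH] f.
  move=> cf x /= Ax; apply: (@continuous_comp _ _ _ (fun x : R * R => (t, x)) f).
    exact: continuous_slice.
  exact: cf.
move=> [df Df]; split=> [x Ax|v].
  apply: (@differentiable_comp _ _ _ _ (fun x : R * R => (t, x)) f); last exact: df.
  apply: differentiable_pair; first exact: differentiable_cst.
  by have /@ex_diff := @is_diff_id _ (R * R)%type x.
have -> : 'D_v (fun x => f (t, x)) = fun x => 'D_((0, v) : space_time) f (t, x).
  by apply/funext => x; rewrite derive_slice.
exact: (IH ('D_((0, v) : space_time) f) (Df _)).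
Qed.

Lemma near_line V (P : V -> Prop) (z v : V) :
  (\near z, P z) -> \forall s \near (0 : R), P (z + s *: v).
Proof.
have : z + s *: v @[s --> (0 : R)] --> z.
  rewrite -[X in _ --> nbhs X]addr0; apply: cvgD; first exact: cvg_cst.
  by rewrite -(scale0r v); apply: cvgZr_tmp; exact: cvg_id.
by move=> h Pz; exact: (h _ Pz).
Qed.

Lemma derive_dirD V W (f : V -> W) (x u v : V) : differentiable f x ->
  'D_(u + v) f x = 'D_u f x + 'D_v f x.
Proof. by move=> df; rewrite !deriveE // linearD. Qed.

Lemma derive_dirZ V W (f : V -> W) (x u : V) (a : R) : differentiable f x ->
  'D_(a *: u) f x = a *: 'D_u f x.
Proof. by move=> df; rewrite !deriveE // linearZ. Qed.

Lemma is_derive_Cn V W n (U : set V) (f : V -> W) x v : Cn_on n.+1 U f -> U x ->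
  is_derive x v f ('D_v f x).
Proof. by move=> [df _] Ux; apply/derivableP/diff_derivable/df. Qed.

End Slices.

Local Opaque derive.

(** * Commuting derivatives of the flow in a chart *)

Section ChartCalculus.
Context {R : realType} {V : normedModType R}.
Local Notation R4 := 'rV[R]_4.
Variables (A : set V) (Phi : V -> R4) (sdir : R * R -> V) (tdir : V).
Hypothesis oA : open A.
Hypothesis cPhi : forall n, Cn_on n A Phi.
Hypothesis sdir_lin : forall a b u v, sdir (a *: u + b *: v) = a *: sdir u + b *: sdir v.

Let X v := 'D_(sdir v) Phi.
Let XX v u := 'D_(sdir u) (X v).
Let H := 'D_tdir Phi.

Lemma Cn_on_X n v : Cn_on n A (X v).
Proof. by have [_] := cPhi n.+1; exact. Qed.

Lemma Cn_on_H n : Cn_on n A H.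
Proof. by have [_] := cPhi n.+1; exact. Qed.

Lemma Cn_on_der (W : normedModType R) n (f : V -> W) u : Cn_on n.+1 A f -> Cn_on n A ('D_u f).
Proof. by move=> [_]; exact. Qed.

Lemma diffA (W : normedModType R) n (f : V -> W) z :
  Cn_on n.+1 A f -> A z -> differentiable f z.
Proof. by move=> [df _] Az; exact: df. Qed.

Lemma X_lin z a b u v : A z -> X (a *: u + b *: v) z = a *: X u z + b *: X v z.
Proof.
move=> Az; have dP := diffA (cPhi 1) Az.
have -> : X (a *: u + b *: v) z = 'D_(a *: sdir u + b *: sdir v) Phi z.
  by rewrite /X sdir_lin.
apply: (etrans (derive_dirD (a *: sdir u) (b *: sdir v) dP)).
by congr (_ + _); exact: derive_dirZ.
Qed.

Lemma XXC z u v : A z -> XX u v z = XX v u z.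
Proof. by move=> Az; exact: derive_sym_rV oA Az (cPhi 2). Qed.

Lemma XH z v : A z -> 'D_tdir (X v) z = 'D_(sdir v) H z.
Proof. by move=> Az; exact: derive_sym_rV oA Az (cPhi 2). Qed.

Lemma XXH z u v : A z -> 'D_tdir (XX v u) z = 'D_(sdir u) ('D_(sdir v) H) z.
Proof.
move=> Az; apply: (etrans (derive_sym_rV tdir (sdir u) oA Az (Cn_on_X 2 v))).
apply: near_eq_derive; apply: filterS (open_nbhs_nbhs (conj oA Az)) => y Ay.
exact: XH.
Qed.

Lemma nearA z (P : V -> Prop) : (forall y, A y -> P y) -> A z -> \near z, P z.
Proof. by move=> AP Az; apply: filterS (open_nbhs_nbhs (conj oA Az)) => y /AP. Qed.

Lemma der_Phi z u : A z -> is_derive z u Phi ('D_u Phi z).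
Proof. exact: (is_derive_Cn u (cPhi 1)). Qed.

Lemma der_X z u v : A z -> is_derive z u (X v) ('D_u (X v) z).
Proof. exact: (is_derive_Cn u (Cn_on_X 1 v)). Qed.

Lemma der_H z u : A z -> is_derive z u H ('D_u H z).
Proof. exact: (is_derive_Cn u (Cn_on_H 1)). Qed.

Lemma Cn_on_XX n v u : Cn_on n A (XX v u).
Proof. exact: Cn_on_der (Cn_on_X n.+1 v). Qed.

Lemma XX_lin z a b c d u v : A z -> XX (a *: u + b *: v) (c *: u + d *: v) z =
  a *: (c *: XX u u z + d *: XX u v z) + b *: (c *: XX u v z + d *: XX v v z).
Proof.
move=> Az.
have dXv : differentiable (X v) z by apply: diffA (Cn_on_X 1 v) Az.
have dXu : differentiable (X u) z by apply: diffA (Cn_on_X 1 u) Az.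
have dir p : XX (a *: u + b *: v) p z = a *: XX u p z + b *: XX v p z.
  have E : XX (a *: u + b *: v) p z = 'D_(sdir p) (a *: X u + b *: X v) z.
    by apply: near_eq_derive; apply: nearA Az => y Ay; exact: X_lin.
  rewrite E.
  by have [_ ->] := is_deriveD (is_deriveZ a (der_X (sdir p) u Az))
                              (is_deriveZ b (der_X (sdir p) v Az)).
have dir2 p : differentiable (X p) z ->
    XX p (c *: u + d *: v) z = c *: XX p u z + d *: XX p v z.
  move=> dXp; have -> : XX p (c *: u + d *: v) z = 'D_(c *: sdir u + d *: sdir v) (X p) z.
    by rewrite /XX sdir_lin.
  apply: (etrans (derive_dirD (c *: sdir u) (d *: sdir v) dXp)).
  by congr (_ + _); exact: derive_dirZ.
by rewrite (dir _) (dir2 u dXu) (dir2 v dXv) (XXC v u Az).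
Qed.

End ChartCalculus.

(** The derivatives become named functions tied together by first-order relations, so that later
    computations handle short atoms. Taking [V] to be the plane, [sdir] the identity and [tdir]
    zero, the same record serves for a single surface. *)
Record flow_jet (R : realType) (V : normedModType R) (A : set V) (Phi : V -> 'rV[R]_4)
    (sdir : R * R -> V) (tdir : V) (H Ht : V -> 'rV[R]_4)
    (X HX : R * R -> V -> 'rV[R]_4) (XX HXX : R * R -> R * R -> V -> 'rV[R]_4) : Prop :=
  FlowJet {
  jet_PhiX : forall z v, A z -> is_derive z (sdir v) Phi (X v z);
  jet_Phit : forall z, A z -> is_derive z tdir Phi (H z);
  jet_Xx : forall z v u, A z -> is_derive z (sdir u) (X v) (XX v u z);
  jet_Xt : forall z v, A z -> is_derive z tdir (X v) (HX v z);
  jet_Hx : forall z v, A z -> is_derive z (sdir v) H (HX v z);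
  jet_Ht : forall z, A z -> is_derive z tdir H (Ht z);
  jet_XXt : forall z v u, A z -> is_derive z tdir (XX v u) (HXX v u z);
  jet_HXx : forall z v u, A z -> is_derive z (sdir u) (HX v) (HXX v u z);
  jet_XXC : forall z v u, A z -> XX v u z = XX u v z;
  jet_X_lin : forall z a b u v, A z -> X (a *: u + b *: v) z = a *: X u z + b *: X v z;
  jet_XX_lin : forall z a b c d u v, A z ->
    XX (a *: u + b *: v) (c *: u + d *: v) z =
    a *: (c *: XX u u z + d *: XX u v z) + b *: (c *: XX u v z + d *: XX v v z);
  jet_X : forall v z, 'D_(sdir v) Phi z = X v z;
  jet_XX : forall v u z, 'D_(sdir u) (X v) z = XX v u z;
  jet_H : forall z, 'D_tdir Phi z = H z }.

Lemma exists_flow_jet (R : realType) (V : normedModType R) (A : set V) Phi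
    (sdir : R * R -> V) tdir : open A -> (forall n, Cn_on n A Phi) ->
  (forall a b u v, sdir (a *: u + b *: v) = a *: sdir u + b *: sdir v) ->
  exists H Ht X HX XX HXX, flow_jet A Phi sdir tdir H Ht X HX XX HXX.
Proof.
move=> oA cPhi sl.
pose X v := 'D_(sdir v) Phi; pose XX v u := 'D_(sdir u) (X v).
pose H := 'D_tdir Phi; pose HX v := 'D_(sdir v) H; pose HXX v u := 'D_(sdir u) (HX v).
exists H, ('D_tdir H), X, HX, XX, HXX; split.
- by move=> z v; exact: der_Phi.
- by move=> z; exact: der_Phi.
- by move=> z v u; exact: der_X.
- by move=> z v Az; rewrite /HX /H -(XH sdir tdir oA cPhi v Az); exact: der_X.
- by move=> z v; exact: der_H.
- by move=> z; exact: der_H.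
- move=> z v u Az; rewrite /HXX /HX /H -(XXH sdir tdir oA cPhi u v Az).
  exact: (is_derive_Cn tdir (Cn_on_XX sdir cPhi 1 v u)).
- by move=> z v u Az; exact: (is_derive_Cn _ (Cn_on_der (sdir v) (Cn_on_H tdir cPhi 2))).
- by move=> z v u; exact: XXC.
- by move=> z a b u v; exact: X_lin.
- by move=> z a b c d u v; exact: XX_lin.
- by [].
- by [].
- by [].
Qed.

Local Transparent derive.

(** Cramer's rule. *)
Lemma planar_decomp (R : realType) (w0 w1 v : R * R) :
  w0.1 * w1.2 - w0.2 * w1.1 != 0 -> exists a b, v = a *: w0 + b *: w1.
Proof.
case: w0 w1 => [p q] [r s] /= wd.
exists ((v.1 * s - v.2 * r) / (p * s - q * r)), ((p * v.2 - q * v.1) / (p * s - q * r)).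
by case: v => v1 v2 /=; apply/eqP; rewrite -pair_eqE /=; apply/andP; split; apply/eqP;
  rewrite /GRing.scale /=; field.
Qed.

(** * Directional derivatives of scalar functions *)

Section DeriveRules.
Context {R : realType} {V : normedModType R}.
Implicit Types (f g : V -> R) (x v : V).

Lemma is_derive_add f g x v df dg : is_derive x v f df -> is_derive x v g dg ->
  is_derive x v (fun y => f y + g y) (df + dg).
Proof. exact: is_deriveD. Qed.

Lemma is_derive_sub f g x v df dg : is_derive x v f df -> is_derive x v g dg ->
  is_derive x v (fun y => f y - g y) (df - dg).
Proof. exact: is_deriveB. Qed.

Lemma is_derive_mul f g x v df dg : is_derive x v f df -> is_derive x v g dg ->
  is_derive x v (fun y => f y * g y) (f x * dg + g x * df).
Proof. exact: is_deriveM. Qed.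

Lemma is_derive_scal f x v df (k : R) : is_derive x v f df ->
  is_derive x v (fun y => k * f y) (k * df).
Proof. exact: is_deriveZ. Qed.

Lemma is_derive_inv f x v df : f x != 0 -> is_derive x v f df ->
  is_derive x v (fun y => (f y)^-1) (- df / f x ^+ 2).
Proof.
move=> f0 [dvf dE]; apply: DeriveDef; first exact: derivableV.
by rewrite deriveV // dE mulNr mulrC -mulNr.
Qed.

Lemma is_derive_along f x v s d : is_derive (x + s *: v) v f d ->
  is_derive s 1 (fun r => f (x + r *: v)) d.
Proof.
move=> fd.
have E : (fun h : R => h^-1 *: (((fun r => f (x + r *: v)) \o shift s) (h *: 1)
    - f (x + s *: v))) =
  (fun h : R => h^-1 *: ((f \o shift (x + s *: v)) (h *: v) - f (x + s *: v))).
  apply/funext => h /=; congr (_ *: (f _ - _)).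
  by rewrite [_%:A]mulr1 scalerDl addrCA.
by case: fd => dvf dE; split; [rewrite /derivable E|rewrite -dE /derive E].
Qed.

(** Only a directional derivative of [f] is available, so the chain rule is applied to the
    restriction of [f] to the line through [x] in the direction [v]. *)
Lemma is_derive_scomp f (g : R -> R) x v df dg : is_derive x v f df ->
  is_derive (f x) 1 g dg -> is_derive x v (fun y => g (f y)) (dg * df).
Proof.
move=> fd gd.
have x0 : x + 0 *: v = x by rewrite scale0r addr0.
have f1 : is_derive (0 : R) 1 (fun r => f (x + r *: v)) df.
  by apply: is_derive_along; rewrite x0.
have g1 : is_derive (0 : R) 1 (fun r => g (f (x + r *: v))) (dg * df).
  have gd' : is_derive (f (x + 0 *: v)) 1 g dg by rewrite x0.
  exact: (@is_derive1_comp _ g (fun r => f (x + r *: v)) 0 dg df gd' f1).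
have E : (fun h : R => h^-1 *: (((fun r => g (f (x + r *: v))) \o shift 0) (h *: 1)
    - g (f (x + 0 *: v)))) =
  (fun h : R => h^-1 *: (((fun y => g (f y)) \o shift x) (h *: v) - g (f x))).
  apply/funext => h /=; congr (_ *: (g (f _) - g (f _))) => //.
  by rewrite [_%:A]mulr1 addr0 addrC.
by case: g1 => dvf <-; split; [rewrite /derivable -E|rewrite /derive -E].
Qed.

End DeriveRules.

(* The flow in one chart, seen from an abstract space-time [V] with a time
   direction [tdir] and spatial directions [sdir v].  [X v], [XX v u], [H], [HX v],
   [HXX v u], [Ht] stand for the derivatives of [Phi] in the directions
   [v], [v u], [tdir], [tdir v], [tdir v u], [tdir tdir]; the squared norm of the
   second fundamental form enters through [nA2]. *)
Section ChartEvolution.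
Context {R : realType} {V : normedModType R}.
Local Notation R4 := 'rV[R]_4.
Variables (A : set V) (Phi H Ht : V -> R4) (sdir : R * R -> V) (tdir : V) (nA2 : V -> R).
Variables (X HX : R * R -> V -> R4) (XX HXX : R * R -> R * R -> V -> R4).
Hypothesis oA : open A.
Hypothesis PhiX : forall z v, A z -> is_derive z (sdir v) Phi (X v z).
Hypothesis Phit : forall z, A z -> is_derive z tdir Phi (H z).
Hypothesis Xx : forall z v u, A z -> is_derive z (sdir u) (X v) (XX v u z).
Hypothesis Xt : forall z v, A z -> is_derive z tdir (X v) (HX v z).
Hypothesis Hx : forall z v, A z -> is_derive z (sdir v) H (HX v z).
Hypothesis HtP : forall z, A z -> is_derive z tdir H (Ht z).
Hypothesis XXt : forall z v u, A z -> is_derive z tdir (XX v u) (HXX v u z).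
Hypothesis HXx : forall z v u, A z -> is_derive z (sdir u) (HX v) (HXX v u z).
Hypothesis XXC : forall z v u, A z -> XX v u z = XX u v z.
Hypothesis X_lin : forall z a b u v, A z -> X (a *: u + b *: v) z = a *: X u z + b *: X v z.
Hypothesis XX_lin : forall z a b c d u v, A z ->
  XX (a *: u + b *: v) (c *: u + d *: v) z =
  a *: (c *: XX u u z + d *: XX u v z) + b *: (c *: XX u v z + d *: XX v v z).

Record stframe z (w : 'I_2 -> R * R) : Prop := STFrame {
  stframe_det : (w 0).1 * (w 1).2 - (w 0).2 * (w 1).1 != 0;
  stframe00 : dot (X (w 0) z) (X (w 0) z) = 1;
  stframe11 : dot (X (w 1) z) (X (w 1) z) = 1;
  stframe01 : dot (X (w 0) z) (X (w 1) z) = 0;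
  stframe_H : H z = npart (X (w 0) z) (X (w 1) z) (XX (w 0) (w 0) z) +
                    npart (X (w 0) z) (X (w 1) z) (XX (w 1) (w 1) z);
  stframe_A : nA2 z =
    dot (npart (X (w 0) z) (X (w 1) z) (XX (w 0) (w 0) z))
        (npart (X (w 0) z) (X (w 1) z) (XX (w 0) (w 0) z)) +
    2 * dot (npart (X (w 0) z) (X (w 1) z) (XX (w 0) (w 1) z))
        (npart (X (w 0) z) (X (w 1) z) (XX (w 0) (w 1) z)) +
    dot (npart (X (w 0) z) (X (w 1) z) (XX (w 1) (w 1) z))
        (npart (X (w 0) z) (X (w 1) z) (XX (w 1) (w 1) z)) }.

Hypothesis stframe_ex : forall z, A z -> exists w, stframe z w.
Hypothesis omegaX : forall z u v, A z -> omega (X u z) (X v z) = 0.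
Hypothesis calP : forall z, A z -> 0 < ReOmega (X (e_ 0) z) (X (e_ 1) z).

Lemma decomp_frame z w v : stframe z w -> exists a b, v = a *: w 0 + b *: w 1.
Proof. by move=> [wd _ _ _ _ _]; exact: planar_decomp. Qed.

Lemma dotHX z v : A z -> dot (H z) (X v z) = 0.
Proof.
move=> Az; have [w wP] := stframe_ex Az.
have [a [b ->]] := decomp_frame v wP; have [_ e00 e11 e01 -> _] := wP.
by rewrite X_lin // npart_tangent.
Qed.

(** The frame of [stframe] depends on the point, whereas here the directions [w0], [w1] are
    arbitrary and constant. The identity thus holds on all of [A] with the same directions and may
    be differentiated. *)
Lemma trace_identity z w0 w1 : A z ->
  (dot (X w0 z) (X w0 z) * dot (X w1 z) (X w1 z) - dot (X w0 z) (X w1 z) ^+ 2)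
    * dot (H z) (H z) =
  dot (X w1 z) (X w1 z) * dot (H z) (XX w0 w0 z)
  - 2 * dot (X w0 z) (X w1 z) * dot (H z) (XX w0 w1 z)
  + dot (X w0 z) (X w0 z) * dot (H z) (XX w1 w1 z).
Proof.
move=> Az; have [w wP] := stframe_ex Az.
have [a [b E0]] := decomp_frame w0 wP; have [c [d E1]] := decomp_frame w1 wP.
have [_ e00 e11 e01 HE _] := wP.
rewrite E0 E1 !X_lin // !XX_lin //.
exact: (trace_any_frame (XX (w 0) (w 1) z) a b c d e00 e11 e01 HE (dotHX _ Az) (dotHX _ Az)).
Qed.

Lemma der_near0 (f : V -> R) z u df : A z -> (forall y, A y -> f y = 0) ->
  is_derive z u f df -> df = 0.
Proof.
move=> Az f0 [_ <-].
have -> : 'D_u f z = 'D_u (cst 0 : V -> R) z.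
  apply: near_eq_derive; apply: filterS (open_nbhs_nbhs (conj oA Az)) => y Ay.
  by rewrite f0.
by rewrite derive_cst.
Qed.

Lemma dotHX_x z u v : A z -> dot (HX u z) (X v z) = - dot (H z) (XX v u z).
Proof.
move=> Az; apply/eqP; rewrite -addr_eq0; apply/eqP.
apply: (der_near0 (f := fun y => dot (H y) (X v y)) Az (fun y => dotHX v (z := y))).
exact: (is_derive_bil (@dot_bil R) (Hx u Az) (Xx v u Az)).
Qed.

Lemma dotHX_t z v : A z -> dot (Ht z) (X v z) = - dot (H z) (HX v z).
Proof.
move=> Az; apply/eqP; rewrite -addr_eq0; apply/eqP.
apply: (der_near0 (f := fun y => dot (H y) (X v y)) Az (fun y => dotHX v (z := y))).
exact: (is_derive_bil (@dot_bil R) (HtP Az) (Xt v Az)).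
Qed.

Lemma omegaX_x z p u v : A z ->
  omega (XX u p z) (X v z) = - omega (X u z) (XX v p z).
Proof.
move=> Az; apply/eqP; rewrite -addr_eq0; apply/eqP.
apply: (der_near0 (f := fun y => omega (X u y) (X v y)) Az (fun y => omegaX u v (z := y))).
exact: (is_derive_bil (@omega_bil R) (Xx _ _ Az) (Xx _ _ Az)).
Qed.

(** The trace identity is differentiated in time with [w] frozen, and orthonormality is inserted
    only afterwards, at [z]. *)
Lemma trace_identity_t z w : A z -> stframe z w ->
  2 * (dot (HX (w 0) z) (X (w 0) z) + dot (HX (w 1) z) (X (w 1) z)) * dot (H z) (H z)
    + 2 * dot (H z) (Ht z) =
    2 * dot (HX (w 1) z) (X (w 1) z) * dot (H z) (XX (w 0) (w 0) z)
    + (dot (Ht z) (XX (w 0) (w 0) z) + dot (H z) (HXX (w 0) (w 0) z))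
    - 2 * (dot (HX (w 0) z) (X (w 1) z) + dot (HX (w 1) z) (X (w 0) z))
        * dot (H z) (XX (w 0) (w 1) z)
    + 2 * dot (HX (w 0) z) (X (w 0) z) * dot (H z) (XX (w 1) (w 1) z)
    + (dot (Ht z) (XX (w 1) (w 1) z) + dot (H z) (HXX (w 1) (w 1) z)).
Proof.
move=> Az [_ e00 e11 e01 _ _]; have dB := @dot_bil R.
pose g k m y := dot (X (w k) y) (X (w m) y); pose h k m y := dot (H y) (XX (w k) (w m) y).
have dg k m : is_derive z tdir (g k m) _ := is_derive_bil dB (Xt (w k) Az) (Xt (w m) Az).
have dh k m : is_derive z tdir (h k m) _ := is_derive_bil dB (HtP Az) (XXt (w k) (w m) Az).
have dHH : is_derive z tdir (fun y => dot (H y) (H y)) _ :=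
  is_derive_bil dB (HtP Az) (HtP Az).
pose lhs y := (g 0 0 y * g 1 1 y - g 0 1 y * g 0 1 y) * dot (H y) (H y).
pose rhs y := g 1 1 y * h 0 0 y - 2 * (g 0 1 y * h 0 1 y) + g 0 0 y * h 1 1 y.
have dl := is_derive_mul (is_derive_sub (is_derive_mul (dg 0 0) (dg 1 1)) (is_derive_mul (dg 0 1) (dg 0 1))) dHH.
have dr := is_derive_add (is_derive_sub (is_derive_mul (dg 1 1) (dh 0 0)) (is_derive_scal 2 (is_derive_mul (dg 0 1) (dh 0 1))))
  (is_derive_mul (dg 0 0) (dh 1 1)).
have tr y : A y -> lhs y - rhs y = 0.
  move=> Ay; have := trace_identity (w 0) (w 1) Ay.
  by rewrite /lhs /rhs -expr2 => ->; rewrite /g /h; ring.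
have := der_near0 Az tr (is_derive_sub dl dr).
rewrite /g /h e00 e11 e01 !(dotC (X _ z)) (dotC (Ht z) (H z)) => E.
by apply/eqP; rewrite -subr_eq0 -[X in _ == X]E; apply/eqP; ring.
Qed.

Definition Hsq y := dot (H y) (H y).

Lemma Hsq_x z v : A z -> is_derive z (sdir v) Hsq (2 * dot (H z) (HX v z)).
Proof.
move=> Az; apply: (is_derive_eq (is_derive_bil (@dot_bil R) (Hx v Az) (Hx v Az))).
by rewrite (dotC (HX v z)) mulr_natl mulr2n.
Qed.

Lemma Hsq_t z : A z -> is_derive z tdir Hsq (2 * dot (H z) (Ht z)).
Proof.
move=> Az; apply: (is_derive_eq (is_derive_bil (@dot_bil R) (HtP Az) (HtP Az))).
by rewrite (dotC (Ht z)) mulr_natl mulr2n.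
Qed.

Lemma Hsq_xx z v u : A z -> is_derive z (sdir u) (fun y => 2 * dot (H y) (HX v y))
  (2 * (dot (HX u z) (HX v z) + dot (H z) (HXX v u z))).
Proof.
by move=> Az; apply: is_derive_scal; exact: (is_derive_bil (@dot_bil R) (Hx u Az) (HXx v u Az)).
Qed.

(** The tangent of the Lagrangian angle: single-valued and differentiable, while the angle itself is
    only chosen point by point. *)
Definition tanangle y := ImOmega (X (e_ 0) y) (X (e_ 1) y) / ReOmega (X (e_ 0) y) (X (e_ 1) y).

Lemma alt_frame (B : R4 -> R4 -> R) w0 w1 y : bilin B -> (forall u v, B u v = - B v u) ->
  A y -> B (X w0 y) (X w1 y) = (w0.1 * w1.2 - w0.2 * w1.1) * B (X (e_ 0) y) (X (e_ 1) y).
Proof.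
move=> bB alt Ay; rewrite {1}(e_E w0) {1}(e_E w1) !X_lin //.
have alt0 u : B u u = 0 by have := alt u u; lra.
rewrite !(bilDr bB, bilZr bB, bilDl bB, bilZl bB) !alt0 (alt (X (e_ 1) y)); ring.
Qed.

Lemma ReOmegaC (u v : R4) : ReOmega u v = - ReOmega v u.
Proof. by rewrite !ReOmegaE; ring. Qed.

Lemma ImOmegaC (u v : R4) : ImOmega u v = - ImOmega v u.
Proof. by rewrite !ImOmegaE; ring. Qed.

(** Both forms are alternating, so a change of frame multiplies each by the same determinant, which
    cancels in the quotient whatever its sign. *)
Lemma tanangle_frame w0 w1 y : w0.1 * w1.2 - w0.2 * w1.1 != 0 -> A y ->
  ReOmega (X w0 y) (X w1 y) != 0 /\
  tanangle y = ImOmega (X w0 y) (X w1 y) / ReOmega (X w0 y) (X w1 y).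
Proof.
move=> wd Ay; rewrite /tanangle.
rewrite (alt_frame w0 w1 (@ReOmega_bil R) ReOmegaC Ay).
rewrite (alt_frame w0 w1 (@ImOmega_bil R) ImOmegaC Ay).
have c0 := lt0r_neq0 (calP Ay); split; first by rewrite mulf_neq0.
by rewrite invfM mulrACA divff // mul1r.
Qed.

(** Since the frame is orthonormal and the plane Lagrangian, Omega has modulus 1 at [z], so 1 + T^2
    is the inverse square of its real part. The angular velocity is the sum of the contributions of
    the two moving arguments. *)
Lemma tanangle_der z w p Y0 Y1 : A z -> stframe z w ->
  is_derive z p (X (w 0)) Y0 -> is_derive z p (X (w 1)) Y1 ->
  is_derive z p tanangle
    ((1 + tanangle z ^+ 2) * (omega (X (w 0) z) Y0 + omega (X (w 1) z) Y1)).
Proof.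
move=> Az wP d0 d1; have [wd e00 e11 e01 _ _] := wP.
have [r0 tE] := tanangle_frame wd Az.
have o01 := omegaX (w 0) (w 1) Az.
apply: (near_eq_is_derive (f := fun y => ImOmega (X (w 0) y) (X (w 1) y) *
    (ReOmega (X (w 0) y) (X (w 1) y))^-1)).
  apply: filterS (open_nbhs_nbhs (conj oA Az)) => y Ay.
  by have [_ ->] := tanangle_frame wd Ay.
have dI := is_derive_bil (@ImOmega_bil R) d0 d1.
have dR := is_derive_bil (@ReOmega_bil R) d0 d1.
have dRV := @is_derive_inv _ _ (fun y => ReOmega (X (w 0) y) (X (w 1) y)) z p _ r0 dR.
apply: (is_derive_eq (is_derive_mul dI dRV)).
have F := Omega_first Y0 o01; have S := Omega_second Y1 o01.
have N := Omega_norm o01.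
rewrite e00 e11 e01 in F S N.
rewrite tE; move: r0 F S N.
set r := ReOmega _ _; set i := ImOmega (X _ z) (X _ z) => r0 F S N.
have -> : omega (X (w 0) z) Y0 + omega (X (w 1) z) Y1 =
  r * (ImOmega Y0 (X (w 1) z) + ImOmega (X (w 0) z) Y1)
  - i * (ReOmega Y0 (X (w 1) z) + ReOmega (X (w 0) z) Y1).
  transitivity ((omega (X (w 0) z) Y0 * 1 - omega (X (w 1) z) Y0 * 0) +
    (omega (X (w 1) z) Y1 * 1 - omega (X (w 0) z) Y1 * 0)); first by ring.
  by rewrite -F -S; ring.
have -> : 1 + (i / r) ^+ 2 = r ^- 2.
  transitivity ((r ^+ 2 + i ^+ 2) / r ^+ 2); first by field.
  by rewrite N mul1r expr0n subr0 div1r.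
by field.
Qed.

Lemma XX_right z w c d v : A z ->
  XX v (c *: w + d *: v) z = c *: XX v w z + d *: XX v v z /\
  XX w (c *: w + d *: v) z = c *: XX w w z + d *: XX w v z.
Proof.
move=> Az; have := XX_lin 0 1 c d w v Az; have := XX_lin 1 0 c d w v Az.
rewrite !scale0r !scale1r !addr0 !add0r => -> ->.
by rewrite (XXC v w Az).
Qed.

(** On a Lagrangian surface omega(X_u, X_vw) is symmetric in all three directions ([K1], [K2]). Its
    trace in two of them is omega(X_v, H), hence d theta (v) = omega(X_v, H). *)
Lemma tanangle_x z v : A z ->
  is_derive z (sdir v) tanangle ((1 + tanangle z ^+ 2) * omega (X v z) (H z)).
Proof.
move=> Az; have [w wP] := stframe_ex Az.
have [a [b vE]] := decomp_frame v wP.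
apply: (is_derive_eq (tanangle_der Az wP (Xx _ v Az) (Xx _ v Az))).
have [_ e00 e11 e01 HE _] := wP.
have oB := @omega_bil R; have o01 := omegaX (w 0) (w 1) Az.
have o10 := omegaX (w 1) (w 0) Az.
have o00 := omegaX (w 0) (w 0) Az; have o11 := omegaX (w 1) (w 1) Az.
have K1 : omega (X (w 1) z) (XX (w 1) (w 0) z) = omega (X (w 0) z) (XX (w 1) (w 1) z).
  by rewrite omegaC XXC // omegaX_x // opprK.
have K2 : omega (X (w 0) z) (XX (w 0) (w 1) z) = omega (X (w 1) z) (XX (w 0) (w 0) z).
  by rewrite omegaC XXC // omegaX_x // opprK.
have h0 : omega (X (w 0) z) (H z) =
    omega (X (w 0) z) (XX (w 0) (w 0) z) + omega (X (w 0) z) (XX (w 1) (w 1) z).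
  by rewrite HE (bilDr oB) !omega_npart.
have h1 : omega (X (w 1) z) (H z) =
    omega (X (w 1) z) (XX (w 0) (w 0) z) + omega (X (w 1) z) (XX (w 1) (w 1) z).
  by rewrite HE (bilDr oB) !omega_npart.
congr (_ * _); rewrite vE X_lin // (bilDl oB) !(bilZl oB) h0 h1.
have [-> ->] := XX_right (w 0) a b (w 1) Az.
by rewrite !(bilDr oB, bilZr oB) K1 K2; ring.
Qed.

Lemma tanangle_t z w : A z -> stframe z w -> is_derive z tdir tanangle
  ((1 + tanangle z ^+ 2) * (omega (X (w 0) z) (HX (w 0) z) + omega (X (w 1) z) (HX (w 1) z))).
Proof. by move=> Az wP; exact: (tanangle_der Az wP (Xt _ Az) (Xt _ Az)). Qed.

(* This is [- ln (cos theta)], [theta] being the Lagrangian angle. *)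
Definition logsec y := 2^-1 * ln (1 + tanangle y ^+ 2).

Lemma logsec_der z p m : A z ->
  is_derive z p tanangle ((1 + tanangle z ^+ 2) * m) ->
  is_derive z p logsec (tanangle z * m).
Proof.
move=> Az dT.
have T0 : 0 < 1 + tanangle z ^+ 2 by rewrite ltr_pwDl // sqr_ge0.
have d2 := is_derive_add (is_derive_cst (1 : R) z p) (is_derive_mul dT dT).
have dl := is_derive_scal 2^-1 (is_derive_scomp (g := @ln R) d2 (is_derive1_ln _)).
have {}dl := dl T0.
apply: (is_derive_eq dl); rewrite /cst /= add0r -expr2; move: (lt0r_neq0 T0) => T1.
by field.
Qed.

Lemma logsec_x z v : A z ->
  is_derive z (sdir v) logsec (tanangle z * omega (X v z) (H z)).
Proof. by move=> Az; apply: logsec_der => //; exact: tanangle_x. Qed.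

Lemma logsec_xx z v u : A z ->
  is_derive z (sdir u) (fun y => tanangle y * omega (X v y) (H y))
    (tanangle z * (omega (XX v u z) (H z) + omega (X v z) (HX u z))
     + omega (X v z) (H z) * ((1 + tanangle z ^+ 2) * omega (X u z) (H z))).
Proof.
move=> Az; apply: (is_derive_mul (tanangle_x u Az)).
exact: (is_derive_bil (@omega_bil R) (Xx v u Az) (Hx u Az)).
Qed.

Definition sqdist (p : R4) y := dot (Phi y - p) (Phi y - p).

Lemma shift_der (W : normedModType R) (f : V -> W) z v p df :
  is_derive z v f df -> is_derive z v (fun y => f y - p) df.
Proof.
move=> fd; apply: (is_derive_eq (is_deriveB fd (is_derive_cst p z v))).
by rewrite subr0.
Qed.

Lemma sqdist_x p z v : A z -> is_derive z (sdir v) (sqdist p) (2 * dot (Phi z - p) (X v z)).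
Proof.
move=> Az; have d := shift_der p (PhiX v Az).
apply: (is_derive_eq (is_derive_bil (@dot_bil R) d d)).
by rewrite (dotC (X v z)) mulr_natl mulr2n.
Qed.

Lemma sqdist_t p z : A z -> is_derive z tdir (sqdist p) (2 * dot (Phi z - p) (H z)).
Proof.
move=> Az; have d := shift_der p (Phit Az).
apply: (is_derive_eq (is_derive_bil (@dot_bil R) d d)).
by rewrite (dotC (H z)) mulr_natl mulr2n.
Qed.

Lemma sqdist_xx p z v u : A z -> is_derive z (sdir u) (fun y => 2 * dot (Phi y - p) (X v y))
  (2 * (dot (X u z) (X v z) + dot (Phi z - p) (XX v u z))).
Proof.
move=> Az; apply: is_derive_scal; have d := shift_der p (PhiX u Az).
exact: (is_derive_bil (@dot_bil R) d (Xx v u Az)).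
Qed.

Lemma line_second (f f1 : V -> R) z v f2 : A z ->
  (forall y, A y -> is_derive y v f (f1 y)) -> is_derive z v f1 f2 ->
  (\forall s \near (0 : R), f (z + s *: v) <= f z) -> f1 z = 0 /\ f2 <= 0.
Proof.
move=> Az fd f1d fmax.
have z0 : z + 0 *: v = z by rewrite scale0r addr0.
have nl : \forall s \near (0 : R), A (z + s *: v).
  exact: near_line (open_nbhs_nbhs (conj oA Az)).
have := @local_max_second R (fun s => f (z + s *: v)) (fun s => f1 (z + s *: v)) f2.
rewrite z0; apply.
- by apply: filterS nl => s As; apply: is_derive_along; exact: fd.
- by apply: is_derive_along; rewrite z0.
- exact: fmax.
Qed.

Variable tau : V -> R.
Hypothesis taux : forall z v, is_derive z (sdir v) tau 0.
Hypothesis taut : forall z, is_derive z tdir tau 1.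

(** At the maximum the gradient of [f] vanishes, its second derivatives along [w 0], [w 1] are at
    most 0 and its time derivative is at least 0, so the heat operator of [f] is nonnegative. That
    operator gives -4 on |Phi - p|^2, 1 on [tau], at most |H|^2 on |H|^2 / 2 as |A| <= 1, and at
    most - |H|^2 on psi. *)
Theorem local_max_bound z p (a k l : R) : A z -> nA2 z <= 1 -> 0 <= a ->
  let f y := a / 2 * Hsq y + logsec y - k * sqdist p y + l * tau y in
  (forall v, \forall s \near (0 : R), f (z + s *: sdir v) <= f z) ->
  (\forall s \near (0 : R), s <= 0 -> f (z + s *: tdir) <= f z) ->
  (1 - a) * Hsq z <= 4 * k + l.
Proof.
move=> Az A1 a0 f fx ft.
have [w wP] := stframe_ex Az; have [_ e00 e11 e01 HE AE] := wP.
pose f1 v y := a / 2 * (2 * dot (H y) (HX v y)) + tanangle y * omega (X v y) (H y)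
  - k * (2 * dot (Phi y - p) (X v y)) + l * 0.
have fd v y : A y -> is_derive y (sdir v) f (f1 v y).
  move=> Ay; exact: (is_derive_add (is_derive_sub (is_derive_add (is_derive_scal (a / 2) (Hsq_x v Ay)) (logsec_x v Ay))
    (is_derive_scal k (sqdist_x p v Ay))) (is_derive_scal l (taux y v))).
have f1d v : is_derive z (sdir v) (f1 v) _ :=
  is_derive_add (is_derive_sub (is_derive_add (is_derive_scal (a / 2) (Hsq_xx v v Az)) (logsec_xx v v Az))
    (is_derive_scal k (sqdist_xx p v v Az))) (is_derive_cst (l * 0) z (sdir v)).
have ftd := is_derive_add (is_derive_sub (is_derive_add (is_derive_scal (a / 2) (Hsq_t Az)) (logsec_der Az (tanangle_t Az wP)))
    (is_derive_scal k (sqdist_t p Az))) (is_derive_scal l (taut z)).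
have [g0 h0] := line_second Az (fd (w 0)) (f1d (w 0)) (fx (w 0)).
have [g1 h1] := line_second Az (fd (w 1)) (f1d (w 1)) (fx (w 1)).
have t0 : 0 <= a / 2 * (2 * dot (H z) (Ht z)) +
   tanangle z * (omega (X (w 0) z) (HX (w 0) z) + omega (X (w 1) z) (HX (w 1) z)) -
   k * (2 * dot (Phi z - p) (H z)) + l * 1.
  have z0 : z + 0 *: tdir = z by rewrite scale0r addr0.
  have ftd0 := ftd; rewrite -z0 in ftd0; have {}ftd0 := is_derive_along ftd0.
  move: (local_max_left ftd0); rewrite z0; exact.
have He0 := dotHX (w 0) Az; have He1 := dotHX (w 1) Az.
have EV := normH2_evolution e00 e11 e01 He0 He1 HE
  (dotHX_x (w 0) (w 0) Az) (etrans (dotHX_x (w 0) (w 1) Az) (congr1 (fun x => - dot (H z) x) (XXC (w 1) (w 0) Az)))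
  (dotHX_x (w 1) (w 0) Az) (dotHX_x (w 1) (w 1) Az)
  (dotHX_t (w 0) Az) (dotHX_t (w 1) Az) (trace_identity_t Az wP).
have PS := psi_evolution (HX (w 0) z) (HX (w 1) z) e00 e11 e01 He0 He1 HE (tanangle z)
  (omegaX (w 0) (w 1) Az).
(* Rewrites the normal velocity as X00 + X11 minus its tangential part, so that the time derivative
   of |Phi - p|^2 is compared with its second derivatives. *)
have DT : dot (Phi z - p) (H z) = dot (Phi z - p) (XX (w 0) (w 0) z)
    + dot (Phi z - p) (XX (w 1) (w 1) z)
    - dot (XX (w 0) (w 0) z + XX (w 1) (w 1) z) (X (w 0) z) * dot (Phi z - p) (X (w 0) z)
    - dot (XX (w 0) (w 0) z + XX (w 1) (w 1) z) (X (w 1) z) * dot (Phi z - p) (X (w 1) z).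
  have dB := @dot_bil R; rewrite -(bilDr dB) (trace_decomp HE).
  rewrite !(bilBr _ _ _ dB, bilZr dB) -(trace_decomp HE); ring.
rewrite /f1 e00 e11 in h0 h1 g0 g1.
rewrite -AE in EV.
have q0 : 0 <= Hsq z by exact: dot_ge0.
rewrite DT in t0; move: h0 h1 g0 g1 t0 EV PS A1 q0; rewrite /Hsq {DT}.
set c0 := dot (XX _ _ z + XX _ _ z) (X (w 0) z).
set c1 := dot (XX _ _ z + XX _ _ z) (X (w 1) z).
move: (tanangle z) (dot (H z) (H z)) (nA2 z) => T q n.
move: (dot (H z) (Ht z)) (dot (H z) (HX (w 0) z)) (dot (H z) (HX (w 1) z)) => ht k0 k1.
move: (dot (H z) (HXX (w 0) (w 0) z)) (dot (H z) (HXX (w 1) (w 1) z)) => k00 k11.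
move: (dot (HX (w 0) z) (HX (w 0) z)) (dot (HX (w 1) z) (HX (w 1) z)) => q0 q1.
move: (omega (X (w 0) z) (H z)) (omega (X (w 1) z) (H z)) => n0 n1.
move: (omega (X (w 0) z) (HX (w 0) z)) (omega (X (w 1) z) (HX (w 1) z)) => m0 m1.
move: (omega (XX _ _ z) (H z)) (omega (XX _ _ z) (H z)) => x0 x1.
move: (dot (Phi z - p) (X (w 0) z)) (dot (Phi z - p) (X (w 1) z)) => d0 d1.
move: (dot (Phi z - p) (XX _ _ z)) (dot (Phi z - p) (XX _ _ z)) => d00 d11.
move: c0 c1 => c0 c1 h0 h1 g0 g1 t0 EV PS A1 qp.
have EVa : a / 2 * (2 * ht - 2 * (q0 + q1) - 2 * (k00 + k11) - - c0 * (2 * k0)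
    - - c1 * (2 * k1)) <= a / 2 * (2 * q).
  apply: ler_wpM2l; first by rewrite divr_ge0.
  by rewrite (le_trans EV) // ler_piMr // mulr_ge0.
have qT : - (1 + T ^+ 2) * q <= - q.
  by rewrite mulNr lerN2 mulrDl mul1r lerDl mulr_ge0 // sqr_ge0.
(* The vanishing gradient times the traced Christoffel symbols: the first-order part of the
   Laplacian, in the form of products that linear arithmetic can use. *)
have cg0 : c0 * (a / 2 * (2 * k0) + T * n0 - k * (2 * d0) + l * 0) = 0 by rewrite g0 mulr0.
have cg1 : c1 * (a / 2 * (2 * k1) + T * n1 - k * (2 * d1) + l * 0) = 0 by rewrite g1 mulr0.
move: t0 h0 h1 EVa cg0 cg1 PS qT; lra.
Qed.

End ChartEvolution.

Local Opaque derive.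

Lemma onframe_abstract (R : realType) (f : R * R -> 'rV[R]_4) x w
    (Xt : R * R -> R * R -> 'rV[R]_4) (XXt : R * R -> R * R -> 'rV[R]_4) :
  onframe f x w -> (forall v, 'D_v f = Xt v) -> (forall v u, 'D_u (Xt v) x = XXt v u) ->
  let e0 := Xt (w 0) x in let e1 := Xt (w 1) x in
  [/\ forall k k', dot (Xt (w k) x) (Xt (w k') x) = (k == k')%:R,
    mean_curv f x = npart e0 e1 (XXt (w 0) (w 0)) + npart e0 e1 (XXt (w 1) (w 1)) &
    normA2 f x = \sum_k \sum_m dot (npart e0 e1 (XXt (w k) (w m)))
      (npart e0 e1 (XXt (w k) (w m)))].
Proof.
move=> [_ w1 _ wH wA] XE XXE.
have XtE : Xt = (fun v => 'D_v f) by apply/funext => v; rewrite XE.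
subst Xt; have XXtE : XXt = (fun v u => 'D_u ('D_v f) x).
  by apply/funext => v; apply/funext => u; rewrite XXE.
by subst XXt.
Qed.

Lemma is_derive_fst (R : realType) (V W : normedModType R) (z v : (V * W)%type) :
  is_derive z v (fun y : (V * W)%type => y.1) v.1.
Proof.
have [df _] := Cn_on_fst (@openT _) (Cn_on_id 1 [set: (V * W)%type]).
split; first exact/diff_derivable/df.
rewrite -[X in 'D_v X z]/(fst \o @idfun (V * W)%type) -derive_fst ?derive_id //.
Qed.

(** * The differential inequality for the flow in a chart *)

Section ChartInstance.
Context {R : realType}.
Local Notation R4 := 'rV[R]_4.
Local Notation space_time := (R * (R * R))%type.
Variables (A : set space_time) (Phi : space_time -> R4).
Hypothesis oA : open A.
Hypothesis cPhi : forall n, Cn_on n A Phi.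
Hypothesis immP : forall t x, A (t, x) ->
  row_free (differential (fun y => Phi (t, y)) x).
Hypothesis lagP : forall t x, A (t, x) -> lagrangian_at (fun y => Phi (t, y)) x.
Hypothesis flowP : forall t x, A (t, x) ->
  'D_((1, 0) : space_time) Phi (t, x) = mean_curv (fun y => Phi (t, y)) x.
Hypothesis calP : forall t x, A (t, x) ->
  0 < ReOmega (dpar (fun y => Phi (t, y)) 0 x) (dpar (fun y => Phi (t, y)) 1 x).

Let nA2 (z : space_time) := normA2 (fun y => Phi (z.1, y)) z.2.

Lemma exists_stframe (X : R * R -> space_time -> R4) (XX : R * R -> R * R -> space_time -> R4)
    (H : space_time -> R4) (z : space_time) :
  (forall v t y, 'D_v (fun y => Phi (t, y)) y = X v (t, y)) ->
  (forall v u t x, 'D_u (fun y => X v (t, y)) x = XX v u (t, x)) ->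
  (forall t x, A (t, x) -> H (t, x) = mean_curv (fun y => Phi (t, y)) x) ->
  (forall z v u, A z -> XX v u z = XX u v z) ->
  A z -> exists w, stframe H nA2 X XX z w.
Proof.
move=> XE XXE HE XXC; case: z => t x Az.
have [w wP] := exists_onframe_at (@open_slice R A t oA) Az
  (@Cn_on_slice R _ 2 A Phi t (cPhi 2)) (immP Az).
have XfE v : 'D_v (fun y => Phi (t, y)) = fun y => X v (t, y).
  by apply/funext => y; rewrite XE.
have [w1 wH wA] := onframe_abstract wP XfE (fun v u => XXE v u t x).
exists w; split.
- by have [] := wP.
- exact: (w1 0 0).
- exact: (w1 1 1).
- exact: (w1 0 1).
- by rewrite HE // wH.
- rewrite /nA2 /= wA sum22 (XXC _ (w 1) (w 0) Az).
  by rewrite addrA; congr (_ + _); rewrite -addrA; congr (_ + _); rewrite mulr_natl mulr2n.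
Qed.

Definition tan_angle (f : R * R -> R4) (x : R * R) : R :=
  ImOmega (dpar f 0 x) (dpar f 1 x) / ReOmega (dpar f 0 x) (dpar f 1 x).

Let sdir (v : R * R) : space_time := (0, v).
Let tdir : space_time := (1, 0).

Lemma sdir_lin a b u v : sdir (a *: u + b *: v) = a *: sdir u + b *: sdir v.
Proof. by apply/eqP; rewrite -pair_eqE /= !scaler0 addr0 !eqxx. Qed.

Lemma chart_local_max_bound z p (a k l : R) : A z -> nA2 z <= 1 -> 0 <= a ->
  let q (y : space_time) := normH2 (fun x => Phi (y.1, x)) y.2 in
  let T (y : space_time) := tan_angle (fun x => Phi (y.1, x)) y.2 in
  let f y := a / 2 * q y + 2^-1 * ln (1 + T y ^+ 2)
    - k * dot (Phi y - p) (Phi y - p) + l * y.1 in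
  (\forall y \near z, y.1 <= z.1 -> f y <= f z) -> (1 - a) * q z <= 4 * k + l.
Proof.
move=> Az A1 a0 q T f fmax.
have [H [Ht [X [HX [XX [HXX J]]]]]] := exists_flow_jet tdir oA cPhi sdir_lin.
have dparE t x b : dpar (fun y => Phi (t, y)) b x = X (e_ b) (t, x).
  by rewrite /dpar derive_slice (jet_X J).
have HE t x : A (t, x) -> H (t, x) = mean_curv (fun y => Phi (t, y)) x.
  by move=> Atx; rewrite -(jet_H J); exact: flowP.
have fr y : A y -> exists w, stframe H nA2 X XX y w.
  apply: exists_stframe => // [v t x|v u t x|y' v u].
  - by rewrite derive_slice (jet_X J).
  - by rewrite derive_slice (jet_XX J).
  - exact: (jet_XXC J).
have oX y u v : A y -> omega (X u y) (X v y) = 0.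
  case: y => t x Ay; have oB := @omega_bil R.
  rewrite (e_E u) (e_E v) !(jet_X_lin J) // !(bilDl oB, bilDr oB, bilZl oB, bilZr oB).
  have o c d : omega (X (e_ c) (t, x)) (X (e_ d) (t, x)) = 0.
    by have := lagP Ay c d; rewrite !dparE.
  by rewrite !o !mulr0 !addr0.
have cal y : A y -> 0 < ReOmega (X (e_ 0) y) (X (e_ 1) y).
  by case: y => t x Ay; rewrite -!dparE; exact: calP.
have qE y : A y -> q y = Hsq H y.
  by case: y => t x Ay; rewrite /q /normH2 /= -HE.
have TE y : T y = tanangle X y by case: y => t x; rewrite /T /tan_angle /= !dparE.
rewrite (qE _ Az).
have tx y v : is_derive y (sdir v) (fun y : space_time => y.1) 0 := is_derive_fst y (sdir v).
have tt y : is_derive y tdir (fun y : space_time => y.1) 1 := is_derive_fst y tdir.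
have LB := local_max_bound oA (jet_PhiX J) (jet_Phit J) (jet_Xx J) (jet_Xt J) (jet_Hx J)
  (jet_Ht J) (jet_XXt J) (jet_HXx J) (jet_XXC J) (jet_X_lin J) (jet_XX_lin J) fr oX cal
  tx tt (p := p) (a := a) (k := k) (l := l) Az A1 a0.
have fE y : A y -> f y = a / 2 * Hsq H y + logsec X y - k * sqdist Phi p y + l * y.1.
  by move=> Ay; rewrite /f qE // TE.
have nf : nbhs z [set y | A y /\ (y.1 <= z.1 -> f y <= f z)].
  exact: filterI (open_nbhs_nbhs (conj oA Az)) fmax.
apply: LB.
- move=> v /=; have := near_line (sdir v) nf; apply: filterS => s [As].
  rewrite (fE _ As) (fE _ Az); apply.
  by rewrite /sdir /= scaler0 addr0.
- have := near_line tdir nf; apply: filterS => s [As + s0].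
  rewrite (fE _ As) (fE _ Az); apply.
  by rewrite /tdir /= [_%:A]mulr1 gerDl.
Qed.

End ChartInstance.

(** * Chart changes, curvature and angle on the surface *)

Section SurfaceCalculus.
Context {R : realType}.
Implicit Types (V W : normedModType R) (S : surface R).

(** On an open set the local extensions coincide with [f] near each point, so relative smoothness
    becomes smoothness. *)
Lemma smooth_on_open V W (A B : set V) (f : V -> W) : smooth_on A f ->
  open B -> B `<=` A -> forall n, Cn_on n B f.
Proof.
move=> sf oB BA n; apply: Cn_on_local => x Bx.
have [U [g [oU Ux cg fg]]] := sf x (BA _ Bx).
exists (U `&` B); first by apply: filterI; apply: open_nbhs_nbhs.
apply: (@Cn_on_eq _ _ _ _ _ g); first exact: openI.
  by move=> y [Uy By]; rewrite fg //; exact: BA.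
by apply: Cn_on_sub (cg n) => y [].
Qed.

Lemma nbhs_simg S i x j : sdom S i x -> simg S j (spar i x) ->
  nbhs x [set y | sdom S i y /\ simg S j (spar i y)].
Proof.
move=> ix jx; apply: filterI; first by apply: open_nbhs_nbhs; split; [exact: sdom_open|].
have nj : nbhs (spar i x : S) (simg S j).
  by apply: open_nbhs_nbhs; split=> //; exact: simg_open.
exact: (spar_continuous ix nj).
Qed.

Lemma chart_change S (f : S -> 'rV[R]_4) i x j y : immersion f ->
  sdom S i x -> sdom S j y -> spar i x = spar j y :> S ->
  exists2 M : 'M[R]_2, 0 < \det M & forall a,
    dpar (f \o spar i) a x = M a 0 *: dpar (f \o spar j) 0 y + M a 1 *: dpar (f \o spar j) 1 y.
Proof.
move=> immf ix jy xy.
have jx : simg S j (spar i x) by rewrite xy; exists y.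
have [U [g [oU Ux cg gE]]] := stransition_smooth (conj ix jx).
have nA := nbhs_simg ix jx.
have gx : g x = y by rewrite -gE // /= xy sparK.
exists (jacobian2 (scoord (s := S) j \o spar i) x); first exact: stransition_oriented.
have ng : \near x, (scoord (s := S) j \o spar i) x = g x.
  have nU := open_nbhs_nbhs (conj oU Ux).
  by apply: filterS (filterI nU nA) => z [Uz Az]; exact: gE.
have nf : \near x, (f \o spar i) x = ((f \o spar j) \o g) x.
  apply: filterS (filterI ng nA) => z [zE [_ [w jw wz]]].
  by rewrite /= -zE /= -wz sparK // wz.
have dg : differentiable g x by have [dg _] := cg 1%N; exact: dg.
have df : differentiable (f \o spar j) (g x).
  have [df _] := smooth_on_open (immf j).1 (@sdom_open R S j) (@subset_refl _ _) 1.
  by apply: df; rewrite gx.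
move=> a; rewrite !mxE /= (near_eq_derive _ ng) /dpar (near_eq_derive _ nf).
by rewrite derive_comp // (derive_e _ df) gx.
Qed.

Lemma dot_trace_le (p q r s : 'rV[R]_4) :
  dot (p + s) (p + s) <= 2 * (dot p p + dot q q + (dot r r + dot s s)).
Proof.
have dB := @dot_bil R.
have := dot_ge0 (p - s); have := dot_ge0 q; have := dot_ge0 r.
rewrite !(bilBl _ _ _ dB, bilBr _ _ _ dB, bilDl dB, bilDr dB) (dotC s p); lra.
Qed.

Lemma normH2_le_normA2 (f : R * R -> 'rV[R]_4) (U : set (R * R)) x :
  open U -> U x -> Cn_on 2 U f -> row_free (differential f x) -> normH2 f x <= 2 * normA2 f x.
Proof.
move=> oU Ux cf fr; have [w wP] := exists_onframe_at oU Ux cf fr.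
have [_ wH wA] := onframe_abstract wP (fun v => erefl) (fun v u => erefl).
by rewrite /normH2 wH wA sum22; exact: dot_trace_le.
Qed.

Lemma area_density_gt0 (f : R * R -> 'rV[R]_4) x :
  row_free (differential f x) -> 0 < area_density f x.
Proof.
move=> fr; rewrite /area_density sqrtr_gt0.
have -> : \det (metric f x) = \det (gram2 (dpar f ^~ x)) by [].
by rewrite det_gram2 free2_gram_gt0 //; exact: row_free_dpar.
Qed.

Lemma lagrangian_angle_logsec (f : R * R -> 'rV[R]_4) x th :
  row_free (differential f x) -> lagrangian_angle f x th -> 0 < cos th ->
  0 < ReOmega (dpar f 0 x) (dpar f 1 x) /\
  2^-1 * ln (1 + tan_angle f x ^+ 2) = - ln (cos th).
Proof.
move=> fr thP c0; have D0 := area_density_gt0 fr.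
have [ReE ImE] : ReOmega (dpar f 0 x) (dpar f 1 x) = cos th * area_density f x /\
    ImOmega (dpar f 0 x) (dpar f 1 x) = sin th * area_density f x.
  by rewrite /ReOmega /ImOmega thP; simpc.
rewrite /tan_angle ReE ImE; split; first by rewrite mulr_gt0.
have -> : 1 + (sin th * area_density f x / (cos th * area_density f x)) ^+ 2 = (cos th) ^- 2.
  transitivity ((cos th ^+ 2 + sin th ^+ 2) / cos th ^+ 2).
    by field; rewrite !gt_eqF.
  by rewrite cos2Dsin2 div1r.
rewrite lnV ?posrE ?exprn_gt0 // lnXn // mulrN; congr (- _).
by move: (ln _) => y; rewrite [y *+ 2]mulr2n; lra.
Qed.

End SurfaceCalculus.

(** * Pointwise facts along the flow *)

Section FlowFacts.
Context {R : realType} (S : surface R) (F : R -> S -> 'rV[R]_4).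
Local Notation space_time := (R * (R * R))%type.
Hypothesis hmcf : ancient_mcf F.
Hypothesis hlag : forall t : R, t <= 0 -> lagrangian (F t).
Hypothesis hac : forall t : R, t <= 0 -> almost_calibrated (F t).
Hypothesis hA1 : forall t i x, t <= 0 -> sdom S i x -> normA2 (F t \o spar i) x <= 1.

Definition stmap i (tx : space_time) := F tx.1 (spar i tx.2).
(** Strictly negative times, so that the domain is open in space-time. *)
Definition stdom i : set space_time := [set tx | tx.1 < 0 /\ sdom S i tx.2].

Lemma open_stdom i : open (stdom i).
Proof.
have -> : stdom i = (fun tx : space_time => tx.1) @^-1` [set t | t < 0] `&`
   (fun tx : space_time => tx.2) @^-1` sdom S i by [].
apply: openI; apply: open_comp => //; try by move=> ? _; [exact: cvg_fst|exact: cvg_snd].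
- by move=> z _; exact: cvg_fst.
- by move=> z _; exact: cvg_snd.
- exact: sdom_open.
Qed.

Lemma Cn_on_stmap n i : Cn_on n (stdom i) (stmap i).
Proof.
have [sm _ _] := hmcf.
have sub : stdom i `<=` [set tx : space_time | tx.1 <= 0 /\ sdom S i tx.2].
  by move=> z [/ltW z0 zi].
exact: (smooth_on_open (sm i) (@open_stdom i) sub n).
Qed.

Lemma flow_immersion (t : R) : t <= 0 -> immersion (F t).
Proof. by have [_ im _] := hmcf; exact: im. Qed.

Lemma flow_der (t : R) i x : t < 0 -> sdom S i x ->
  is_derive t 1 (fun s => F s (spar i x)) (mean_curv (F t \o spar i) x).
Proof.
have [_ _ fl] := hmcf; move=> t0 ix.
have cv : (fun h : R => h^-1 *: (((fun s => F s (spar i x)) \o shift t) (h *: 1)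
    - F t (spar i x))) @ 0^' --> mean_curv (F t \o spar i) x.
  move=> P nP; have := fl t i x (ltW t0) ix P nP.
  (* As t < 0, all small increments keep t + s <= 0 and the one-sided limit is two-sided. *)
  have neg : \forall s \near (0 : R)^', t + s <= 0.
    apply: nbhs_dnbhs; apply: filterS (@lt_nbhsl R 0 (- t) _) => [s st|]; last first.
      by rewrite oppr_gt0.
    by rewrite -lerBrDl sub0r ltW.
  apply: filterS2 neg => s ts0 /(_ ts0) /=.
  by rewrite [_%:A]mulr1 [s + t]addrC.
by split; [apply/cvg_ex; eexists; exact: cv|exact: cvg_lim cv].
Qed.

(** No change of coordinates is computed: both sides are the velocity of the same point of the
    flow. *)
Lemma mean_curv_chart (t : R) i x j y : t < 0 -> sdom S i x -> sdom S j y ->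
  spar i x = spar j y :> S -> mean_curv (F t \o spar i) x = mean_curv (F t \o spar j) y.
Proof.
move=> t0 ix jy xy; have [_ <-] := flow_der t0 ix; have [_ <-] := flow_der t0 jy.
by rewrite xy.
Qed.

Lemma tan_angle_chart (t : R) i x j y : t <= 0 -> sdom S i x -> sdom S j y ->
  spar i x = spar j y :> S -> tan_angle (F t \o spar i) x = tan_angle (F t \o spar j) y.
Proof.
move=> t0 ix jy xy; have [M M0 ME] := chart_change (flow_immersion t0) ix jy xy.
have alt (B : 'rV[R]_4 -> 'rV[R]_4 -> R) u v : bilin B -> (forall u v, B u v = - B v u) ->
    B (M 0 0 *: u + M 0 1 *: v) (M 1 0 *: u + M 1 1 *: v) = \det M * B u v.
  move=> bB alt; have alt0 w : B w w = 0 by have := alt w w; lra.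
  rewrite !(bilDr bB, bilZr bB, bilDl bB, bilZl bB) !alt0 (alt v) det_mx2; ring.
rewrite /tan_angle !ME (alt _ _ _ (@ReOmega_bil R) (@ReOmegaC R)).
rewrite (alt _ _ _ (@ImOmega_bil R) (@ImOmegaC R)).
by rewrite invfM mulrACA divff ?mul1r // gt_eqF.
Qed.

Lemma flow_angle (t : R) i x : t <= 0 -> sdom S i x -> exists c,
  [/\ cos_angles (F t) c, 0 < c,
    0 < ReOmega (dpar (F t \o spar i) 0 x) (dpar (F t \o spar i) 1 x) &
    2^-1 * ln (1 + tan_angle (F t \o spar i) x ^+ 2) = - ln c].
Proof.
move=> t0 ix; have [th thP] := lagrangian_angle_exists (hlag t0 ix).
have fr := (flow_immersion t0 i).2 x ix.
have cP : cos_angles (F t) (cos th) by exists i, x, th.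
have [Re0 lE] := lagrangian_angle_logsec fr thP (hac t0 cP).
by exists (cos th); split=> //; exact: hac t0 _ cP.
Qed.

Lemma flow_normH2_le (t : R) i x : t <= 0 -> sdom S i x -> normH2 (F t \o spar i) x <= 2.
Proof.
move=> t0 ix; have [sm im] := flow_immersion t0 i.
have cf := smooth_on_open sm (@sdom_open R S i) (@subset_refl _ _) 2.
have := normH2_le_normA2 (@sdom_open R S i) ix cf (im x ix).
by move=> /le_trans; apply; rewrite -[leRHS]mulr1 ler_pM2l // hA1.
Qed.

(** The mean value theorem is applied to <F r, v> with [v] the total displacement; Cauchy-Schwarz
    and division by |v|^2 conclude. *)
Lemma flow_displacement (t s B : R) i x : t < s -> s < 0 -> sdom S i x ->
  (forall r, t <= r <= s -> normH2 (F r \o spar i) x <= B) ->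
  dot (F s (spar i x) - F t (spar i x)) (F s (spar i x) - F t (spar i x))
    <= B * (s - t) ^+ 2.
Proof.
move=> ts s0 ix HB; set v := F s (spar i x) - F t (spar i x).
have dB := @dot_bil R.
have dg r : t <= r <= s -> is_derive r 1 (fun r => dot (F r (spar i x)) v)
    (dot (mean_curv (F r \o spar i) x) v).
  move=> /andP[_ rs]; have r0 : r < 0 by exact: le_lt_trans rs s0.
  apply: (is_derive_eq (is_derive_bil dB (flow_der r0 ix) (is_derive_cst v r 1))).
  by rewrite (bil0r _ dB) addr0.
have [r /andP[tr rs]] := mvt ts dg.
rewrite -(bilBl _ _ _ dB) -/v => vE.
have CS := cauchy_schwarz (mean_curv (F r \o spar i) x) v.
have HBr : normH2 (F r \o spar i) x <= B by apply: HB; rewrite !ltW.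
rewrite -/(normH2 _ _) in CS.
have v0 := dot_ge0 v; have st0 : 0 < s - t by rewrite subr_gt0.
have [->|vn0] := eqVneq (dot v v) 0.
  rewrite mulr_ge0 ?sqr_ge0 //; apply: le_trans HBr; exact: dot_ge0.
have vp : 0 < dot v v by rewrite lt_def vn0.
rewrite -(ler_pM2r vp) -expr2 {1}vE exprMn [leRHS]mulrAC.
apply: ler_wpM2r; first exact: sqr_ge0.
exact: (le_trans CS (ler_wpM2r v0 HBr)).
Qed.

End FlowFacts.

(** * Inverse functions in the plane *)

(** The one-sided test [local_max_left] is applied to - f and to its reflection s |-> - f (- s). *)
Lemma local_min_zero (R : realType) (f : R -> R) (l : R) : is_derive (0 : R) 1 f l ->
  (\forall s \near (0 : R), f 0 <= f s) -> l = 0.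
Proof.
move=> fl fmin; apply/eqP; rewrite eq_le; apply/andP; split.
  rewrite -oppr_ge0; apply: (local_max_left (is_deriveN fl)).
  by apply: filterS fmin => s fs _; rewrite lerN2.
have fl' : is_derive (- 0 : R) 1 (- f) (- l) by rewrite oppr0; exact: is_deriveN.
have := is_derive1_comp fl' (@is_deriveNid _ _ (0 : R) 1).
rewrite mulrN1 opprK => /local_max_left; apply.
have fmin' : \forall s \near (0 : R), f 0 <= f (- s).
  have cN : - s @[s --> (0 : R)] --> (- 0 : R) by apply: cvgN; exact: cvg_id.
  by rewrite oppr0 in cN; exact: (cN _ fmin).
by apply: filterS fmin' => s fs _; rewrite /= !fctE lerN2 oppr0.
Qed.

Section PlanarInverse.
Context {R : realType}.
Implicit Types (x y v : R * R).

Lemma normP x : `|x| = Num.max `|x.1| `|x.2|.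
Proof. by []. Qed.

Lemma norm_lt x e : (`|x| < e) = (`|x.1| < e) && (`|x.2| < e).
Proof. by rewrite normP gt_max. Qed.

Lemma norm_le x e : (`|x| <= e) = (`|x.1| <= e) && (`|x.2| <= e).
Proof. by rewrite normP ge_max. Qed.

Lemma ball_prod x y e : ball x e y <-> `|y - x| < e.
Proof. by rewrite -ball_normE /= distrC. Qed.

Variables (D : set (R * R)) (f g : R * R -> R).
Hypothesis oD : open D.
Hypothesis cf : Cn_on 1 D f.
Hypothesis cg : Cn_on 1 D g.

Let fa a := 'D_(e_ a) f.
Let ga a := 'D_(e_ a) g.

Lemma mean_value_ball (h : R * R -> R) x0 r x y : Cn_on 1 D h ->
  (forall z, `|z - x0| <= r -> D z) -> `|x - x0| <= r -> `|y - x0| <= r ->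
  exists2 z, `|z - x0| <= r &
    h x - h y = (x - y).1 * 'D_(e_ 0) h z + (x - y).2 * 'D_(e_ 1) h z.
Proof.
move=> [dh _] rD xr yr.
have zr s : 0 <= s <= 1 -> `|y + s *: (x - y) - x0| <= r.
  move=> /andP[s0 s1].
  have -> : y + s *: (x - y) - x0 = (1 - s) *: (y - x0) + s *: (x - x0).
    by rewrite scalerBl scale1r !scalerBr; apply/eqP; rewrite -pair_eqE /=;
      apply/andP; split; apply/eqP; rewrite /GRing.scale /=; ring.
  rewrite (le_trans (ler_normD _ _)) // !normrZ !ger0_norm ?subr_ge0 //.
  apply: (@le_trans _ _ ((1 - s) * r + s * r)); last by rewrite -mulrDl subrK mul1r.
  by apply: lerD; apply: ler_wpM2l => //; rewrite subr_ge0.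
have der (s : R) : 0 <= s <= 1 -> is_derive s 1 (fun s => h (y + s *: (x - y)))
    ('D_(x - y) h (y + s *: (x - y))).
  by move=> s01; apply: is_derive_line; apply/dh/rD/zr.
have [s /andP[s0 s1] sE] := mvt ltr01 der.
have s01 : 0 <= s <= 1 by rewrite !ltW.
exists (y + s *: (x - y)); first exact: zr.
move: sE; rewrite scale1r scale0r addr0 subrKC subr0 mulr1 => ->.
by rewrite derive_e //; exact/dh/rD/zr.
Qed.

Definition jdet x y := fa 0 x * ga 1 y - fa 1 x * ga 0 y.

Lemma continuous_partial (h : R * R -> R) a x : Cn_on 1 D h -> D x ->
  {for x, continuous ('D_(e_ a) h)}.
Proof. by move=> [_ Dh] Dx; exact: (Dh (e_ a)). Qed.

(* Bounds near [x0] for the matrix appearing in the mean value theorem, whose two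
   rows are evaluated at two different points. *)
Lemma jacobian_bounds x0 : D x0 -> jdet x0 x0 != 0 -> exists r d m : R,
  [/\ 0 < r, 0 < d /\ 0 < m, (forall x, `|x - x0| <= r -> D x),
    (forall x y, `|x - x0| <= r -> `|y - x0| <= r -> d <= `|jdet x y|) &
    (forall x a, `|x - x0| <= r -> `|fa a x| <= m /\ `|ga a x| <= m)].
Proof.
move=> Dx0 j0.
have cfa a : {for x0, continuous (fa a)} by exact: continuous_partial.
have cga a : {for x0, continuous (ga a)} by exact: continuous_partial.
have c1 (h : R * R -> R) : {for x0, continuous h} ->
    h p.1 @[p --> ((x0, x0) : (R * R) * (R * R))] --> h x0.
  by move=> ch; apply: (@cvg_comp _ _ _ (fun p => p.1) h _ _ _ _ ch); exact: cvg_fst.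
have c2 (h : R * R -> R) : {for x0, continuous h} ->
    h p.2 @[p --> ((x0, x0) : (R * R) * (R * R))] --> h x0.
  by move=> ch; apply: (@cvg_comp _ _ _ (fun p => p.2) h _ _ _ _ ch); exact: cvg_snd.
have cj : jdet p.1 p.2 @[p --> ((x0, x0) : (R * R) * (R * R))] --> jdet x0 x0.
  by apply: cvgB; apply: cvgM; [exact: c1|exact: c2|exact: c1|exact: c2].
have d0 : 0 < `|jdet x0 x0| by rewrite normr_gt0.
pose d := `|jdet x0 x0| / 2; have d2 : 0 < d by rewrite divr_gt0.
have dd : d < `|jdet x0 x0| by rewrite ltr_pdivrMr // ltr_pMr // ltr1n.
have nj : \forall p \near ((x0, x0) : (R * R) * (R * R)), d < `|jdet p.1 p.2|.
  have : `|jdet p.1 p.2| @[p --> ((x0, x0) : (R * R) * (R * R))] --> `|jdet x0 x0|.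
    exact: cvg_norm.
  by move=> /(_ _ (lt_nbhsr dd)).
pose m := 1 + (`|fa 0 x0| + `|fa 1 x0| + `|ga 0 x0| + `|ga 1 x0|).
have m0 : 0 < m by rewrite ltr_pwDl // !addr_ge0.
have bnd (h : R * R -> R) : {for x0, continuous h} -> `|h x0| < m ->
    \forall x \near x0, `|h x| < m.
  move=> ch hm; have : `|h x| @[x --> x0] --> `|h x0| by exact: cvg_norm.
  by move=> /(_ _ (lt_nbhsl hm)).
have nb : \forall x \near x0, [/\ D x, `|fa 0 x| < m, `|fa 1 x| < m, `|ga 0 x| < m & `|ga 1 x| < m].
  have lt4 (p q s t : R) : 0 <= p -> 0 <= q -> 0 <= s -> 0 <= t ->
      [/\ p < 1 + (p + q + s + t), q < 1 + (p + q + s + t),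
        s < 1 + (p + q + s + t) & t < 1 + (p + q + s + t)] by move=> *; split; lra.
  have [l0 l1 l2 l3] := lt4 _ _ _ _ (normr_ge0 (fa 0 x0)) (normr_ge0 (fa 1 x0))
    (normr_ge0 (ga 0 x0)) (normr_ge0 (ga 1 x0)).
  have b0 := bnd _ (cfa 0) l0; have b1 := bnd _ (cfa 1) l1.
  have b2 := bnd _ (cga 0) l2; have b3 := bnd _ (cga 1) l3.
  have nD : nbhs x0 D by exact: open_nbhs_nbhs.
  apply: filterS (filterI nD (filterI (filterI b0 b1) (filterI b2 b3))).
  by move=> x [Dx [[h0 h1] [h2 h3]]]; split; [exact: Dx|exact: h0|exact: h1|exact: h2|exact: h3].
have [e /= e0 eP] := (nbhs_ballP _ _).1 nj.
have [e' /= e'0 e'P] := (nbhs_ballP _ _).1 nb.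
pose r := Num.min e e' / 2.
have r0 : 0 < r by rewrite divr_gt0 // lt_min e0.
have rm : r < Num.min e e' by rewrite ltr_pdivrMr // ltr_pMr ?ltr1n // lt_min e0.
have [re re'] : r < e /\ r < e' by move: rm; rewrite lt_min => /andP.
have be x : `|x - x0| <= r -> ball x0 e x by move=> xr; apply/ball_prod/(le_lt_trans xr).
have be' x : `|x - x0| <= r -> ball x0 e' x by move=> xr; apply/ball_prod/(le_lt_trans xr).
exists r, d, m; split=> //.
- by move=> x /be'/e'P[].
- by move=> x y xr yr; apply: ltW; apply: (eP (x, y)); split; exact: be.
- move=> x a /be'/e'P[_ f0 f1 g0 g1].
  have [->|->] := ord2 a.
    by split; apply: ltW; [exact: f0|exact: g0].
  by split; apply: ltW; [exact: f1|exact: g1].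
Qed.

(* The local surjectivity comes from minimizing the distance to the target value:
   an interior minimum is a zero because the differential is invertible. *)
Theorem local_inverse x0 : D x0 -> jdet x0 x0 != 0 -> exists r c : R,
  [/\ 0 < r, 0 < c, (forall x, `|x - x0| <= r -> D x /\ jdet x x != 0),
    (forall x y, `|x - x0| <= r -> `|y - x0| <= r ->
       c * `|x - y| <= `|(f x - f y, g x - g y)|) &
    (forall v, `|(v.1 - f x0, v.2 - g x0)| < c * r / 4 ->
       exists2 x, `|x - x0| < r & (f x = v.1 /\ g x = v.2))].
Proof.
move=> Dx0 j0; have [r [d [m [r0 [d0 m0] rD dJ mJ]]]] := jacobian_bounds Dx0 j0.
have c0 : 0 < d / (2 * m) by rewrite divr_gt0 // mulr_gt0.
have lower x y : `|x - x0| <= r -> `|y - x0| <= r ->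
    d / (2 * m) * `|x - y| <= `|(f x - f y, g x - g y)|.
  move=> xr yr.
  have [z zr fE] : exists2 z, `|z - x0| <= r & f x - f y = (x - y).1 * fa 0 z + (x - y).2 * fa 1 z
    := mean_value_ball cf rD xr yr.
  have [z' z'r gE] : exists2 z, `|z - x0| <= r & g x - g y = (x - y).1 * ga 0 z + (x - y).2 * ga 1 z
    := mean_value_ball cg rD xr yr.
  have J := dJ z z' zr z'r.
  have [f0 _] := mJ z 0 zr; have [f1 _] := mJ z 1 zr.
  have [_ g0] := mJ z' 0 z'r; have [_ g1] := mJ z' 1 z'r.
  move: J f0 f1 g0 g1 fE gE; rewrite /jdet.
  move: (fa 0 z) (fa 1 z) (ga 0 z') (ga 1 z') => a b p q J na nb np nq.
  move: (x - y) => [w1 w2] /= fE gE.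
  set N := `|(f x - f y, g x - g y)|.
  have Nf : `|f x - f y| <= N by rewrite /N normP /= le_max lexx.
  have Ng : `|g x - g y| <= N by rewrite /N normP /= le_max lexx orbT.
  have sm (s t u w : R) : `|s| <= m -> `|t| <= m -> `|u| <= N -> `|w| <= N ->
      `|s * u - t * w| <= 2 * m * N.
    move=> sm tm uN wN; rewrite (le_trans (ler_normB _ _)) // !normrM.
    have -> : 2 * m * N = m * N + m * N by ring.
    by apply: lerD; apply: ler_pM.
  (* Cramer's rule: each coordinate of x - y times the determinant is a combination of the two
     increments. *)
  have E1 : (a * q - b * p) * w1 = q * (f x - f y) - b * (g x - g y).
    by rewrite fE gE; ring.
  have E2 : (a * q - b * p) * w2 = a * (g x - g y) - p * (f x - f y).
    by rewrite fE gE; ring.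
  have key s : `|(a * q - b * p) * s| <= 2 * m * N -> d * `|s| <= 2 * m * N.
    by move=> h; apply: le_trans h; rewrite normrM ler_wpM2r.
  rewrite mulrAC ler_pdivrMr ?mulr_gt0 // [N * _]mulrC.
  have [->|->] : `|(w1, w2)| = `|w1| \/ `|(w1, w2)| = `|w2|.
      by rewrite normP /=; case/orP: (le_total `|w1| `|w2|) => h; [right|left];
        [exact: max_r|exact: max_l].
    by apply: key; rewrite E1; exact: sm.
  by apply: key; rewrite E2; exact: sm.
exists r, (d / (2 * m)); split=> //.
- move=> x xr; split; first exact: rD.
  by rewrite -normr_gt0 (lt_le_trans d0) // dJ.
set c := d / (2 * m) in c0 lower *.
move=> v vr.
pose B := [set x : R * R | `|x - x0| <= r].
pose h (x : R * R) := (f x - v.1) * (f x - v.1) + (g x - v.2) * (g x - v.2).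
have x0B : B x0 by rewrite /B /= subrr normr0 ltW.
have cB : compact B.
  have -> : B = `[x0.1 - r, x0.1 + r] `*` `[x0.2 - r, x0.2 + r].
    apply/seteqP; split => x /=; rewrite /B /= norm_le /= !ler_distl !in_itv /=.
      by move=> /andP[-> ->].
    by move=> [-> ->].
  by apply: compact_setX; exact: segment_compact.
have [df _] := cf; have [dg _] := cg.
have ch x : D x -> {for x, continuous h}.
  move=> Dx; have cfx := differentiable_continuous (df _ Dx).
  have cgx := differentiable_continuous (dg _ Dx).
  have cf1 : f y - v.1 @[y --> x] --> f x - v.1 by apply: cvgB => //; exact: cvg_cst.
  have cg1 : g y - v.2 @[y --> x] --> g x - v.2 by apply: cvgB => //; exact: cvg_cst.
  by apply: cvgD; apply: cvgM.
have [x1 x1B hmin] : exists2 x1, x1 \in B & forall x, x \in B -> h x1 <= h x.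
  apply: compact_EVT_min => //; first by exists x0.
  by apply: continuous_in_subspaceT => x; rewrite inE => /rD; exact: ch.
move: x1B; rewrite inE => x1B.
(* The minimum is interior. At distance r from [x0] the map moves by at least c r in the maximum
   norm, so with [v] within c r / 4 of the value at [x0] the function [h] is at least (9/16) (c r)^2
   there, whereas h x0 is below (1/8) (c r)^2. *)
have x1r : `|x1 - x0| < r.
  rewrite lt_neqAle x1B andbT; apply/eqP => x1r.
  have := hmin x0; rewrite inE => /(_ x0B).
  have := lower x1 x0 x1B x0B; rewrite x1r.
  move: vr; rewrite norm_lt /= => /andP[v1 v2].
  rewrite normP /= le_max /h.
  have cr0 : 0 < c * r by rewrite mulr_gt0.
  move: v1 v2; move: (f x0) (g x0) (f x1) (g x1) (c * r) (v.1) (v.2) cr0.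
  move=> p q s t u w z u0; rewrite !ltr_norml => /andP[a1 a2] /andP[a3 a4] b hh.
  have small e : - (u / 4) < e -> e < u / 4 -> e * e < u * u / 16.
    by move=> e1 e2; have : 0 < (u / 4 - e) * (e + u / 4) by [apply: mulr_gt0; lra]; lra.
  have big e : 3 / 4 * u <= e -> 9 / 16 * (u * u) <= e * e.
    by move=> e1; have : 0 <= (e - 3 / 4 * u) * (e + 3 / 4 * u) by [apply: mulr_ge0; lra]; lra.
  have := small _ a1 a2; have := small _ a3 a4.
  have sq0 (e : R) : 0 <= e * e by rewrite -expr2 sqr_ge0.
  move: (sq0 u) (sq0 (s - w)) (sq0 (t - z)) => k0 k1 k2 j1 j2.
  have e1 : (p - w) * (p - w) = (w - p) * (w - p) by ring.
  have e2 : (q - z) * (q - z) = (z - q) * (z - q) by ring.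
  have uu : 0 < u * u by exact: mulr_gt0.
  suff : 9 / 16 * (u * u) <= (s - w) * (s - w) \/ 9 / 16 * (u * u) <= (t - z) * (t - z).
    by rewrite e1 e2 in hh; move=> [h3|h3]; lra.
  case/orP: b => /[!ler_normr] /orP[b|b]; [left|left|right|right].
  - by apply: big; lra.
  - have -> : (s - w) * (s - w) = (w - s) * (w - s) by ring.
    by apply: big; lra.
  - by apply: big; lra.
  - have -> : (t - z) * (t - z) = (z - t) * (z - t) by ring.
    by apply: big; lra.
have Dx1 := rD _ x1B.
have nB : nbhs x1 B.
  apply/nbhs_ballP; exists (r - `|x1 - x0|); first by rewrite /= subr_gt0.
  move=> y /ball_prod yx1; rewrite /B /=.
  have -> : y - x0 = (y - x1) + (x1 - x0) by rewrite addrA subrK.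
  by rewrite (le_trans (ler_normD _ _)) // -lerBrDr ltW.
have crit a : (f x1 - v.1) * fa a x1 + (g x1 - v.2) * ga a x1 = 0.
  have x10 : x1 + 0 *: e_ a = x1 by rewrite scale0r addr0.
  have Dl : D (x1 + 0 *: e_ a) by rewrite x10.
  have dfl := is_derive_line (df _ Dl); have dgl := is_derive_line (dg _ Dl).
  have f1 := is_deriveB dfl (is_derive_cst v.1 (0 : R) 1).
  have g1 := is_deriveB dgl (is_derive_cst v.2 (0 : R) 1).
  have := local_min_zero (is_deriveD (is_deriveM f1 f1) (is_deriveM g1 g1)).
  rewrite x10 /GRing.scale /= /cst => /(_ _)/wrap[].
    apply: filterS (near_line (e_ a) nB) => s sB; rewrite !fctE /= x10.
    by apply: hmin; rewrite inE.
  rewrite !fctE x10 !subr0 /fa /ga; move: ('D_(e_ a) f x1) ('D_(e_ a) g x1) => p q; lra.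
have jx1 : jdet x1 x1 != 0 by rewrite -normr_gt0 (lt_le_trans d0) // dJ.
exists x1 => //; move: (crit 0) (crit 1) jx1; rewrite /jdet.
move: (fa 0 x1) (fa 1 x1) (ga 0 x1) (ga 1 x1) => p q s t c1 c2 jx1.
split; apply/eqP; rewrite -subr_eq0; apply/eqP; apply: (mulIf jx1); rewrite mul0r.
  transitivity (((f x1 - v.1) * p + (g x1 - v.2) * s) * t
    - ((f x1 - v.1) * q + (g x1 - v.2) * t) * s); first by ring.
  by rewrite c1 c2; ring.
transitivity (((f x1 - v.1) * q + (g x1 - v.2) * t) * p
    - ((f x1 - v.1) * p + (g x1 - v.2) * s) * q); first by ring.
by rewrite c1 c2; ring.
Qed.

(** Cramer's solution w of the linear system sending w to [v] under the differential of (f, g) at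
    [x]: the velocity of a preimage when the value moves with velocity [v]. *)
Definition inverse_direction (v x : R * R) : R * R :=
  ((v.1 * ga 1 x - v.2 * fa 1 x) / jdet x x, (v.2 * fa 0 x - v.1 * ga 0 x) / jdet x x).

Lemma is_derive_pair (V W : normedModType R) (c : R -> V) (d : R -> W) (s : R) dc dd :
  is_derive s 1 c dc -> is_derive s 1 d dd -> is_derive s 1 (fun r => (c r, d r)) (dc, dd).
Proof.
move=> [dvc cE] [dvd dE].
have [dc' dd'] := ((derivable1_diffP _ _).1 dvc, (derivable1_diffP _ _).1 dvd).
have dp := differentiable_pair dc' dd'.
split; first exact/derivable1_diffP.
by rewrite deriveE // diff_pair // -!deriveE // cE dE.
Qed.

(** The inverse map is differentiated along a line. For each increment h the mean value theorem
    gives a linear system for the increment of [x], with gradients at two intermediate points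
    [zz h]. These tend to [x s] by continuity of the curve, and Cramer's solution passes to the
    limit. *)
Lemma curve_der (x : R -> R * R) (s : R) v : D (x s) -> jdet (x s) (x s) != 0 ->
  {for s, continuous x} ->
  (\forall r \near s, f (x r) = f (x s) + (r - s) * v.1 /\ g (x r) = g (x s) + (r - s) * v.2) ->
  is_derive s 1 x (inverse_direction v (x s)).
Proof.
move=> Dx j0 cx nx.
have cfa a : {for x s, continuous (fa a)} by exact: continuous_partial.
have cga a : {for x s, continuous (ga a)} by exact: continuous_partial.
have [e /= e0 eP] := (nbhs_ballP _ _).1 (open_nbhs_nbhs (conj oD Dx) : nbhs (x s) D).
have nsm : \forall h \near (0 : R), `|x (h + s) - x s| < e /\
    (f (x (h + s)) = f (x s) + h * v.1 /\ g (x (h + s)) = g (x s) + h * v.2).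
  have sh : h + s @[h --> (0 : R)] --> s.
    by rewrite -[X in _ --> X]add0r; apply: cvgD; [exact: cvg_id|exact: cvg_cst].
  have n1 : \forall r \near s, `|x r - x s| < e.
    by have /cvgrPdist_lt/(_ _ e0) := cx; apply: filterS => r; rewrite distrC.
  have n12 : nbhs s ([set r | `|x r - x s| < e] `&` [set r |
      f (x r) = f (x s) + (r - s) * v.1 /\ g (x r) = g (x s) + (r - s) * v.2]).
    by apply: filterI; [exact: n1|exact: nx].
  have n2 : \forall h \near (0 : R), `|x (h + s) - x s| < e /\
      (f (x (h + s)) = f (x s) + (h + s - s) * v.1 /\
       g (x (h + s)) = g (x s) + (h + s - s) * v.2) := sh _ n12.
  have imp h : `|x (h + s) - x s| < e /\ (f (x (h + s)) = f (x s) + (h + s - s) * v.1 /\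
       g (x (h + s)) = g (x s) + (h + s - s) * v.2) -> `|x (h + s) - x s| < e /\
      (f (x (h + s)) = f (x s) + h * v.1 /\ g (x (h + s)) = g (x s) + h * v.2).
    by rewrite addrK.
  exact: (filterS imp n2).
(* Stated as an implication inside the existential, so that a choice function exists for every h;
   where the premise fails the pair (x s, x s) is a default. *)
have ex h : exists zz : (R * R) * (R * R), (`|x (h + s) - x s| < e /\
    (f (x (h + s)) = f (x s) + h * v.1 /\ g (x (h + s)) = g (x s) + h * v.2)) ->
  [/\ `|zz.1 - x s| <= `|x (h + s) - x s|, `|zz.2 - x s| <= `|x (h + s) - x s|,
    h * v.1 = (x (h + s) - x s).1 * fa 0 zz.1 + (x (h + s) - x s).2 * fa 1 zz.1 &
    h * v.2 = (x (h + s) - x s).1 * ga 0 zz.2 + (x (h + s) - x s).2 * ga 1 zz.2].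
  set P := (_ /\ _); have [[k [fE gE]]|] := pselect P; last by exists (x s, x s).
  have bD z : `|z - x s| <= `|x (h + s) - x s| -> D z.
    by move=> zk; apply: eP; apply/ball_prod/(le_lt_trans zk).
  have ss : `|x s - x s| <= `|x (h + s) - x s| by rewrite subrr normr0.
  have [z zk zE] := mean_value_ball cf bD (lexx _) ss.
  have [z' zk' zE'] := mean_value_ball cg bD (lexx _) ss.
  exists (z, z') => _; split=> //=.
    by move: zE; rewrite fE addrAC subrr add0r.
  by move: zE'; rewrite gE addrAC subrr add0r.
have [zz zzP] := choice ex.
have near0 (c : R -> R * R) : (\forall h \near (0 : R), `|c h - x s| <= `|x (h + s) - x s|) ->
    c h @[h --> 0^'] --> x s.
  move=> nc; apply: cvg_within_filter; apply/cvgrPdist_lt => d d0.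
  have sh : h + s @[h --> (0 : R)] --> s.
    by rewrite -[X in _ --> X]add0r; apply: cvgD; [exact: cvg_id|exact: cvg_cst].
  have n1 : \forall r \near s, `|x r - x s| < d.
    by have /cvgrPdist_lt/(_ _ d0) := cx; apply: filterS => r; rewrite distrC.
  have n2 : \forall h \near (0 : R), `|x (h + s) - x s| < d := sh _ n1.
  by apply: filterS2 nc n2 => h; rewrite distrC; exact: le_lt_trans.
have cz1 : (zz h).1 @[h --> 0^'] --> x s.
  by apply: near0; apply: filterS nsm => h /zzP[].
have cz2 : (zz h).2 @[h --> 0^'] --> x s.
  by apply: near0; apply: filterS nsm => h /zzP[].
have f1 a : fa a (zz h).1 @[h --> 0^'] --> fa a (x s) := cvg_comp _ _ cz1 (cfa a).
have g2 a : ga a (zz h).2 @[h --> 0^'] --> ga a (x s) := cvg_comp _ _ cz2 (cga a).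
have cJ : jdet (zz h).1 (zz h).2 @[h --> 0^'] --> jdet (x s) (x s).
  by apply: cvgB; apply: cvgM; [exact: f1|exact: g2|exact: f1|exact: g2].
have cVJ : (jdet (zz h).1 (zz h).2)^-1 @[h --> 0^'] --> (jdet (x s) (x s))^-1.
  exact: cvgV.
have nJ : \forall h \near 0^', jdet (zz h).1 (zz h).2 != 0 by exact: (cvgr_neq0 _ cJ j0).
have cst (c : R) : c @[h --> 0^'] --> c by exact: cvg_cst.
have c1 : (v.1 * ga 1 (zz h).2 - v.2 * fa 1 (zz h).1) / jdet (zz h).1 (zz h).2 @[h --> 0^']
    --> (inverse_direction v (x s)).1.
  by apply: cvgM => //; apply: cvgB; apply: cvgM; [exact: cst|exact: g2|exact: cst|exact: f1].
have c2 : (v.2 * fa 0 (zz h).1 - v.1 * ga 0 (zz h).2) / jdet (zz h).1 (zz h).2 @[h --> 0^']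
    --> (inverse_direction v (x s)).2.
  by apply: cvgM => //; apply: cvgB; apply: cvgM; [exact: cst|exact: f1|exact: cst|exact: g2].
have der (c q : R -> R) (l : R) : q h @[h --> 0^'] --> l ->
    (\forall h \near 0^', q h = h^-1 * (c (h + s) - c s)) -> is_derive s 1 c l.
  move=> cq nq.
  have cv : (fun h : R => h^-1 *: ((c \o shift s) (h *: 1) - c s)) @ 0^' --> l.
    apply: cvg_trans cq; apply: near_eq_cvg; apply: filterS nq => h ->.
    by rewrite /= [_%:A]mulr1.
  by split; [apply/cvg_ex; eexists; exact: cv|exact: cvg_lim cv].
have xE : x = (fun r => ((x r).1, (x r).2)) by apply/funext => r; case: (x r).
have nsm' : \forall h \near (0 : R)^', ((`|x (h + s) - x s| < e /\
    (f (x (h + s)) = f (x s) + h * v.1 /\ g (x (h + s)) = g (x s) + h * v.2)) /\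
    jdet (zz h).1 (zz h).2 != 0) /\ h != 0.
  near=> h; split; last by near: h; exact: nbhs_dnbhs_neq.
  by split; near: h; [exact: nbhs_dnbhs nsm|exact: nJ].
rewrite [X in is_derive _ _ X]xE [X in is_derive _ _ _ X]surjective_pairing.
apply: is_derive_pair.
- apply: der c1 _; apply: filterS nsm' => h [[/zzP[_ _ e1 e2] j1] /= h0].
  have hh : h != 0 by [].
  move: e1 e2 j1; rewrite /jdet; move: (fa 0 _) (fa 1 _) (ga 0 _) (ga 1 _) => p q t u.
  rewrite [(x (h + s) - x s).1]/= [(x (h + s) - x s).2]/=.
  move: ((x (h + s)).1 - (x s).1) ((x (h + s)).2 - (x s).2) => k1 k2 e1 e2 j1.
  apply: (mulfI hh); rewrite mulrA (mulrA h h^-1) divff // mul1r.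
  apply: (mulIf j1); rewrite divfK // mulrBr !mulrA e1 e2; ring.
- apply: der c2 _; apply: filterS nsm' => h [[/zzP[_ _ e1 e2] j1] /= h0].
  have hh : h != 0 by [].
  move: e1 e2 j1; rewrite /jdet; move: (fa 0 _) (fa 1 _) (ga 0 _) (ga 1 _) => p q t u.
  rewrite [(x (h + s) - x s).1]/= [(x (h + s) - x s).2]/=.
  move: ((x (h + s)).1 - (x s).1) ((x (h + s)).2 - (x s).2) => k1 k2 e1 e2 j1.
  apply: (mulfI hh); rewrite mulrA (mulrA h h^-1) divff // mul1r.
  apply: (mulIf j1); rewrite divfK // mulrBr !mulrA e1 e2; ring.
Unshelve. all: by end_near. Qed.

End PlanarInverse.

(** * Projection to a tangent plane *)

Section ProjectionRatio.
Context {R : realType}.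
Implicit Types (u v n : 'rV[R]_4).
Variables (E0 E1 : 'rV[R]_4).
Hypotheses (E00 : dot E0 E0 = 1) (E11 : dot E1 E1 = 1) (E01 : dot E0 E1 = 0).

Definition proj_det u v := dot u E0 * dot v E1 - dot u E1 * dot v E0.

(* The square of the Jacobian of the orthogonal projection of the plane [<u, v>]
   onto the plane [<E0, E1>]. *)
Definition proj_ratio u v := proj_det u v ^+ 2 / (dot u u * dot v v - dot u v ^+ 2).

Lemma proj_ratio_frame u v (a b c d : R) : a * d - b * c != 0 ->
  proj_ratio (a *: u + b *: v) (c *: u + d *: v) = proj_ratio u v.
Proof.
move=> w0; have dB := @dot_bil R; rewrite /proj_ratio /proj_det.
rewrite !(bilDl dB, bilDr dB, bilZl dB, bilZr dB) (dotC v u).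
move: (dot u u) (dot u v) (dot v v) (dot u E0) (dot u E1) (dot v E0) (dot v E1).
move=> p q r s t y z; set w := a * d - b * c in w0.
rewrite [X in X / _ = _](_ : _ = (w * (s * z - t * y)) ^+ 2); last by rewrite /w; ring.
rewrite [X in _ / X = _](_ : _ = w ^+ 2 * (p * r - q ^+ 2)); last by rewrite /w; ring.
by rewrite exprMn invfM mulrACA divff ?mul1r // expf_neq0.
Qed.

(** [proj_det n v] is the inner product of [n] with the projection of [v] to the plane <E0, E1>
    turned by a quarter, a vector of length at most 1. *)
Lemma proj_det_bound n v : dot v v = 1 -> proj_det n v ^+ 2 <= dot n n.
Proof.
move=> v1; have dB := @dot_bil R.
have -> : proj_det n v = dot n (dot v E1 *: E0 - dot v E0 *: E1).
  by rewrite (bilBr _ _ _ dB) !(bilZr dB) /proj_det; ring.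
apply: (le_trans (cauchy_schwarz _ _)); rewrite -[leRHS]mulr1 ler_wpM2l ?dot_ge0 //.
rewrite !(bilBl _ _ _ dB, bilBr _ _ _ dB, bilZl dB, bilZr dB) (dotC E1 E0) E00 E11 E01.
have := bessel v E00 E11 E01; rewrite v1; lra.
Qed.

Lemma proj_detC u v : proj_det u v = - proj_det v u.
Proof. by rewrite /proj_det; ring. Qed.

Section AtFrame.
Variables (e0 e1 : 'rV[R]_4) (x0 x1 : R).
Hypotheses (e00 : dot e0 e0 = 1) (e11 : dot e1 e1 = 1) (e01 : dot e0 e1 = 0).
Let D := proj_det e0 e1.
Let v0 := x0 * dot e0 E0 + x1 * dot e1 E0.
Let v1 := x0 * dot e0 E1 + x1 * dot e1 E1.

(** Bessel's inequality for the projected vector turned by a quarter inside <E0, E1>: its components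
    on e0 and e1 are - D x1 and D x0. *)
Lemma proj_expansion : D ^+ 2 * (x0 ^+ 2 + x1 ^+ 2) <= v0 ^+ 2 + v1 ^+ 2.
Proof.
have dB := @dot_bil R.
have B := bessel (v0 *: E1 - v1 *: E0) e00 e11 e01; move: B.
rewrite !(bilBl _ _ _ dB, bilBr _ _ _ dB, bilZl dB, bilZr dB) (dotC E1 E0) E00 E11 E01.
rewrite !(dotC E0 e0) !(dotC E1 e0) !(dotC E0 e1) !(dotC E1 e1) /D /proj_det /v0 /v1.
move: (dot e0 E0) (dot e0 E1) (dot e1 E0) (dot e1 E1) => a b c d B.
apply: le_trans (le_trans B _); rewrite le_eqVlt; apply/orP; left; apply/eqP; ring.
Qed.

(** The tangential parts of [u] and [v] change the projected area and the area in the same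
    proportion and drop out, leaving 2 D (p - q) with p, q linear in the normal parts [n], [m].
    These are bounded by |A| |x|, and the remaining factor D turns |x| into the speed of the
    projection by [proj_expansion]. The estimate is thus uniform in D. *)
Lemma proj_ratio_derivative (X00 X01 X11 u v : 'rV[R]_4) (A2 : R) :
  A2 = dot (npart e0 e1 X00) (npart e0 e1 X00) + 2 * dot (npart e0 e1 X01) (npart e0 e1 X01)
     + dot (npart e0 e1 X11) (npart e0 e1 X11) ->
  u = x0 *: X00 + x1 *: X01 -> v = x0 *: X01 + x1 *: X11 ->
  (2 * D * (proj_det u e1 + proj_det e0 v)
     - D ^+ 2 * (2 * (dot u e0 + dot v e1))) ^+ 2 <= 8 * A2 * (v0 ^+ 2 + v1 ^+ 2).
Proof.
move=> AE uX vX; have dB := @dot_bil R.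
pose n := npart e0 e1 u; pose m := npart e0 e1 v.
have uE : u = n + dot u e0 *: e0 + dot u e1 *: e1.
  by rewrite /n /npart; apply/rowP => j; rewrite !mxE; ring.
have vE : v = m + dot v e0 *: e0 + dot v e1 *: e1.
  by rewrite /m /npart; apply/rowP => j; rewrite !mxE; ring.
have ue : proj_det u e1 = proj_det n e1 + dot u e0 * D.
  rewrite {1}uE /D /proj_det !(bilDl dB, bilZl dB); ring.
have ve : proj_det e0 v = proj_det e0 m + dot v e1 * D.
  rewrite {1}vE /D /proj_det !(bilDl dB, bilZl dB); ring.
have -> : 2 * D * (proj_det u e1 + proj_det e0 v) - D ^+ 2 * (2 * (dot u e0 + dot v e1))
    = 2 * D * (proj_det n e1 - proj_det m e0).
  by rewrite ue ve (proj_detC e0 m); ring.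
have N1 := proj_det_bound n e11; have N2 := proj_det_bound m e00.
set p := proj_det n e1 in N1 *; set q := proj_det m e0 in N2 *.
have nE : n = x0 *: npart e0 e1 X00 + x1 *: npart e0 e1 X01 by rewrite /n uX npartD !npartZ.
have mE : m = x0 *: npart e0 e1 X01 + x1 *: npart e0 e1 X11 by rewrite /m vX npartD !npartZ.
have two (a b : 'rV[R]_4) : dot (x0 *: a + x1 *: b) (x0 *: a + x1 *: b) <=
    (x0 ^+ 2 + x1 ^+ 2) * (dot a a + dot b b).
  have := dot_ge0 (x1 *: a - x0 *: b).
  rewrite !(bilBl _ _ _ dB, bilBr _ _ _ dB) !(bilDl dB, bilDr dB, bilZl dB, bilZr dB).
  rewrite (dotC b a); lra.
have S : dot n n + dot m m <= (x0 ^+ 2 + x1 ^+ 2) * A2.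
  rewrite nE mE AE; have := two (npart e0 e1 X00) (npart e0 e1 X01).
  have := two (npart e0 e1 X01) (npart e0 e1 X11); lra.
have A0 : 0 <= A2 by rewrite AE !addr_ge0 ?mulr_ge0 // dot_ge0.
have pq : (p - q) ^+ 2 <= 2 * ((x0 ^+ 2 + x1 ^+ 2) * A2).
  by have := sqr_ge0 (p + q); lra.
rewrite exprMn exprMn; have -> : 2 ^+ 2 = 4 :> R by ring.
apply: (@le_trans _ _ (4 * D ^+ 2 * (2 * ((x0 ^+ 2 + x1 ^+ 2) * A2)))).
  by apply: ler_wpM2l => //; rewrite mulr_ge0 // sqr_ge0.
have -> : 4 * D ^+ 2 * (2 * ((x0 ^+ 2 + x1 ^+ 2) * A2)) =
  8 * A2 * (D ^+ 2 * (x0 ^+ 2 + x1 ^+ 2)) by ring.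
by apply: ler_wpM2l; [rewrite mulr_ge0|exact: proj_expansion].
Qed.

End AtFrame.

End ProjectionRatio.

(** Here (a, b) is the projected velocity. The derivative bound keeps the ratio J away from 0 along
    a ray; the last inequality bounds the length of the lifted ray by that of its projection. *)
Lemma proj_ratio_der (R : realType) (E0 E1 : 'rV[R]_4) (X : R * R -> 'rV[R]_4)
    (U : set (R * R)) (x xi : R * R) :
  dot E0 E0 = 1 -> dot E1 E1 = 1 -> dot E0 E1 = 0 ->
  open U -> U x -> (forall n, Cn_on n U X) -> row_free (differential X x) ->
  normA2 X x <= 1 ->
  let a := dot ('D_xi X x) E0 in let b := dot ('D_xi X x) E1 in
  let J y := proj_ratio E0 E1 (dpar X 0 y) (dpar X 1 y) in
  exists dJ, [/\ is_derive x xi J dJ, dJ ^+ 2 <= 8 * (a ^+ 2 + b ^+ 2) &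
    J x * dot ('D_xi X x) ('D_xi X x) <= a ^+ 2 + b ^+ 2].
Proof.
move=> E00 E11 E01 oU Ux cX fr A1 a b J.
have dB := @dot_bil R.
have [H [Ht [Xv [HX [XX [HXX Jt]]]]]] :=
  @exists_flow_jet R (R * R)%type U X id 0 oU cX (fun _ _ _ _ => erefl).
have [w wP] := exists_onframe_at oU Ux (cX 2) fr.
have XfE v : 'D_v X = Xv v by apply/funext => y; exact: (jet_X Jt).
have [w1 _ wA] := onframe_abstract wP XfE (fun v u => jet_XX Jt v u x).
have wd := onframe_det wP.
have [x0 [x1 xiE]] := planar_decomp xi wd.
have e00 : dot (Xv (w 0) x) (Xv (w 0) x) = 1 := w1 0 0.
have e11 : dot (Xv (w 1) x) (Xv (w 1) x) = 1 := w1 1 1.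
have e01 : dot (Xv (w 0) x) (Xv (w 1) x) = 0 := w1 0 1.
have XiE : 'D_xi X x = x0 *: Xv (w 0) x + x1 *: Xv (w 1) x.
  by apply: (etrans (jet_X Jt xi x)); rewrite {1}xiE (jet_X_lin Jt).
have XXi k : XX (w k) xi x = x0 *: XX (w k) (w 0) x + x1 *: XX (w k) (w 1) x.
  have := jet_XX_lin Jt 1 0 x0 x1 (w 0) (w 1) Ux; have := jet_XX_lin Jt 0 1 x0 x1 (w 0) (w 1) Ux.
  rewrite !scale1r !scale0r addr0 !add0r -xiE => h1 h0; have [->|->] := ord2 k.
    by rewrite h0 addr0.
  by rewrite h1 (jet_XXC Jt).
have JE y : U y -> J y = proj_ratio E0 E1 (Xv (w 0) y) (Xv (w 1) y).
  move=> Uy; have dE c : dpar X c y = Xv (e_ c) y := jet_X Jt (e_ c) y.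
  rewrite /J !dE.
  have we v : Xv v y = v.1 *: Xv (e_ 0) y + v.2 *: Xv (e_ 1) y.
    by rewrite {1}(e_E v) (jet_X_lin Jt).
  by rewrite (we (w 0)) (we (w 1)) proj_ratio_frame.
have aE : a = x0 * dot (Xv (w 0) x) E0 + x1 * dot (Xv (w 1) x) E0.
  by rewrite /a XiE (bilDl dB) !(bilZl dB).
have bE : b = x0 * dot (Xv (w 0) x) E1 + x1 * dot (Xv (w 1) x) E1.
  by rewrite /b XiE (bilDl dB) !(bilZl dB).
have dX k E : is_derive x xi (fun y => dot (Xv (w k) y) E) (dot (XX (w k) xi x) E).
  apply: (is_derive_eq (is_derive_bil dB (jet_Xx Jt (w k) xi Ux) (is_derive_cst E x xi))).
  by rewrite (bil0r _ dB) addr0.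
have dXX k m : is_derive x xi (fun y => dot (Xv (w k) y) (Xv (w m) y)) _ :=
  is_derive_bil dB (jet_Xx Jt (w k) xi Ux) (jet_Xx Jt (w m) xi Ux).
have dD := is_derive_sub (is_derive_mul (dX 0 E0) (dX 1 E1)) (is_derive_mul (dX 0 E1) (dX 1 E0)).
have dG := is_derive_sub (is_derive_mul (dXX 0 0) (dXX 1 1)) (is_derive_mul (dXX 0 1) (dXX 0 1)).
have G1 : dot (Xv (w 0) x) (Xv (w 0) x) * dot (Xv (w 1) x) (Xv (w 1) x)
  - dot (Xv (w 0) x) (Xv (w 1) x) * dot (Xv (w 0) x) (Xv (w 1) x) = 1.
  by rewrite e00 e11 e01 mulr0 subr0 mul1r.
have G0 : dot (Xv (w 0) x) (Xv (w 0) x) * dot (Xv (w 1) x) (Xv (w 1) x)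
  - dot (Xv (w 0) x) (Xv (w 1) x) * dot (Xv (w 0) x) (Xv (w 1) x) != 0.
  by rewrite G1 oner_eq0.
have dGV := @is_derive_inv _ _ (fun y => dot (Xv (w 0) y) (Xv (w 0) y) * dot (Xv (w 1) y) (Xv (w 1) y)
  - dot (Xv (w 0) y) (Xv (w 1) y) * dot (Xv (w 0) y) (Xv (w 1) y)) x xi _ G0 dG.
have dJ := is_derive_mul (is_derive_mul dD dD) dGV.
pose u := XX (w 0) xi x; pose v := XX (w 1) xi x.
have key := proj_ratio_derivative E00 E11 E01 (x0 := x0) (x1 := x1) e00 e11 e01 (X00 := XX (w 0) (w 0) x)
  (X01 := XX (w 0) (w 1) x) (X11 := XX (w 1) (w 1) x) (u := u) (v := v) erefl (XXi 0).
have A2E : normA2 X x = dot (npart (Xv (w 0) x) (Xv (w 1) x) (XX (w 0) (w 0) x))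
    (npart (Xv (w 0) x) (Xv (w 1) x) (XX (w 0) (w 0) x))
  + 2 * dot (npart (Xv (w 0) x) (Xv (w 1) x) (XX (w 0) (w 1) x))
    (npart (Xv (w 0) x) (Xv (w 1) x) (XX (w 0) (w 1) x))
  + dot (npart (Xv (w 0) x) (Xv (w 1) x) (XX (w 1) (w 1) x))
    (npart (Xv (w 0) x) (Xv (w 1) x) (XX (w 1) (w 1) x)).
  by rewrite wA sum22 (jet_XXC Jt (w 1) (w 0) Ux); ring.
rewrite -A2E -aE -bE in key.
have vE : v = x0 *: XX (w 0) (w 1) x + x1 *: XX (w 1) (w 1) x.
  by rewrite /v XXi (jet_XXC Jt (w 1) (w 0) Ux).
have {}key := key vE.
eexists; split.
- apply: (near_eq_is_derive _ dJ).
  apply: filterS (open_nbhs_nbhs (conj oU Ux)) => y Uy.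
  by rewrite JE // /proj_ratio /proj_det !expr2.
- have ab0 : 0 <= a ^+ 2 + b ^+ 2 by rewrite addr_ge0 // sqr_ge0.
  apply: (@le_trans _ _ (8 * normA2 X x * (a ^+ 2 + b ^+ 2))); last first.
    by apply: ler_wpM2r => //; rewrite -[leRHS]mulr1 ler_wpM2l.
  apply: le_trans key; rewrite le_eqVlt; apply/orP; left; apply/eqP; congr (_ ^+ 2).
  rewrite G1 e00 e11 e01 /u /v /proj_det (dotC (Xv (w 0) x) (XX (w 0) xi x))
    (dotC (Xv (w 1) x) (XX (w 1) xi x)) expr1n invr1 /cst; ring.
- rewrite (JE _ Ux) /proj_ratio e00 e11 e01 expr0n subr0 mulr1 divr1 XiE.
  rewrite !(bilDl dB, bilDr dB, bilZl dB, bilZr dB) (dotC (Xv (w 1) x)) e00 e11 e01 aE bE.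
  apply: le_trans (proj_expansion E00 E11 E01 x0 x1 e00 e11 e01).
  by rewrite le_eqVlt; apply/orP; left; apply/eqP; ring.
Qed.

(** Continuous induction on [0, b]: the supremum of the parameters up to which [P] holds satisfies
    [P] by the first premise and cannot be below b by the second. The start at 0 is the first
    premise with an empty range. *)
Lemma real_induction (R : realType) (b : R) (P : R -> Prop) : 
  (forall s, 0 <= s <= b -> (forall r, 0 <= r < s -> P r) -> P s) ->
  (forall s, 0 <= s < b -> (forall r, 0 <= r <= s -> P r) ->
     exists2 e, 0 < e & forall r, s < r < s + e -> r <= b -> P r) ->
  forall s, 0 <= s <= b -> P s.
Proof.
move=> lim right s /andP[s0 sb].
pose A := [set r | 0 <= r <= b /\ forall r', 0 <= r' <= r -> P r'].
have A0 : A 0.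
  split=> [|r' r'0]; first by rewrite lexx (le_trans s0).
  have -> : r' = 0 by apply/eqP; rewrite eq_le andbC.
  apply: lim; first by rewrite lexx (le_trans s0).
  by move=> r /andP[r0 r1]; have := le_lt_trans r0 r1; rewrite ltxx.
have supA : has_sup A by split; [exists 0|exists b => r [/andP[]]].
set t := sup A.
have t0 : 0 <= t by exact: sup_upper_bound supA _ A0.
have tb : t <= b by apply: sup_le_ub => [|r [/andP[]]//]; exists 0.
have ltP r : 0 <= r < t -> P r.
  move=> /andP[r0 rt]; have tr : 0 < t - r by rewrite subr_gt0.
  have [r1 [r1b Pr1] rr1] := sup_adherent tr supA.
  by apply: Pr1; rewrite r0 ltW //; move: rr1; rewrite -/t; lra.
have Pt : P t by apply: lim => //; rewrite t0.
have leP' r : 0 <= r <= t -> P r.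
  move=> /andP[r0]; rewrite le_eqVlt => /orP[/eqP -> //|rt].
  by apply: ltP; rewrite r0.
have [tltb|bt] := Order.TotalTheory.ltP t b; last first.
  by apply: leP'; rewrite s0 (le_trans sb).
have [e e0 eP] : exists2 e, 0 < e & forall r, t < r < t + e -> r <= b -> P r.
  by apply: right => //; rewrite t0.
pose t' := Num.min (t + e / 2) b.
have e2 : 0 < e / 2 by rewrite divr_gt0.
have tt' : t < t' by rewrite lt_min tltb ltrDl e2.
have At' : A t'.
  split; first by rewrite (le_trans t0 (ltW tt')) /t' ge_min lexx orbT.
  move=> r /andP[r0 rt']; have [rt|tr] := Order.TotalTheory.leP r t.
    by apply: leP'; rewrite r0.
  move: rt'; rewrite le_min => /andP[rte rb]; apply: eP => //.
  by rewrite tr (le_lt_trans rte) // ltrD2l ltr_pdivrMr // ltr_pMr // ltr1n.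
by have := sup_upper_bound supA At'; rewrite -/t leNgt tt'.
Qed.

(** * Local inverses of the projection on the surface *)

Section RayLifting.
Context {R : realType} (S : surface R) (f : S -> 'rV[R]_4).
Hypothesis immf : immersion f.
Hypothesis hA : forall i x, sdom S i x -> normA2 (f \o spar i) x <= 1.
Variables (p0 : S) (E0 E1 : 'rV[R]_4).
Hypotheses (E00 : dot E0 E0 = 1) (E11 : dot E1 E1 = 1) (E01 : dot E0 E1 = 0).

Definition fproj (q : S) : R * R := (dot (f q - f p0) E0, dot (f q - f p0) E1).

Definition chart_ratio i x :=
  proj_ratio E0 E1 (dpar (f \o spar i) 0 x) (dpar (f \o spar i) 1 x).

Definition chart_of (q : S) : nat := sval (cid (scover q)).

Lemma chart_ofP q : exists2 x, sdom S (chart_of q) x & spar (chart_of q) x = q.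
Proof. by rewrite /chart_of; case: cid => i /= [x ix <-]; exists x. Qed.

Lemma scoord_chart_of i x y : spar (chart_of (spar i x : S)) y = spar i x :> S ->
  sdom S (chart_of (spar i x : S)) y -> scoord (chart_of (spar i x : S)) (spar i x : S) = y.
Proof. by move=> yE jy; have sk := sparK jy; rewrite yE in sk; exact: sk. Qed.

(** Read in a chosen chart; by [ratioE] every chart gives the same value. *)
Definition fratio q := chart_ratio (chart_of q) (scoord (chart_of q) q).

Lemma ratioE i x : sdom S i x -> fratio (spar i x) = chart_ratio i x.
Proof.
move=> ix; have [y jy yE] := chart_ofP (spar i x).
rewrite /fratio (scoord_chart_of yE jy) /chart_ratio.
have [M M0 ME] := chart_change immf jy ix yE.
by rewrite !ME proj_ratio_frame // -det_mx2 gt_eqF.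
Qed.

Lemma Cn_on_chart i n : Cn_on n (sdom S i) (f \o spar i).
Proof. exact: (smooth_on_open (immf i).1 (@sdom_open R S i) (@subset_refl _ _) n). Qed.

Lemma chart_differentiable i x : sdom S i x -> differentiable (f \o spar i) x.
Proof. by have [dX _] := Cn_on_chart i 1; exact: dX. Qed.

Definition pr0 i x := (fproj (spar i x)).1.
Definition pr1 i x := (fproj (spar i x)).2.

Lemma Cn_on_dot E i n : Cn_on n (sdom S i) (fun x => dot (f (spar i x) - f p0) E).
Proof.
have oD := @sdom_open R S i; apply: (Cn_on_bil (@dot_bil R)) => //; last exact: Cn_on_cst.
exact: (Cn_onD oD (Cn_on_chart i n) (Cn_on_cst n _ (- f p0))).
Qed.

Lemma derive_dot E i x v : sdom S i x ->
  'D_v (fun x => dot (f (spar i x) - f p0) E) x = dot ('D_v (f \o spar i) x) E.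
Proof.
move=> ix; have dB := @dot_bil R.
have d1 := is_derive_Cn v (Cn_on_chart i 1) ix.
have d2 := is_deriveB d1 (is_derive_cst (f p0) x v).
have [_ ->] := is_derive_bil dB d2 (is_derive_cst E x v).
by rewrite subr0 (bil0r _ dB) addr0.
Qed.

Lemma jdetE i x : sdom S i x -> jdet (pr0 i) (pr1 i) x x =
  proj_det E0 E1 (dpar (f \o spar i) 0 x) (dpar (f \o spar i) 1 x).
Proof.
move=> ix; have d0 a := derive_dot E0 (e_ a) ix : 'D_(e_ a) (pr0 i) x = _.
have d1 a := derive_dot E1 (e_ a) ix : 'D_(e_ a) (pr1 i) x = _.
have alg (a b c d a' b' c' d' : R) : a = a' -> b = b' -> c = c' -> d = d' ->
  a * d - b * c = a' * d' - c' * b' by move=> -> -> -> ->; rewrite [b' * c']mulrC.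
exact: (alg _ _ _ _ _ _ _ _ (d0 0) (d0 1) (d1 0) (d1 1)).
Qed.

Lemma chart_gram_gt0 i x : sdom S i x -> 0 < dot (dpar (f \o spar i) 0 x) (dpar (f \o spar i) 0 x)
  * dot (dpar (f \o spar i) 1 x) (dpar (f \o spar i) 1 x)
  - dot (dpar (f \o spar i) 0 x) (dpar (f \o spar i) 1 x) ^+ 2.
Proof. by move=> ix; apply/free2_gram_gt0/row_free_dpar/(immf i).2. Qed.

Lemma chart_ratio_gt0 i x : sdom S i x -> (0 < chart_ratio i x) = (jdet (pr0 i) (pr1 i) x x != 0).
Proof.
move=> ix; rewrite jdetE // /chart_ratio /proj_ratio pmulr_lgt0 ?invr_gt0 ?chart_gram_gt0 //.
by rewrite lt_def sqr_ge0 andbT sqrf_eq0.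
Qed.

(* A local inverse [gi] of the projection [fproj] around [q], in the chart [i]. *)
Record local_section (q : S) (i : nat) (x0 : R * R) (r c rho : R) (gi : R * R -> R * R) : Prop :=
  LocalSection {
  ls_dom : sdom S i x0;
  ls_q : spar i x0 = q;
  ls_r : 0 < r;
  ls_c : 0 < c;
  ls_rho : 0 < rho;
  ls_ball : forall x, `|x - x0| <= r -> sdom S i x /\ jdet (pr0 i) (pr1 i) x x != 0;
  ls_inj : forall x y, `|x - x0| <= r -> `|y - x0| <= r ->
    c * `|x - y| <= `|fproj (spar i x) - fproj (spar i y)|;
  ls_sec : forall v, `|v - fproj q| < rho ->
    `|gi v - x0| < r /\ fproj (spar i (gi v)) = v }.

Lemma exists_local_section q : 0 < fratio q ->
  exists i x0 r c rho gi, local_section q i x0 r c rho gi.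
Proof.
have [x0 ix0 qE] := chart_ofP q; move: (chart_of q) x0 ix0 qE => i x0 ix0 <-.
rewrite ratioE // chart_ratio_gt0 // => j0.
have [r [c [r0 c0 rB rI rS]]] := local_inverse (@sdom_open R S i) (Cn_on_dot E0 i 1)
  (Cn_on_dot E1 i 1) ix0 j0.
have rho0 : 0 < c * r / 4 by rewrite divr_gt0 // mulr_gt0.
(* Outside the small ball the section takes the default value [x0]. *)
have sec v : exists x, `|v - fproj (spar i x0)| < c * r / 4 ->
    `|x - x0| < r /\ fproj (spar i x) = v.
  have [vr|] := pselect (`|v - fproj (spar i x0)| < c * r / 4); last by exists x0.
  have [x xr [e1 e2]] := rS v vr; exists x => _; split => //.
  by rewrite /fproj; apply/eqP; rewrite -pair_eqE /= e1 e2 !eqxx.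
have [gi giP] := choice sec.
exists i, x0, r, c, (c * r / 4), gi; split=> //.
Qed.

Lemma Cn_on_chart_ratio i n : Cn_on n (sdom S i) (chart_ratio i).
Proof.
have oD := @sdom_open R S i; have bd := @dot_bil R.
have cd a m : Cn_on m (sdom S i) (dpar (f \o spar i) a).
  by have [_] := Cn_on_chart i m.+1; exact.
have cE a E : Cn_on n (sdom S i) (fun x => dot (dpar (f \o spar i) a x) E).
  by apply: Cn_on_bil => //; exact: Cn_on_cst.
have cc a b : Cn_on n (sdom S i) (fun x => dot (dpar (f \o spar i) a x) (dpar (f \o spar i) b x)).
  exact: Cn_on_bil.
have cB (g h : R * R -> R) : Cn_on n (sdom S i) g -> Cn_on n (sdom S i) h ->
    Cn_on n (sdom S i) (fun x => g x - h x).
  by move=> cg ch; apply: Cn_onD => //; exact: Cn_onN.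
have cdet := cB _ _ (Cn_onM oD (cE 0 E0) (cE 1 E1)) (Cn_onM oD (cE 0 E1) (cE 1 E0)).
have cgram := cB _ _ (Cn_onM oD (cc 0 0) (cc 1 1)) (Cn_onM oD (cc 0 1) (cc 0 1)).
apply: (Cn_on_eq oD _ (Cn_onM oD (Cn_onM oD cdet cdet) (Cn_onV oD _ cgram))) => x ix.
  by rewrite /chart_ratio /proj_ratio /proj_det !expr2.
have alg (a b d : R) : 0 < a * b - d ^+ 2 -> a * b - d * d != 0.
  by rewrite expr2 => /gt_eqF ->.
exact: alg _ _ _ (chart_gram_gt0 ix).
Qed.

Lemma chart_cont (h : S -> R) i x0 : sdom S i x0 -> {for x0, continuous (h \o spar i)} ->
  {for (spar i x0 : S), continuous h}.
Proof.
move=> ix0 ch; have im : simg S i (spar i x0) by exists x0.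
have cs := scoord_continuous im.
have cc : (h \o spar i) (scoord i p) @[p --> (spar i x0 : S)] --> h (spar i x0).
  by apply: (cvg_comp (scoord i) (h \o spar i) cs); rewrite sparK //; exact: ch.
apply: cvg_trans cc; apply: near_eq_cvg.
have : nbhs (spar i x0 : S) (simg S i).
  by apply: open_nbhs_nbhs; split => //; exact: simg_open.
by apply: filterS => p [x ix <-]; rewrite /= sparK.
Qed.

Lemma ratio_continuous q : {for q, continuous fratio}.
Proof.
have [x0 ix0 <-] := chart_ofP q; move: (chart_of q) ix0 => i ix0.
apply: chart_cont => //; have cr := Cn_on_continuous (Cn_on_chart_ratio i 0) ix0.
have rE := ratioE ix0; rewrite /prop_for /continuous_at -rE in cr.
apply: cvg_trans cr; apply: near_eq_cvg.
apply: filterS (open_nbhs_nbhs (conj (@sdom_open R S i) ix0)) => x ix.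
exact: (esym (ratioE ix)).
Qed.

Lemma proj1_continuous q : {for q, continuous (fun p => (fproj p).1)}.
Proof.
have [x0 ix0 <-] := chart_ofP q; move: (chart_of q) ix0 => i ix0.
exact: (@chart_cont (fun p => dot (f p - f p0) E0) i x0 ix0
  (Cn_on_continuous (Cn_on_dot E0 i 0) ix0)).
Qed.

Lemma proj2_continuous q : {for q, continuous (fun p => (fproj p).2)}.
Proof.
have [x0 ix0 <-] := chart_ofP q; move: (chart_of q) ix0 => i ix0.
exact: (@chart_cont (fun p => dot (f p - f p0) E1) i x0 ix0
  (Cn_on_continuous (Cn_on_dot E1 i 0) ix0)).
Qed.

Lemma proj_near q e : 0 < e -> \forall p \near q, `|fproj p - fproj q| < e.
Proof.
move=> e0.
have c1 : \forall p \near q, `|(fproj q).1 - (fproj p).1| < e.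
  by have /cvgrPdist_lt/(_ _ e0) := @proj1_continuous q.
have c2 : \forall p \near q, `|(fproj q).2 - (fproj p).2| < e.
  by have /cvgrPdist_lt/(_ _ e0) := @proj2_continuous q.
by apply: filterS2 c1 c2 => p h1 h2; rewrite distrC norm_lt; apply/andP.
Qed.

Definition sec i (gi : R * R -> R * R) v : S := spar i (gi v).

Section LocalSection.
Context {q : S} {i : nat} {x0 : R * R} {r c rho : R} {gi : R * R -> R * R}.
Hypothesis ls : local_section q i x0 r c rho gi.

Lemma ls_lip v v' : `|v - fproj q| < rho -> `|v' - fproj q| < rho ->
  c * `|gi v - gi v'| <= `|v - v'|.
Proof.
move=> /(ls_sec ls)[gr gv] /(ls_sec ls)[gr' gv'].
by have := ls_inj ls (ltW gr) (ltW gr'); rewrite gv gv'.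
Qed.

Lemma ls_uniq x v : `|x - x0| <= r -> `|v - fproj q| < rho -> fproj (spar i x) = v -> x = gi v.
Proof.
move=> xr /(ls_sec ls)[gr gv] xv; have := ls_inj ls xr (ltW gr).
rewrite xv gv subrr normr0 pmulr_rle0 ?(ls_c ls) // normr_le0 subr_eq0.
by move/eqP.
Qed.

Lemma ls_giq : gi (fproj q) = x0.
Proof.
apply/esym/ls_uniq; rewrite ?subrr ?normr0 ?(ls_rho ls) ?(ltW (ls_r ls)) //.
by rewrite (ls_q ls).
Qed.

Lemma gi_continuous v : `|v - fproj q| < rho -> {for v, continuous gi}.
Proof.
move=> vr; apply/cvgrPdist_lt => e e0.
have ce : 0 < c * e by rewrite mulr_gt0 // (ls_c ls).
have d0 : 0 < rho - `|v - fproj q| by rewrite subr_gt0.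
have nb : nbhs v (ball v (Num.min (c * e) (rho - `|v - fproj q|))).
  by apply: nbhsx_ballx; rewrite lt_min ce.
apply: filterS nb => w /ball_prod; rewrite lt_min => /andP[w1 w2].
have wr : `|w - fproj q| < rho.
  rewrite -[w](subrK v) -addrA (le_lt_trans (ler_normD _ _)) //.
  by rewrite -ltrBrDr.
have := ls_lip vr wr; rewrite distrC in w1 => /le_lt_trans/(_ w1).
by rewrite ltr_pM2l ?(ls_c ls).
Qed.

Lemma sec_dom v : `|v - fproj q| < rho -> sdom S i (gi v).
Proof. by move=> /(ls_sec ls)[gr _]; have [] := ls_ball ls (ltW gr). Qed.

Lemma sec_continuous v : `|v - fproj q| < rho -> {for v, continuous (sec i gi)}.
Proof.
move=> vr; apply: (continuous_comp (f := gi) (g := spar i)); first exact: gi_continuous.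
exact/spar_continuous/sec_dom.
Qed.

Lemma proj_sec v : `|v - fproj q| < rho -> fproj (sec i gi v) = v.
Proof. by move=> /(ls_sec ls)[]. Qed.

Lemma ratio_sec v : `|v - fproj q| < rho -> 0 < fratio (sec i gi v).
Proof.
move=> vr; have [gr _] := ls_sec ls vr; have [id j0] := ls_ball ls (ltW gr).
by rewrite /sec ratioE // chart_ratio_gt0.
Qed.

Lemma sec_q : sec i gi (fproj q) = q.
Proof. by rewrite /sec ls_giq (ls_q ls). Qed.

Lemma ls_nbhs : nbhs q [set p | exists2 x, `|x - x0| < r & spar i x = p].
Proof.
have im : simg S i q by exists x0; [exact: (ls_dom ls)|exact: (ls_q ls)].
have n1 : nbhs q (simg S i) by apply: open_nbhs_nbhs; split=> //; exact: simg_open.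
have cq : scoord i q = x0 by rewrite -(ls_q ls) sparK //; exact: (ls_dom ls).
have n2 : \forall p \near q, `|scoord i q - scoord i p| < r.
  by have /cvgrPdist_lt/(_ _ (ls_r ls)) := scoord_continuous im.
apply: filterS2 n1 n2 => p [x ix <-]; rewrite cq sparK // distrC => xr.
by exists x.
Qed.

(** Points near [q] have chart coordinates within [r] of [x0], where the projection is injective; so
    they lie on the section and not on another branch. *)
Lemma near_sec : \forall p \near q, `|fproj p - fproj q| < rho /\ p = sec i gi (fproj p).
Proof.
apply: filterS2 ls_nbhs (@proj_near q rho (ls_rho ls)) => p [x xr <-] pr; split=> //.
by rewrite /sec; congr (spar i _); exact: ls_uniq (ltW xr) pr erefl.
Qed.

End LocalSection.

End RayLifting.

Arguments sec {R} S i gi v.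

(** * Lifting rays to the surface *)

Lemma is_derive_curve (R : realType) (V W : normedModType R) (x : R -> V) (g : V -> W) (s : R) w :
  is_derive s 1 x w -> differentiable g (x s) -> is_derive s 1 (g \o x) ('D_w g (x s)).
Proof.
move=> [dx xw] dg; have dfx : differentiable x s by exact/derivable1_diffP.
have dc : differentiable (g \o x) s by exact: differentiable_comp.
apply: DeriveDef; first exact: diff_derivable.
by rewrite (derive_comp (1 : R) dfx dg) xw.
Qed.

Lemma Cn_on_interior (R : realType) (f : R -> R * R) (D : set R) n : open D ->
  Cn_on n D f -> (forall s, D s -> derivable f s 1) -> Cn_on n D ('D_1 f) -> Cn_on n.+1 D f.
Proof.
move=> oD cf df cD; split=> [s /df/derivable1_diffP //|v].
apply: (Cn_on_eq oD (f := fun s => v *: 'D_1 f s)).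
  by move=> s /df/derivable1_diffP ds; rewrite -[v in RHS]mulr1 [v * 1](_ : _ = v *: 1) // derive_dirZ.
apply: (Cn_on_lin (L := *:%R v) oD) => //; exact: scaler_continuous.
Qed.

Lemma near_norm_lt (R : realType) (w p : R * R) (e : R) : `|w - p| < e ->
  \forall y \near w, `|y - p| < e.
Proof.
move=> we; have d0 : 0 < e - `|w - p| by rewrite subr_gt0.
apply: filterS (nbhsx_ballx w _ d0) => y /ball_prod yw.
rewrite -[y](subrK w) -addrA (le_lt_trans (ler_normD _ _)) //.
by rewrite -ltrBrDr.
Qed.

Lemma exists_left_point (R : realType) (s d : R) : 0 < s -> 0 < d ->
  exists s', [/\ 0 <= s', s' < s & `|s' - s| < d].
Proof.
move=> s0 d0; have mp : 0 < Num.min s d by rewrite lt_min s0.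
have [ms md] : Num.min s d <= s /\ Num.min s d <= d by rewrite !ge_min !lexx !orbT.
exists (s - Num.min s d / 2); split; [lra|lra|].
by rewrite distrC gtr0_norm ?subr_gt0 //; lra.
Qed.

Lemma affine_step (R : realType) (m s t a b dj : R) : `|dj| <= m -> s < t ->
  b - a = dj * (t - s) -> 1 - m * s <= a -> 1 - m * t <= b.
Proof.
move=> dm st eq ge; have : - m * (t - s) <= dj * (t - s).
  by rewrite ler_pM2r ?subr_gt0 //; move: dm; rewrite ler_norml => /andP[].
by rewrite -eq; lra.
Qed.

Section Lifts.
Context {R : realType} (S : surface R) (f : S -> 'rV[R]_4).
Hypothesis immf : immersion f.
Hypothesis hA : forall i x, sdom S i x -> normA2 (f \o spar i) x <= 1.
Variables (p0 : S) (E0 E1 : 'rV[R]_4).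
Hypotheses (E00 : dot E0 E0 = 1) (E11 : dot E1 E1 = 1) (E01 : dot E0 E1 = 0).

Local Notation fproj := (fproj f p0 E0 E1).
Local Notation fratio := (fratio f E0 E1).
Local Notation local_section := (local_section f p0 E0 E1).
Implicit Types (v : R * R) (g : R -> S).

(** Continuity is spelled out relative to [0, b], since [g] is arbitrary outside. Positivity of the
    ratio is what provides a local section at each point of the lift. *)
Record ray_lift v (b : R) g : Prop := RayLift {
  lift_start : g 0 = p0;
  lift_proj : forall s : R, 0 <= s <= b -> fproj (g s) = s *: v;
  lift_ratio : forall s : R, 0 <= s <= b -> 0 < fratio (g s);
  lift_cont : forall s : R, 0 <= s <= b -> forall N, nbhs (g s) N ->
    exists2 d, 0 < d & forall s', 0 <= s' <= b -> `|s' - s| < d -> N (g s') }.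

Lemma lift_near v b g s0 i x0 r c rho gi : ray_lift v b g -> 0 <= s0 <= b ->
  local_section (g s0) i x0 r c rho gi ->
  exists2 d, 0 < d & forall s : R, 0 <= s <= b -> `|s - s0| < d ->
    `|s *: v - fproj (g s0)| < rho /\ g s = sec S i gi (s *: v).
Proof.
move=> L s0b ls; have [d d0 H] := lift_cont L s0b (near_sec immf ls).
by exists d => // s sb sd; have := H s sb sd; rewrite (lift_proj L sb).
Qed.

Lemma lift_sub v b b' g : ray_lift v b g -> b' <= b -> ray_lift v b' g.
Proof.
move=> L bb; have sub s : 0 <= s <= b' -> 0 <= s <= b.
  by move=> /andP[-> /le_trans -> //].
split=> [|s /sub|s /sub|s /sub sb N]; [exact: (lift_start L)|exact: (lift_proj L)|exact: (lift_ratio L)|].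
by move=> /(lift_cont L sb)[d d0 H]; exists d => // s' /sub; exact: H.
Qed.

Lemma lift_scale v g a : ray_lift v 1 g -> 0 <= a <= 1 -> ray_lift (a *: v) 1 (fun s => g (a * s)).
Proof.
move=> L /andP[a0 a1]; have sub s : 0 <= s <= 1 -> 0 <= a * s <= 1.
  by move=> /andP[s0 s1]; rewrite mulr_ge0 //= mulr_ile1.
split=> [|s /sub sb|s /sub|s /sub sb N nN].
- by rewrite mulr0 (lift_start L).
- by rewrite (lift_proj L sb) scalerA mulrC.
- exact: (lift_ratio L).
- have [d d0 H] := lift_cont L sb nN; exists d => // s' /sub s'b s'd; apply: H => //.
  rewrite -mulrBr normrM ger0_norm // (le_lt_trans _ s'd) //.
  by rewrite ler_piMl.
Qed.

(** Continuous induction: two lifts that agree before s agree at s because the surface is Hausdorff,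
    and a little beyond because both follow the same local section. *)
Lemma lift_unique v b g h : ray_lift v b g -> ray_lift v b h -> forall s : R, 0 <= s <= b -> g s = h s.
Proof.
move=> Lg Lh; apply: real_induction => [s sb eq|s /andP[s0 sb] eq].
  have /andP[s0 s1] := sb; have [<-|sn] := eqVneq 0 s; first by rewrite (lift_start Lg) (lift_start Lh).
  have sp : 0 < s by rewrite lt_def eq_sym sn.
  apply: (@surface_hausdorff R S) => A B /(lift_cont Lg sb)[d d0 HA] /(lift_cont Lh sb)[e e0 HB].
  have de : 0 < Num.min d e by rewrite lt_min d0.
  have [s' [s'0 s's]] := exists_left_point sp de; rewrite lt_min => /andP[nd ne].
  have s'b : 0 <= s' <= b by rewrite s'0 (le_trans (ltW s's)).
  exists (g s'); split; first exact: HA.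
  by rewrite eq ?s'0 //; exact: HB.
have sb' : 0 <= s <= b by rewrite s0 ltW.
have gh : g s = h s by apply: eq; rewrite s0 lexx.
have [i [x0 [r [c [rho [gi ls]]]]]] := exists_local_section immf p0 (lift_ratio Lg sb').
have [d d0 H] := lift_near Lg sb' ls; rewrite gh in ls.
have [e e0 H'] := lift_near Lh sb' ls.
exists (Num.min d e); first by rewrite lt_min d0.
move=> t /andP[st]; rewrite -ltrBlDl lt_min => /andP[td te] tb.
have t0b : 0 <= t <= b by rewrite (le_trans s0 (ltW st)).
have ts : `|t - s| = t - s by rewrite gtr0_norm ?subr_gt0.
by have [||_ ->] := H t; rewrite ?ts //; have [||_ ->] := H' t; rewrite ?ts.
Qed.

Section SectionCurve.
Context {q : S} {i : nat} {x0 : R * R} {r c rho : R} {gi : R * R -> R * R}.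
Hypothesis ls : local_section q i x0 r c rho gi.

Lemma scal_near v (t : R) : `|t *: v - fproj q| < rho ->
  \forall s \near t, `|s *: v - fproj q| < rho.
Proof.
move=> tr; have ct : {for t, continuous (fun s : R => s *: v)} by exact: scalel_continuous.
exact: (ct _ (near_norm_lt tr)).
Qed.

Lemma sec_curve_continuous v (t : R) : `|t *: v - fproj q| < rho ->
  {for t, continuous (fun s : R => sec S i gi (s *: v))}.
Proof.
move=> tr; apply: (continuous_comp (f := fun s : R => s *: v)); first exact: scalel_continuous.
exact: (sec_continuous ls).
Qed.

(** Follows the lift up to [a], then the section; the compatibility at [a] is only needed for
    continuity there. *)
Lemma ray_lift_glue v (a b : R) g : ray_lift v a g -> 0 <= a <= b ->
  (forall t : R, a <= t <= b -> `|t *: v - fproj q| < rho) ->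
  g a = sec S i gi (a *: v) ->
  ray_lift v b (fun t => if t <= a then g t else sec S i gi (t *: v)).
Proof.
move=> L /andP[a0 ab] nr ga.
have gt (t : R) : ~~ (t <= a) -> t <= b -> `|t *: v - fproj q| < rho.
  by rewrite -ltNge => at0 tb; rewrite nr // (ltW at0).
split=> [|s /andP[s0 sb]|s /andP[s0 sb]|s /andP[s0 sb] N].
- by rewrite a0 (lift_start L).
- case: ifPn => [sa|sa]; first by rewrite (lift_proj L) // s0.
  by rewrite (proj_sec ls) // gt.
- case: ifPn => [sa|sa]; first by rewrite (lift_ratio L) // s0.
  by apply: (ratio_sec immf ls); rewrite gt.
- have left : s <= a -> nbhs (g s) N ->
      exists2 d, 0 < d & forall s', 0 <= s' <= a -> `|s' - s| < d -> N (g s').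
    by move=> sa; apply: (lift_cont L); rewrite s0.
  have right : a <= s -> nbhs (sec S i gi (s *: v)) N ->
      exists2 d, 0 < d & forall s', `|s' - s| < d -> N (sec S i gi (s' *: v)).
    move=> sa nN; have sr : `|s *: v - fproj q| < rho by rewrite nr // sa.
    have /nbhs_ballP[d d0 H] := sec_curve_continuous sr nN.
    by exists d => // s' s'd; apply: H; rewrite -ball_normE /= distrC.
  case: ifPn => [sa|]; last first.
    rewrite -ltNge => sa /(right (ltW sa))[d d0 H].
    exists (Num.min d (s - a)); first by rewrite lt_min d0 subr_gt0.
    move=> s' _; rewrite lt_min => /andP[s'd]; rewrite ltr_norml => /andP[s's _].
    by rewrite ifF; [exact: H|apply/negbTE; rewrite -ltNge; lra].
  move=> nN; have [d d0 H] := left sa nN.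
  have [e e0 H'] : exists2 e, 0 < e & forall s', ~~ (s' <= a) -> `|s' - s| < e ->
      N (sec S i gi (s' *: v)).
    have [sa'|as'] := ltP s a.
      exists (a - s); rewrite ?subr_gt0 // => s'; rewrite -ltNge ltr_norml => h /andP[_ h'].
      by lra.
    have sE : s = a by apply/eqP; rewrite eq_le sa.
    have [|e e0 H'] := right as'; first by rewrite sE -ga -sE.
    by exists e => // s' _; exact: H'.
  exists (Num.min d e); first by rewrite lt_min d0.
  move=> s' /andP[s'0 s'b]; rewrite lt_min => /andP[s'd s'e].
  case: ifPn => s'a; last exact: H'.
  by apply: H => //; rewrite s'0.
Qed.

(** The velocity, in the chart, of the section above the ray of direction [v]; as a function of [x]
    it is an autonomous vector field. *)
Definition lift_dir v (x : R * R) : R * R :=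
  inverse_direction (pr0 f p0 E0 E1 i) (pr1 f p0 E0 E1 i) v x.

Lemma sec_curve_der v (t : R) : `|t *: v - fproj q| < rho ->
  is_derive t 1 (fun s : R => gi (s *: v)) (lift_dir v (gi (t *: v))).
Proof.
move=> tr; have [gr gv] := ls_sec ls tr; have [id j0] := ls_ball ls (ltW gr).
apply: (curve_der (@sdom_open R S i) (Cn_on_dot immf p0 E0 i 1) (Cn_on_dot immf p0 E1 i 1) id j0).
- apply: (continuous_comp (f := fun s : R => s *: v)); first exact: scalel_continuous.
  exact: (gi_continuous ls).
- apply: filterS (scal_near tr) => s sr.
  have [_ gs] := ls_sec ls sr.
  have e1 w x : fproj (spar i x) = w -> pr0 f p0 E0 E1 i x = w.1 by move=> <-.
  have e2 w x : fproj (spar i x) = w -> pr1 f p0 E0 E1 i x = w.2 by move=> <-.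
  suff : pr0 f p0 E0 E1 i (gi (s *: v)) = pr0 f p0 E0 E1 i (gi (t *: v)) + (s - t) * v.1 /\
    pr1 f p0 E0 E1 i (gi (s *: v)) = pr1 f p0 E0 E1 i (gi (t *: v)) + (s - t) * v.2 by [].
  rewrite (e1 _ _ gv) (e1 _ _ gs) (e2 _ _ gv) (e2 _ _ gs) /=.
  by rewrite -!mulrDl addrC subrK.
Qed.

Lemma lift_dir_dot v x : sdom S i x ->
  jdet (pr0 f p0 E0 E1 i) (pr1 f p0 E0 E1 i) x x != 0 ->
  dot ('D_(lift_dir v x) (f \o spar i) x) E0 = v.1 /\
  dot ('D_(lift_dir v x) (f \o spar i) x) E1 = v.2.
Proof.
move=> ix; have d0 a := derive_dot immf p0 E0 (e_ a) ix.
have d1 a := derive_dot immf p0 E1 (e_ a) ix.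
have dX := chart_differentiable immf ix.
have lin w E : dot ('D_w (f \o spar i) x) E =
    w.1 * dot ('D_(e_ 0) (f \o spar i) x) E + w.2 * dot ('D_(e_ 1) (f \o spar i) x) E.
  have alg (a b : R) (X Y : 'rV[R]_4) : dot (a *: X + b *: Y) E = a * dot X E + b * dot Y E.
    by have dB := @dot_bil R; rewrite (bilDl dB) !(bilZl dB).
  exact: etrans (congr1 (fun X => dot X E) (derive_e w dX)) (alg _ _ _ _).
have jE : jdet (pr0 f p0 E0 E1 i) (pr1 f p0 E0 E1 i) x x =
  dot ('D_(e_ 0) (f \o spar i) x) E0 * dot ('D_(e_ 1) (f \o spar i) x) E1 -
  dot ('D_(e_ 1) (f \o spar i) x) E0 * dot ('D_(e_ 0) (f \o spar i) x) E1.
  have alg (A B C D a b a' b' : R) : A = a -> B = b -> C = a' -> D = b' -> A * B - C * D = a * b - a' * b'.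
    by move=> -> -> -> ->.
  exact: (alg _ _ _ _ _ _ _ _ (d0 0) (d1 1) (d0 1) (d1 0)).
have dirE : lift_dir v x = ((v.1 * dot ('D_(e_ 1) (f \o spar i) x) E1 -
    v.2 * dot ('D_(e_ 1) (f \o spar i) x) E0) / jdet (pr0 f p0 E0 E1 i) (pr1 f p0 E0 E1 i) x x,
  (v.2 * dot ('D_(e_ 0) (f \o spar i) x) E0 -
    v.1 * dot ('D_(e_ 0) (f \o spar i) x) E1) / jdet (pr0 f p0 E0 E1 i) (pr1 f p0 E0 E1 i) x x).
  have alg (A B C D a b a' b' j : R) : A = a -> B = b -> C = a' -> D = b' ->
    ((v.1 * A - v.2 * B) / j, (v.2 * C - v.1 * D) / j) =
    ((v.1 * a - v.2 * b) / j, (v.2 * a' - v.1 * b') / j) by move=> -> -> -> ->.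
  exact: (alg _ _ _ _ _ _ _ _ _ (d1 1) (d0 1) (d0 0) (d1 0)).
have fin (A0 A1 B0 B1 j : R) (w : R * R) : j != 0 -> j = A0 * B1 - A1 * B0 ->
    w = ((v.1 * B1 - v.2 * A1) / j, (v.2 * A0 - v.1 * B0) / j) ->
    w.1 * A0 + w.2 * A1 = v.1 /\ w.1 * B0 + w.2 * B1 = v.2.
  by move=> + jj -> /=; rewrite jj => j0; split; field.
move=> j0; have [h0 h1] := fin _ _ _ _ _ _ j0 jE dirE.
by split; [exact: etrans (lin _ _) h0|exact: etrans (lin _ _) h1].
Qed.

(** This is [proj_ratio_der] for the velocity of the lifted ray, whose projection is exactly [v] by
    [lift_dir_dot]. *)
Lemma sec_ratio_der v (t : R) : `|t *: v - fproj q| < rho ->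
  exists dJ, [/\ is_derive t 1 (fun s : R => fratio (sec S i gi (s *: v))) dJ,
    dJ ^+ 2 <= 8 * (v.1 ^+ 2 + v.2 ^+ 2) &
    fratio (sec S i gi (t *: v)) *
      dot ('D_1 (fun s : R => f (sec S i gi (s *: v))) t)
          ('D_1 (fun s : R => f (sec S i gi (s *: v))) t) <= v.1 ^+ 2 + v.2 ^+ 2].
Proof.
move=> tr; have [gr gv] := ls_sec ls tr; have [id j0] := ls_ball ls (ltW gr).
have [e1 e2] := lift_dir_dot v id j0; have dc := sec_curve_der tr.
have subst (P : R -> R -> Prop) (a b a' b' : R) : a = a' -> b = b' -> P a b -> P a' b' by move=> -> ->.
have [dJ [derJ dJ2 Jle]] := subst (fun a b => exists dJ, [/\
    is_derive (gi (t *: v)) (lift_dir v (gi (t *: v))) (chart_ratio f E0 E1 i) dJ,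
    dJ ^+ 2 <= 8 * (a ^+ 2 + b ^+ 2) &
    chart_ratio f E0 E1 i (gi (t *: v)) * dot ('D_(lift_dir v (gi (t *: v))) (f \o spar i) (gi (t *: v)))
      ('D_(lift_dir v (gi (t *: v))) (f \o spar i) (gi (t *: v))) <= a ^+ 2 + b ^+ 2]) _ _ _ _ e1 e2
  (proj_ratio_der (lift_dir v (gi (t *: v))) E00 E11 E01 (@sdom_open R S i) id
    (Cn_on_chart immf i) ((immf i).2 _ id) (hA id)).
exists dJ; split; [|exact: dJ2|].
- have dr : differentiable (chart_ratio f E0 E1 i) (gi (t *: v)).
    by have [dr _] := Cn_on_chart_ratio immf E0 E1 i 1; exact: dr.
  have := is_derive_curve dc dr; have [_ ->] := derJ; apply: near_eq_is_derive.
  apply: filterS (scal_near tr) => s sr; have [gr' _] := ls_sec ls sr.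
  by have [id' _] := ls_ball ls (ltW gr'); rewrite /sec ratioE.
- have dX : differentiable (f \o spar i) (gi (t *: v)).
    by have [dX _] := Cn_on_chart immf i 1; exact: dX.
  have [_ dE] := is_derive_curve dc dX.
  have dE' : 'D_1 (fun s : R => f (sec S i gi (s *: v))) t = _ := dE.
  by rewrite dE' /sec ratioE.
Qed.

End SectionCurve.

(** Along the lift the ratio changes at a rate of absolute value at most m. It is differentiable
    only through local sections, so the bound is propagated from each parameter to slightly larger
    ones. *)
Lemma lift_ratio_ge v b g m : fratio p0 = 1 -> 0 <= m -> 8 * (v.1 ^+ 2 + v.2 ^+ 2) <= m ^+ 2 ->
  ray_lift v b g -> forall s, 0 <= s <= b -> 1 - m * s <= fratio (g s).
Proof.
move=> p1 m0 vm L; apply: real_induction => [s sb ge|s /andP[s0 sb] ge].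
  have /andP[s0 s1] := sb; have [<-|sn] := eqVneq 0 s; first by rewrite mulr0 subr0 (lift_start L) p1.
  have sp : 0 < s by rewrite lt_def eq_sym sn.
  rewrite leNgt; apply/negP => lt.
  have nb : nbhs (g s) [set p | fratio p < 1 - m * s].
    by apply: (@ratio_continuous _ _ _ immf E0 E1 (g s) [set y | y < 1 - m * s]); exact: lt_nbhsl.
  have [d d0 H] := lift_cont L sb nb.
  have [s' [s'0 s's s'd]] := exists_left_point sp d0.
  have h1 : fratio (g s') < 1 - m * s by apply: H => //; rewrite s'0 (le_trans (ltW s's)).
  have h2 : 1 - m * s' <= fratio (g s') by apply: ge; rewrite s'0.
  have := le_lt_trans h2 h1; rewrite ltrD2l ltrN2 ltNge.
  by rewrite ler_wpM2l // ltW.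
have sb' : 0 <= s <= b by rewrite s0 ltW.
have gs := ge s; have [i [x0 [r [c [rho [gi ls]]]]]] := exists_local_section immf p0 (lift_ratio L sb').
have [d d0 H] := lift_near L sb' ls.
exists d => // t /andP[st tsd] tb.
have near_t u : s <= u <= t -> `|u *: v - fproj (g s)| < rho /\ g u = sec S i gi (u *: v).
  move=> /andP[su ut]; apply: H; first by rewrite (le_trans s0 su) (le_trans ut tb).
  by rewrite ger0_norm ?subr_ge0 // ltrBlDl (le_lt_trans ut).
have der u : s <= u <= t -> is_derive u 1 (fun w : R => fratio (sec S i gi (w *: v)))
    ('D_1 (fun w : R => fratio (sec S i gi (w *: v))) u).
  by move=> /near_t[ur _]; have [dJ [dd _ _]] := sec_ratio_der ls ur; apply: derivableP; case: dd.
have [w /andP[sw wt]] := mvt st der.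
have [|_ gt] := near_t t; first by rewrite lexx (ltW st).
have [|_ gs'] := near_t s; first by rewrite lexx (ltW st).
rewrite -gt -gs'.
have [|wr _] := near_t w; first by rewrite (ltW sw) (ltW wt).
have [dJ [[_ ->] dJ2 _]] := sec_ratio_der ls wr => eq.
have {}gs : 1 - m * s <= fratio (g s) by apply: gs; rewrite s0 lexx.
have dm : `|dJ| <= m.
  by rewrite -(@ler_pXn2r _ 2) ?nnegrE ?normr_ge0 // real_normK ?num_real // (le_trans dJ2).
exact: affine_step dm st eq gs.
Qed.

End Lifts.

(** * The induced distance *)

(** Argued directly on the supremum over simple functions, so that it applies to the speed of an
    arbitrary curve, about whose measurability nothing is known. *)
Lemma le_integral_subset (R : realType) (D E : set R) (f g : R -> \bar R) :
  (forall x, D x -> 0 <= f x)%E -> (forall x, E x -> 0 <= g x)%E ->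
  (forall x, D x -> E x /\ (f x <= g x)%E) ->
  (\int[lebesgue_measure]_(x in D) f x <= \int[lebesgue_measure]_(x in E) g x)%E.
Proof.
move=> f0 g0 fg; rewrite !ge0_integralE //; apply: le_ereal_sup => _ /= [h hf <-].
exists h => // x; apply: le_trans (hf x) _; rewrite !patchE.
case: ifPn => [/set_mem/fg[Ex le]|_]; first by rewrite mem_set.
by case: ifPn => // /set_mem/g0.
Qed.

Lemma variation_le (R : realType) (y dy : R -> R) (a b : R) : a < b ->
  (forall x, a <= x <= b -> is_derive x 1 y (dy x) /\ {for x, continuous dy}) ->
  ((`|y b - y a|)%:E <= \int[lebesgue_measure]_(x in `[a, b]) (`|dy x|)%:E)%E.
Proof.
move=> ab der.
have yc x : a <= x <= b -> {for x, continuous y}.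
  by move=> /der[[d _] _]; apply/differentiable_continuous/derivable1_diffP.
have dyc : {within `[a, b], continuous dy}.
  apply: continuous_in_subspaceT => x /set_mem; rewrite /= in_itv /= => xab.
  by have [] := der x xab.
have dE : {in `]a, b[%R, y^`()%classic =1 dy}.
  move=> x; rewrite in_itv /= => /andP[ax xb]; rewrite derive1E.
  by have [[_ ->] _] := der x (introT andP (conj (ltW ax) (ltW xb))).
have lr : derivable_oo_LRcontinuous y a b.
  split=> [x||]; last 2 first.
  - by apply/cvg_at_right_filter/yc; rewrite lexx ltW.
  - by apply/cvg_at_left_filter/yc; rewrite lexx ltW.
  by rewrite in_itv /= => /andP[ax xb]; have [[]] := der x (introT andP (conj (ltW ax) (ltW xb))).
have ftc := continuous_FTC2 ab dyc lr dE.
rewrite -abse_EFin EFinB -ftc.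
apply: (le_trans (le_abse_integral lebesgue_measure _ _)) => //.
apply/measurable_realfun.measurable_EFinP; exact: measurable_realfun.subspace_continuous_measurable_fun.
Qed.

(** Bootstrapping: if G is of class C^n, so is its derivative Phi(G), hence G is of class
    C^(n+1). *)
Lemma Cn_on_ode (R : realType) (G : R -> R * R) (Phi : R * R -> R * R) (W : set R) (D : set (R * R)) :
  open W -> (forall s, W s -> D (G s)) ->
  (forall m, Cn_on m D (fun x => (Phi x).1)) -> (forall m, Cn_on m D (fun x => (Phi x).2)) ->
  (forall s, W s -> is_derive s 1 G (Phi (G s))) -> forall n, Cn_on n W G.
Proof.
move=> oW WD c1 c2 dG; elim=> [|n IH].
  by move=> s Ws; have [dd _] := dG s Ws; apply/differentiable_continuous/derivable1_diffP.
apply: Cn_on_interior => //; first by move=> s /dG[].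
have e1 := Cn_on_planar_comp oW WD c1 IH; have e2 := Cn_on_planar_comp oW WD c2 IH.
apply: (Cn_on_eq oW _ (Cn_on_pair oW e1 e2)) => s /dG[_ ->].
by rewrite /comp -surjective_pairing.
Qed.

Lemma near_ball_prod (R : realType) (x0 : R * R) (A : set (R * R)) : nbhs x0 A ->
  exists2 r, 0 < r & forall x, `|x - x0| <= r -> A x.
Proof.
move=> /nbhs_ballP[e /= e0 H]; exists (e / 2); first by rewrite divr_gt0.
move=> x xe; apply: H; apply/ball_prod; apply: le_lt_trans xe _.
by rewrite ltr_pdivrMr // ltr_pMr // ltr1n.
Qed.

Lemma closed_ball_compact (R : realType) (x0 : R * R) r : compact [set x | `|x - x0| <= r].
Proof.
have -> : [set x | `|x - x0| <= r] =
    `[x0.1 - r, x0.1 + r]%classic `*` `[x0.2 - r, x0.2 + r]%classic.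
  apply/seteqP; split=> x /=; rewrite norm_le !in_itv /= !ler_distl; first by move=> /andP[].
  by move=> [-> ->].
by apply: compact_setX; exact: segment_compact.
Qed.

Lemma mem_open_unit (R : realType) (s : R) : 0 < s < 1 -> s \in `[0, 1]%R.
Proof. by rewrite in_itv /= => /andP[s0 s1]; rewrite !ltW. Qed.

(** * The induced distance and the topology of the surface *)

Section ChartDistance.
Context {R : realType} (S : surface R) (f : S -> 'rV[R]_4).
Hypothesis immf : immersion f.
Implicit Types (g : R -> S).

Lemma spar_ball_closed i x0 r : (forall x, `|x - x0| <= r -> sdom S i x) ->
  closed (spar i @` [set x | `|x - x0| <= r] : set S).
Proof.
move=> sub; apply: compact_closed; first exact: surface_hausdorff.
apply: continuous_compact; last exact: closed_ball_compact.
apply: continuous_in_subspaceT => x /set_mem/sub; exact: spar_continuous.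
Qed.

Lemma spar_ball_nbhs i x0 (r : R) x : sdom S i x -> `|x - x0| < r ->
  nbhs (spar i x : S) (spar i @` [set x | `|x - x0| < r]).
Proof.
move=> ix xr; have im : simg S i (spar i x) by exists x.
have n1 : nbhs (spar i x : S) (simg S i) by apply: open_nbhs_nbhs; split=> //; exact: simg_open.
have n2 : \forall p \near (spar i x : S), `|scoord i p - x0| < r.
  have cs := scoord_continuous im; rewrite /prop_for /continuous_at sparK // in cs.
  exact: (cs _ (near_norm_lt xr)).
by apply: filterS2 n1 n2 => p [y iy <-]; rewrite sparK // => yr; exists y.
Qed.

Lemma smooth_curve_continuous g s N : smooth_curve g -> 0 <= s <= 1 -> nbhs (g s) N ->
  exists2 d, 0 < d & forall s', 0 <= s' <= 1 -> `|s' - s| < d -> N (g s').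
Proof.
move=> sg s01 nN; have s01' : s \in `[0, 1]%R by rewrite in_itv.
have [i [W [oW Ws im sm]]] := sg s s01'.
have [U [G [oU Us cG GE]]] := sm s (conj Ws s01').
have [x ix xE] := im s Ws s01'.
have GsE : G s = x by rewrite -GE //= -xE sparK.
have cs : {for s, continuous (spar i \o G : R -> S)}.
  apply: continuous_comp; first exact: (cG 0%N s Us).
  by rewrite GsE; exact: spar_continuous.
have n1 : \forall t \near s, N (spar i (G t)) by apply: cs; rewrite /comp GsE xE.
have n2 : nbhs s (U `&` W) by apply: filterI; apply: open_nbhs_nbhs.
have /nbhs_ballP[d d0 H] : nbhs s ((fun t => N (spar i (G t))) `&` (U `&` W)) by exact: filterI.
exists d => // t t01 ts.
have [|Nt [Ut Wt]] := H t; first by rewrite -ball_normE /= distrC.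
have t01' : t \in `[0, 1]%R by rewrite in_itv.
by have [y iy yE] := im t Wt t01'; move: Nt; rewrite -GE //= -yE sparK.
Qed.

(** The curve is known to be smooth in some chart [j]; the transition map carries this to the given
    chart [i]. *)
Lemma smooth_curve_chart g s i : smooth_curve g -> 0 < s < 1 -> simg S i (g s) ->
  exists A, [/\ open A, A s, Cn_on 2 A (scoord i \o g) & forall t, A t -> simg S i (g t)].
Proof.
move=> sg s01 ims; have s01' : s \in `[0, 1]%R by exact: mem_open_unit.
have [j [W [oW Ws im sm]]] := sg s s01'.
have [U [G [oU Us cG GE]]] := sm s (conj Ws s01').
have [x jx xE] := im s Ws s01'.
have GsE : G s = x by rewrite -GE //= -xE sparK.
rewrite -xE in ims.
have [V [T [oV Vx cT TE]]] := stransition_smooth (conj jx ims).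
have cG0 : {for s, continuous G} by exact: (cG 0%N s Us).
have nG : \forall t \near s, [/\ sdom S j (G t), simg S i (spar j (G t)) & V (G t)].
  have nj : \forall y \near G s, (sdom S j y /\ simg S i (spar j y)) /\ V y.
    rewrite GsE; apply: filterI; last exact: open_nbhs_nbhs.
    exact: nbhs_simg.
  have n2 : \forall t \near s, (sdom S j (G t) /\ simg S i (spar j (G t))) /\ V (G t) := cG0 _ nj.
  by apply: filterS n2 => t [[]].
have nU : \forall t \near s, (U `&` W) t /\ 0 < t < 1.
  have nUW : nbhs s (U `&` W) by apply: filterI; apply: open_nbhs_nbhs.
  apply: filterI => //; have [s0 s1] := andP s01.
  by apply: filterS2 (lt_nbhsr s0) (lt_nbhsl s1) => t -> ->.
have nA : \forall t \near s, ((U `&` W) t /\ 0 < t < 1) /\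
  [/\ sdom S j (G t), simg S i (spar j (G t)) & V (G t)] by exact: filterI.
have gE t : (U `&` W) t /\ 0 < t < 1 -> g t = spar j (G t).
  move=> [[Ut Wt] t01]; have t01' : t \in `[0, 1]%R by exact: mem_open_unit.
  have [y jy yE] := im t Wt t01'; rewrite -GE //= -yE sparK //.
pose A := interior [set t | ((U `&` W) t /\ 0 < t < 1) /\
  [/\ sdom S j (G t), simg S i (spar j (G t)) & V (G t)]].
have sub t : A t -> ((U `&` W) t /\ 0 < t < 1) /\
  [/\ sdom S j (G t), simg S i (spar j (G t)) & V (G t)] by move=> /interior_subset.
have oA : open A by exact: open_interior.
exists A; split=> // [|t /sub[h [_ h2 _]]]; last by rewrite gE.
have cGA : Cn_on 2 A G by apply: Cn_on_sub (cG 2%N) => t /sub[[[]]].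
have VA t : A t -> V (G t) by move=> /sub[_ []].
have c1 := Cn_on_planar_comp oA VA (fun m => Cn_on_fst oV (cT m)) cGA.
have c2 := Cn_on_planar_comp oA VA (fun m => Cn_on_snd oV (cT m)) cGA.
apply: (Cn_on_eq oA _ (Cn_on_pair oA c1 c2)) => t At.
have [h [h1 h2 h3]] := sub t At.
by rewrite /comp -surjective_pairing (gE t h) -TE.
Qed.

(** The quotient bounded by [M] is the trace of the inverse metric, hence at least the inverse of
    the smallest eigenvalue of the metric. *)
Lemma planar_speed (u v : 'rV[R]_4) (w1 w2 M : R) : 0 <= M ->
  0 < dot u u * dot v v - dot u v ^+ 2 ->
  (dot u u + dot v v) / (dot u u * dot v v - dot u v ^+ 2) <= M ->
  w1 ^+ 2 <= M * dot (w1 *: u + w2 *: v) (w1 *: u + w2 *: v) /\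
  w2 ^+ 2 <= M * dot (w1 *: u + w2 *: v) (w1 *: u + w2 *: v).
Proof.
move=> M0; have dB := @dot_bil R.
have -> : dot (w1 *: u + w2 *: v) (w1 *: u + w2 *: v) =
    w1 ^+ 2 * dot u u + 2 * (w1 * w2 * dot u v) + w2 ^+ 2 * dot v v.
  by rewrite !(bilDl dB, bilDr dB, bilZl dB, bilZr dB) (dotC v u); ring.
have := dot_ge0 u; have := dot_ge0 v.
move: (dot u u) (dot v v) (dot u v) => a b c b0 a0 G0 hM.
have {}hM : a + b <= M * (a * b - c ^+ 2) by rewrite -ler_pdivrMr.
set Q := _ + _ + _.
have Q0 : 0 <= Q.
  have key : (a + b) * Q = (w1 * a + w2 * c) ^+ 2 + (w1 * c + w2 * b) ^+ 2
    + (w1 ^+ 2 + w2 ^+ 2) * (a * b - c ^+ 2) by rewrite /Q; ring.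
  have ab : 0 < a + b.
    rewrite lt_def addr_ge0 // andbT; apply/eqP => ab0.
    have a00 : a = 0 by lra.
    have b00 : b = 0 by lra.
    by move: G0; rewrite a00 b00 mul0r sub0r oppr_gt0 ltNge sqr_ge0.
  rewrite -(pmulr_rge0 _ ab) key addr_ge0 ?addr_ge0 ?sqr_ge0 //.
  by rewrite mulr_ge0 ?(ltW G0) // addr_ge0 ?sqr_ge0.
have le4 (s t p q g : R) : 0 <= s -> 0 <= t -> 0 <= p -> 0 <= q -> 0 <= g ->
    p * g <= s + t + (p + q) * g /\ q * g <= s + t + (p + q) * g.
  move=> s0 t0 p0 q0 g0; have pg := mulr_ge0 p0 g0; have qg := mulr_ge0 q0 g0.
  by rewrite mulrDl; split; lra.
have q1 : w1 ^+ 2 * (a * b - c ^+ 2) <= (a + b) * Q.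
  have -> : (a + b) * Q = (w1 * a + w2 * c) ^+ 2 + (w1 * c + w2 * b) ^+ 2
    + (w1 ^+ 2 + w2 ^+ 2) * (a * b - c ^+ 2) by rewrite /Q; ring.
  exact: (le4 _ _ _ _ _ (sqr_ge0 _) (sqr_ge0 _) (sqr_ge0 _) (sqr_ge0 _) (ltW G0)).1.
have q2 : w2 ^+ 2 * (a * b - c ^+ 2) <= (a + b) * Q.
  have -> : (a + b) * Q = (w1 * a + w2 * c) ^+ 2 + (w1 * c + w2 * b) ^+ 2
    + (w1 ^+ 2 + w2 ^+ 2) * (a * b - c ^+ 2) by rewrite /Q; ring.
  exact: (le4 _ _ _ _ _ (sqr_ge0 _) (sqr_ge0 _) (sqr_ge0 _) (sqr_ge0 _) (ltW G0)).2.
have bd : (a + b) * Q <= M * Q * (a * b - c ^+ 2).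
  by rewrite mulrAC ler_wpM2r.
by split; rewrite -(ler_pM2r G0); [exact: le_trans q1 bd|exact: le_trans q2 bd].
Qed.

Lemma chart_speed i x0 : sdom S i x0 -> exists r K, [/\ 0 < r, 0 < K &
  forall x, `|x - x0| <= r -> sdom S i x /\
    forall w, `|w| <= K * enorm ('D_w (f \o spar i) x)].
Proof.
move=> ix0; have oD := @sdom_open R S i; have bd := @dot_bil R.
pose u := dpar (f \o spar i) 0; pose v := dpar (f \o spar i) 1.
have cd a : Cn_on 0 (sdom S i) (dpar (f \o spar i) a).
  by have [_] := Cn_on_chart immf i 1; exact.
have cc a b : Cn_on 0 (sdom S i) (fun x => dot (dpar (f \o spar i) a x) (dpar (f \o spar i) b x)).
  exact: Cn_on_bil.
pose G x := dot (u x) (u x) * dot (v x) (v x) - dot (u x) (v x) ^+ 2.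
have G0 x : sdom S i x -> 0 < G x.
  exact: (@chart_gram_gt0 R S f immf i x).
have cG : Cn_on 0 (sdom S i) G.
  have alg (a b c : R) : a * b - c * c = a * b - c ^+ 2 by rewrite expr2.
  have cG' := Cn_onD oD (Cn_onM oD (cc 0 0) (cc 1 1)) (Cn_onN oD (Cn_onM oD (cc 0 1) (cc 0 1))).
  by apply: Cn_on_eq oD _ cG' => x _; exact: alg.
pose h x := (dot (u x) (u x) + dot (v x) (v x)) / G x.
have ch : {for x0, continuous h}.
  have cV : Cn_on 0 (sdom S i) (fun x => (G x)^-1).
    by apply: Cn_onV => // x ix; rewrite gt_eqF // G0.
  exact: (Cn_onM oD (Cn_onD oD (cc 0 0) (cc 1 1)) cV).
pose M := `|h x0| + 1.
have M0 : 0 < M by rewrite ltr_wpDl.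
have hM : h x0 < M by rewrite ltr_pwDr // ler_norm.
have nh : \forall x \near x0, h x < M := ch _ (lt_nbhsl hM).
have nA : \forall x \near x0, sdom S i x /\ h x < M.
  by apply: filterI => //; exact: open_nbhs_nbhs.
have [r r0 rA] := near_ball_prod nA.
exists r, (Num.sqrt M); split=> //; first by rewrite sqrtr_gt0.
move=> x /rA[ix hx]; split=> // w.
have dX := chart_differentiable immf ix.
have := planar_speed w.1 w.2 (ltW M0) (G0 x ix) (ltW hx).
have -> : w.1 *: u x + w.2 *: v x = 'D_w (f \o spar i) x by exact: esym (derive_e w dX).
rewrite /enorm -sqrtrM ?(ltW M0) //; set Q := M * _ => -[w1 w2].
by rewrite norm_le -!sqrtr_sqr !ler_wsqrtr.
Qed.

Lemma curve_speed g i x0 r K t A : open A -> A t -> Cn_on 2 A (scoord i \o g) ->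
  (forall t, A t -> simg S i (g t)) -> 0 < K ->
  (forall x, `|x - x0| <= r -> sdom S i x /\
    forall w, `|w| <= K * enorm ('D_w (f \o spar i) x)) ->
  `|scoord i (g t) - x0| <= r ->
  K^-1 * `|'D_1 (scoord i \o g) t| <= enorm ('D_1 (f \o g) t).
Proof.
move=> oA At cy im K0 sp /sp[ix le].
have dX : differentiable (f \o spar i) ((scoord i \o g) t).
  by have [dX _] := Cn_on_chart immf i 1; exact: dX.
have dc := is_derive_curve (is_derive_Cn (1 : R) cy At) dX.
have dg : is_derive t 1 (f \o g) ('D_('D_1 (scoord i \o g) t) (f \o spar i) ((scoord i \o g) t)).
  apply: near_eq_is_derive dc; apply: filterS (open_nbhs_nbhs (conj oA At)) => s /im[x jx xE].
  by rewrite /comp -xE sparK.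
have [_ ->] := dg; rewrite ler_pdivrMl //; exact: le.
Qed.

Lemma ball_push (x0 x y : R * R) (r : R) : `|x - y| < r / 4 -> `|x - x0| < r / 8 ->
  `|y - x0| < r / 2.
Proof.
move=> xy x0'; have -> : y - x0 = - (x - y) + (x - x0) by rewrite opprB addrA subrK.
apply: le_lt_trans (ler_normD _ _) _; rewrite normrN; have := normr_ge0 (x - y).
by move: (`|x - y|) (`|x - x0|) xy x0' => a b; lra.
Qed.

(** A curve ending at [q] and shorter than r / (4 K) cannot leave the chart ball of radius r / 2,
    since in the chart it is at most K times as long. The curve is followed backwards from [q] by
    continuous induction; the closed image [C] handles limits. *)
Lemma dist_nbhs q (N : set S) : nbhs q N ->
  exists2 e : R, 0 < e & forall p, (dist f p q < e%:E)%E -> N p.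
Proof.
have [i [x0 ix0 <-]] := scover q => nN.
have [r1 [K [r10 K0 sp1]]] := chart_speed ix0.
have n0 : \forall x \near x0, N (spar i x) := spar_continuous ix0 nN.
have [r2 r20 sp2] := near_ball_prod n0.
pose r := Num.min r1 r2; have r0 : 0 < r by rewrite lt_min r10.
have sp x : `|x - x0| <= r -> sdom S i x /\ forall w, `|w| <= K * enorm ('D_w (f \o spar i) x).
  by rewrite le_min => /andP[/sp1].
have spN x : `|x - x0| <= r -> N (spar i x) by rewrite le_min => /andP[_ /sp2].
have r2r : r / 2 <= r by rewrite ler_pdivrMr // ler_pMr // ler1n.
have spD x : `|x - x0| <= r / 2 -> sdom S i x by move=> h; have [] := sp x (le_trans h r2r).
exists (K^-1 * (r / 4)); first by rewrite mulr_gt0 ?invr_gt0 ?divr_gt0.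
move=> p /ereal_inf_lt[_ [g [sg g0 g1] <-] lg].
pose C : set S := spar i @` [set x | `|x - x0| <= r / 2].
have cC : closed C by exact: spar_ball_closed.
suff PC : forall s : R, 0 <= s <= 1 -> C (g (1 - s)).
  have [x xr <-] : C p by rewrite -g0 -(subrr 1); apply: PC; rewrite lexx ler01.
  exact/spN/(le_trans xr).
have unit1 (s : R) : 0 <= s <= 1 -> 0 <= 1 - s <= 1.
  by move=> /andP[s0 s1]; rewrite subr_ge0 s1 gerBl.
have dif (s s' : R) : `|(1 - s') - (1 - s)| = `|s' - s|.
  by rewrite distrC; congr (`|_|); ring.
apply: real_induction => [s s01 ih|s /andP[s0 s1] ih].
  have [se|sn] := eqVneq s 0.
    by rewrite se subr0 g1; exists x0 => //=; rewrite subrr normr0 divr_ge0 // ltW.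
  have sp0 : 0 < s by rewrite lt_def sn; case/andP: s01.
  have [//|nC] := pselect (C (g (1 - s))).
  have nb : nbhs (g (1 - s)) (~` C) by apply: open_nbhs_nbhs; split=> //; exact: closed_openC.
  have [d d0 H] := smooth_curve_continuous sg (unit1 s s01) nb.
  have [s' [s'0 s's s'd]] := exists_left_point sp0 d0.
  have s'1 : s' < s by [].
  have s'01 : 0 <= s' <= 1 by rewrite s'0 (le_trans (ltW s's)) //; case/andP: s01.
  have [] := H (1 - s') (unit1 _ s'01); first by rewrite dif.
  by apply: ih; rewrite s'0.
have s01 : 0 <= s <= 1 by rewrite s0 ltW.
(* A strict bound at 1 - s, needed to go further. At the end time 1 the curve is smooth only from
   one side, so the estimate starts at 1 - h, where the curve is within r / 8 of the centre; from
   there it moves by less than r / 4. *)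
have [x ix [xr xE]] : exists2 x, sdom S i x & `|x - x0| < r / 2 /\ spar i x = g (1 - s).
  have [se|sn] := eqVneq s 0.
    by exists x0 => //; rewrite se subr0 g1 subrr normr0 divr_gt0.
  have sp0 : 0 < s by rewrite lt_def sn s0.
  have nb : nbhs (g 1) (spar i @` [set x | `|x - x0| < r / 8]).
    by rewrite g1; apply: spar_ball_nbhs => //; rewrite subrr normr0 divr_gt0.
  have i11 : 0 <= (1 : R) <= 1 by apply/andP.
  have [d d0 H] := smooth_curve_continuous sg i11 nb.
  have mp : 0 < Num.min s d by rewrite lt_min sp0.
  have [h [h0 hs hd]] : exists h, [/\ 0 < h, h < s & h < d].
    have [ms md] : Num.min s d <= s /\ Num.min s d <= d by rewrite !ge_min !lexx !orbT.
    by exists (Num.min s d / 2); move: (Num.min s d) mp ms md => m *; split; lra.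
  pose y t := scoord i (g t).
  have rng t : 1 - s <= t <= 1 - h -> 0 < t < 1 /\ 0 <= 1 - t <= s.
    by move=> /andP[ta tb]; split; apply/andP; split; move: ta tb s1 h0 hs; clear=> *; lra.
  have inC t : 1 - s <= t <= 1 - h -> simg S i (g t) /\ `|y t - x0| <= r / 2.
    move=> /rng[_ ts]; have := ih _ ts; rewrite subKr => -[x xr xE].
    by split; [exists x => //; exact: spD|rewrite /y -xE sparK //; exact: spD].
  have loc t : 1 - s <= t <= 1 - h -> exists A, [/\ open A, A t, Cn_on 2 A y & forall t, A t -> simg S i (g t)].
    by move=> tab; have [t01 _] := rng t tab; have [im _] := inC t tab; exact: smooth_curve_chart.
  have ab : 1 - s < 1 - h by rewrite ltrD2l ltrN2.
  have lenP t : (0 <= (enorm ('D_1 (f \o g) t))%:E)%E by rewrite lee_fin sqrtr_ge0.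
  (* The norm of the plane is the maximum of the coordinates, so the displacement is estimated for
     each coordinate separately. *)
  have comp (yk : R -> R) (dk : R -> R) :
      (forall t, 1 - s <= t <= 1 - h -> [/\ is_derive t 1 yk (dk t), {for t, continuous dk} &
        `|dk t| <= `|'D_1 y t| ]) -> `|yk (1 - h) - yk (1 - s)| < r / 4.
    move=> der; have der' t : 1 - s <= t <= 1 - h ->
        is_derive t 1 (fun t => K^-1 * yk t) (K^-1 * dk t) /\ {for t, continuous (fun t => K^-1 * dk t)}.
      move=> /der[d1 d2 _]; split; first exact: is_derive_scal.
      by apply: cvgM => //; exact: cvg_cst.
    have v := variation_le ab der'.
    have le : (\int[lebesgue_measure]_(x in `[(1 - s)%R, (1 - h)%R]) (`|K^-1 * dk x|)%:E <= curve_length f g)%E.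
      apply: le_integral_subset => // t /=; rewrite in_itv /= => tab.
      have [t01 _] := rng t tab; split; first by rewrite in_itv.
      rewrite lee_fin normrM gtr0_norm ?invr_gt0 //.
      have [A [oA At cA iA]] := loc t tab; have [_ yr] := inC t tab.
      apply: le_trans (curve_speed oA At cA iA K0 sp (le_trans yr r2r)).
      by apply: ler_wpM2l; [rewrite invr_ge0 ltW|have [] := der t tab].
    have := le_lt_trans (le_trans v le) lg; rewrite lte_fin -mulrBr normrM gtr0_norm ?invr_gt0 //.
    by rewrite ltr_pM2l ?invr_gt0.
  have [x [xr _ xE]] : exists x, [/\ `|x - x0| < r / 8, sdom S i x & spar i x = g (1 - h)].
    have [||x xr xE] := H (1 - h).
    - by apply: unit1; rewrite (ltW h0) (ltW (lt_trans hs s1)).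
    - by rewrite [X in `|X|](_ : _ = - h) ?normrN ?gtr0_norm //; ring.
    exists x; split=> //; apply: spD; apply: (le_trans (ltW xr)).
    by move: (r) r0; clear=> *; lra.
  have yh : y (1 - h) = x by rewrite /y -xE sparK //; apply/spD/(le_trans (ltW xr)); move: (r) r0; clear=> *; lra.
  have c1 := comp (fun t => (y t).1) (fun t => ('D_1 y t).1).
  have c2 := comp (fun t => (y t).2) (fun t => ('D_1 y t).2).
  have yy : `|y (1 - h) - y (1 - s)| < r / 4.
    rewrite norm_lt; apply/andP; split; [apply: c1|apply: c2] => t /loc[A [oA At cA _]].
      have cA' : Cn_on 1 A ('D_1 y) by have [_] := cA; exact.
      split; last by rewrite normP le_max lexx.
      - have := is_derive_Cn (1 : R) (Cn_on_fst oA cA) At; rewrite derive_fst //.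
        by have [dy _] := cA; exact: dy.
      - exact: (Cn_on_continuous (Cn_on_fst oA cA') At).
    have cA' : Cn_on 1 A ('D_1 y) by have [_] := cA; exact.
    split; last by rewrite normP le_max lexx orbT.
    - have := is_derive_Cn (1 : R) (Cn_on_snd oA cA) At; rewrite derive_snd //.
      by have [dy _] := cA; exact: dy.
    - exact: (Cn_on_continuous (Cn_on_snd oA cA') At).
  have [|[z iz zE] _] := inC (1 - s); first by rewrite lexx ltW.
  have yz : y (1 - s) = z by rewrite /y -zE sparK.
  by exists z => //; split=> //; rewrite -yz; apply: ball_push yy _; rewrite yh.
have nb := spar_ball_nbhs ix xr; rewrite xE in nb.
have [d d0 H] := smooth_curve_continuous sg (unit1 s s01) nb.
exists d => // t /andP[st tsd] t1.
have t01 : 0 <= t <= 1 by rewrite t1 (le_trans s0 (ltW st)).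
have [|z zr <-] := H (1 - t) (unit1 t t01).
  by rewrite dif gtr0_norm ?subr_gt0 // ltrBlDl.
by exists z => //; exact: ltW.
Qed.


End ChartDistance.

Lemma open_ball_prod (R : realType) (x0 : R * R) r : open [set x | `|x - x0| < r].
Proof. by rewrite openE => x xr; exact: near_norm_lt. Qed.

Lemma segment_mem (R : realType) (a a' b t : R) : 0 <= a <= b -> 0 <= a' <= b -> 0 <= t <= 1 ->
  0 <= a + t * (a' - a) <= b.
Proof.
move=> /andP[a0 ab] /andP[a'0 a'b] /andP[t0 t1].
have -> : a + t * (a' - a) = (1 - t) * a + t * a' by ring.
have t1' : 0 <= 1 - t by rewrite subr_ge0.
rewrite addr_ge0 ?mulr_ge0 //=.
have -> : b = (1 - t) * b + t * b by ring.
by rewrite lerD // ler_wpM2l.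
Qed.

Lemma integral_unit_cst (R : realType) (M : R) :
  (\int[lebesgue_measure]_(x in `]0%R, 1%R[) (M%:E) = M%:E)%E.
Proof.
have mE : lebesgue_measure (`]0%R, 1%R[%classic : set R) = 1%E.
  by rewrite lebesgue_measure_itv /= lte_fin ltr01 EFinN sube0.
rewrite (integral_cst lebesgue_measure (measurable_itv _)).
by apply: etrans (congr1 (mule M%:E) mE) _; rewrite mule1.
Qed.

Lemma half_bound (R : realType) (x y z w : R) : y * x <= z -> 2 * z <= w -> 0 <= x ->
  2^-1 <= y -> x <= w.
Proof.
move=> xz zw x0 y0; have : 2^-1 * x <= y * x by rewrite ler_wpM2r.
by lra.
Qed.

(** * Smoothness and length of lifted rays *)

Section LiftLength.
Context {R : realType} (S : surface R) (f : S -> 'rV[R]_4).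
Hypothesis immf : immersion f.
Hypothesis hA : forall i x, sdom S i x -> normA2 (f \o spar i) x <= 1.
Variables (p0 : S) (E0 E1 : 'rV[R]_4).
Hypotheses (E00 : dot E0 E0 = 1) (E11 : dot E1 E1 = 1) (E01 : dot E0 E1 = 0).

Local Notation fproj := (fproj f p0 E0 E1).
Local Notation fratio := (fratio f E0 E1).
Local Notation local_section := (local_section f p0 E0 E1).
Local Notation ray_lift := (ray_lift f p0 E0 E1).

Lemma Cn_on_lift_dir i x0 r v (k : R) : (forall x, `|x - x0| < r ->
    sdom S i x /\ jdet (pr0 f p0 E0 E1 i) (pr1 f p0 E0 E1 i) x x != 0) ->
  forall m, Cn_on m [set x | `|x - x0| < r] (fun x => (k *: lift_dir f p0 E0 E1 (i := i) v x).1) /\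
    Cn_on m [set x | `|x - x0| < r] (fun x => (k *: lift_dir f p0 E0 E1 (i := i) v x).2).
Proof.
move=> H m; set D := [set x | _]; have oD : open D by exact: open_ball_prod.
have sub : D `<=` sdom S i by move=> x /H[].
have c0 a : Cn_on m D ('D_(e_ a) (pr0 f p0 E0 E1 i)).
  by apply: Cn_on_sub sub _; have [_] := Cn_on_dot immf p0 E0 i m.+1; exact.
have c1 a : Cn_on m D ('D_(e_ a) (pr1 f p0 E0 E1 i)).
  by apply: Cn_on_sub sub _; have [_] := Cn_on_dot immf p0 E1 i m.+1; exact.
have cs (w : R) (h : R * R -> R) : Cn_on m D h -> Cn_on m D (fun x => w * h x).
  by move=> ch; apply: Cn_onM => //; exact: Cn_on_cst.
have cB (h h' : R * R -> R) : Cn_on m D h -> Cn_on m D h' -> Cn_on m D (fun x => h x - h' x).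
  by move=> ch ch'; apply: Cn_onD => //; exact: Cn_onN.
have cJ : Cn_on m D (fun x => (jdet (pr0 f p0 E0 E1 i) (pr1 f p0 E0 E1 i) x x)^-1).
  apply: Cn_onV => //; first by move=> x /H[].
  exact: (cB _ _ (Cn_onM oD (c0 0) (c1 1)) (Cn_onM oD (c0 1) (c1 0))).
split; first exact: (cs k _ (Cn_onM oD (cB _ _ (cs v.1 _ (c1 1)) (cs v.2 _ (c0 1))) cJ)).
exact: (cs k _ (Cn_onM oD (cB _ _ (cs v.2 _ (c0 0)) (cs v.1 _ (c1 0))) cJ)).
Qed.

Lemma is_derive_affine (V : normedModType R) (h : R -> V) (a k t : R) dh :
  is_derive (a + t * k) 1 h dh -> is_derive t 1 (fun t => h (a + t * k)) (k *: dh).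
Proof.
move=> [dh1 dhE]; have dl : is_derive t 1 (fun t : R => a + t * k) k.
  have := is_derive_add (is_derive_cst a t 1) (is_derive_mul (is_derive_id t 1) (is_derive_cst k t 1)).
  by rewrite mulr0 !add0r mulr1.
have dd : differentiable h (a + t * k) by exact/derivable1_diffP.
have := is_derive_curve dl dd; rewrite -[k in 'D_k _ _]mulr1 [k * 1](_ : _ = k *: 1) //.
by rewrite derive_dirZ // dhE.
Qed.

Lemma lift_local v b g s0 : ray_lift v b g -> 0 <= s0 <= b ->
  exists i x0 r c rho gi, local_section (g s0) i x0 r c rho gi.
Proof. by move=> L sb; have := exists_local_section immf p0 (lift_ratio L sb). Qed.

Lemma affine_near v a k t i x0 r c rho gi q d : local_section q i x0 r c rho gi ->
  0 < d -> `|(a + t * k) *: v - fproj q| < rho ->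
  \forall s \near t, `|(a + s * k) - (a + t * k)| < d /\ `|(a + s * k) *: v - fproj q| < rho.
Proof.
move=> ls d0 tr.
have cl : {for t, continuous (fun s : R => a + s * k)}.
  by apply: cvgD; [exact: cvg_cst|apply: cvgM; [exact: cvg_id|exact: cvg_cst]].
have n1 : \forall s \near (a + t * k), `|s - (a + t * k)| < d /\ `|s *: v - fproj q| < rho.
  apply: filterI; last exact: scal_near tr.
  by apply: filterS (nbhsx_ballx (a + t * k) d d0) => s; rewrite -ball_normE /= distrC.
exact: cl _ n1.
Qed.

(** In a chart the lift solves the autonomous equation of the smooth field [lift_dir], scaled by the
    speed of the affine reparametrization, so it is smooth by bootstrapping. *)
Lemma lift_smooth_curve v b g a a' : ray_lift v b g -> 0 <= a <= b -> 0 <= a' <= b ->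
  smooth_curve (fun t => g (a + t * (a' - a))).
Proof.
move=> L ab a'b s; rewrite in_itv /= => s01; pose k := a' - a.
have sb := segment_mem ab a'b s01.
have [i [x0 [r [c [rho [gi ls]]]]]] := lift_local L sb.
have [d d0 H] := lift_near immf L sb ls.
have [|sr _] := H _ sb; first by rewrite subrr normr0.
have nW := affine_near ls d0 sr.
pose W := interior [set s' | `|(a + s' * k) - (a + s * k)| < d /\
  `|(a + s' * k) *: v - fproj (g (a + s * k))| < rho].
have WP t : W t -> `|(a + t * k) - (a + s * k)| < d /\
  `|(a + t * k) *: v - fproj (g (a + s * k))| < rho by move=> /interior_subset.
have oW : open W by exact: open_interior.
have gE t : W t -> 0 <= t <= 1 -> g (a + t * k) = spar i (gi ((a + t * k) *: v)).
  by move=> /WP[td _] t01; have [] := H _ (segment_mem ab a'b t01) td.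
have dom t : W t -> sdom S i (gi ((a + t * k) *: v)).
  by move=> /WP[_ tr]; exact: sec_dom ls _ tr.
exists i, W; split=> //.
  move=> t Wt; rewrite in_itv /= => t01.
  by exists (gi ((a + t * k) *: v)); [exact: dom|rewrite -gE].
move=> t [Wt _]; exists W, (fun t => gi ((a + t * k) *: v)); split=> //; last first.
  move=> u Wu [_]; rewrite /= in_itv /= => u01.
  by rewrite (gE _ Wu u01) sparK //; exact: dom.
have bD x : `|x - x0| < r -> sdom S i x /\ jdet (pr0 f p0 E0 E1 i) (pr1 f p0 E0 E1 i) x x != 0.
  by move=> xr; exact: ls_ball ls _ (ltW xr).
have cc := Cn_on_lift_dir v k bD.
apply: (@Cn_on_ode R _ _ W [set x | `|x - x0| < r] oW _ (fun m => (cc m).1) (fun m => (cc m).2)).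
  by move=> u /WP[_ ur]; have [] := ls_sec ls ur.
move=> u /WP[_ ur]; exact: (is_derive_affine (h := fun t : R => gi (t *: v)) (sec_curve_der immf ls ur)).
Qed.

(** The lift itself is a competitor for the distance. As the ratio times its squared speed is at
    most |v|^2, a ratio of at least 1/2 gives squared speed at most 2 |v|^2. *)
Lemma lift_dist v b g L a a' : ray_lift v b g ->
  (forall s, 0 <= s <= b -> 2^-1 <= fratio (g s)) ->
  0 <= L -> 2 * (v.1 ^+ 2 + v.2 ^+ 2) <= L ^+ 2 -> 0 <= a <= b -> 0 <= a' <= b ->
  (dist f (g a) (g a') <= (L * `|a' - a|)%:E)%E.
Proof.
move=> Lg rat L0 vL ab a'b; pose k := a' - a.
apply: (@le_trans _ _ (curve_length f (fun t => g (a + t * k)))).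
  apply: ereal_inf_lbound; exists (fun t => g (a + t * k)) => //; split.
  - exact: (lift_smooth_curve Lg).
  - by rewrite mul0r addr0.
  - by rewrite mul1r /k addrC subrK.
rewrite -[leRHS]integral_unit_cst; apply: le_integral_subset.
- by move=> x _; rewrite lee_fin sqrtr_ge0.
- by move=> x _; rewrite lee_fin mulr_ge0.
move=> s /= s01; split=> //; move: s01; rewrite in_itv /= => /andP[s0 s1].
have s01 : 0 <= s <= 1 by rewrite !ltW.
have sb := segment_mem ab a'b s01.
have [i [x0 [r [c [rho [gi ls]]]]]] := lift_local Lg sb.
have [d d0 H] := lift_near immf Lg sb ls.
have [|sr gs] := H _ sb; first by rewrite subrr normr0.
have nW := affine_near ls d0 sr.
have [dJ [_ _]] := sec_ratio_der immf hA E00 E11 E01 ls sr.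
rewrite -gs; pose D := 'D_1 (fun t : R => f (sec S i gi (t *: v))) (a + s * k) => le0.
have le : fratio (g (a + s * (a' - a))) * dot D D <= v.1 ^+ 2 + v.2 ^+ 2 := le0.
have dX : differentiable (f \o spar i) (gi ((a + s * k) *: v)).
  by have [dX _] := Cn_on_chart immf i 1; exact: dX _ (sec_dom ls sr).
have [dd _] := is_derive_curve (sec_curve_der immf ls sr) dX.
have dD : is_derive (a + s * k) 1 (fun t : R => f (sec S i gi (t *: v))) D.
  by apply: DeriveDef.
have dg : is_derive s 1 (f \o (fun t => g (a + t * k))) (k *: D).
  apply: near_eq_is_derive (is_derive_affine dD).
  have n01 : \forall t \near s, 0 < t < 1 by apply: filterS2 (lt_nbhsr s0) (lt_nbhsl s1) => t -> ->.
  apply: filterS2 n01 nW => t /andP[t0 t1] [td _].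
  have t01 : 0 <= t <= 1 by rewrite !ltW.
  by have [_] := H (a + t * k) (segment_mem ab a'b t01) td; rewrite /comp => ->.
have [_ ->] := dg; rewrite lee_fin.
have DL : dot D D <= L ^+ 2.
  exact: half_bound le vL (dot_ge0 D) (rat _ sb).
have dB := @dot_bil R; rewrite /enorm (bilZl dB) (bilZr dB) mulrA -expr2.
rewrite sqrtrM ?sqr_ge0 // sqrtr_sqr mulrC ler_wpM2r //.
by rewrite -[leRHS](ger0_norm L0) -sqrtr_sqr ler_wsqrtr.
Qed.

End LiftLength.

(** * Sheets over a disc *)

Lemma convex_lt (R : realType) (k t x p e : R) : k <= t <= 1 ->
  `|k * x - p| < e -> `|x - p| < e -> `|t * x - p| < e.
Proof.
move=> /andP[kt t1]; rewrite !ltr_norml => /andP[a b] /andP[c d].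
have [x0|x0] := Order.TotalTheory.leP 0 x.
  have h1 : k * x <= t * x by rewrite ler_wpM2r.
  have h2 : t * x <= 1 * x by rewrite ler_wpM2r.
  by rewrite mul1r in h2; apply/andP; split; lra.
have h1 : t * x <= k * x by rewrite ler_wnM2r // ltW.
have h2 : 1 * x <= t * x by rewrite ler_wnM2r // ltW.
by rewrite mul1r in h2; apply/andP; split; lra.
Qed.

Lemma convex_norm_lt (R : realType) (k t e : R) (w p : R * R) : k <= t <= 1 ->
  `|k *: w - p| < e -> `|w - p| < e -> `|t *: w - p| < e.
Proof.
move=> kt; rewrite !norm_lt /= => /andP[a b] /andP[c d].
by apply/andP; split; apply: (convex_lt kt).
Qed.

(** Origin of the radius 1/8: in the maximum norm v.1^2 + v.2^2 is at most 1/32, so slope 1/2 is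
    allowed in [lift_ratio_ge], the ratio stays above 1/2 up to parameter 1, and lifted rays have
    speed at most 1. *)
Lemma small_bounds (R : realType) (v : R * R) : `|v| <= 8^-1 ->
  8 * (v.1 ^+ 2 + v.2 ^+ 2) <= (2^-1) ^+ 2 /\ 2 * (v.1 ^+ 2 + v.2 ^+ 2) <= 1 ^+ 2.
Proof.
rewrite norm_le => /andP[a b].
have sq (x : R) : `|x| <= 8^-1 -> x ^+ 2 <= (8^-1) ^+ 2.
  by move=> h; rewrite -[x ^+ 2]real_normK ?num_real // ler_pXn2r // ?nnegrE ?invr_ge0.
by have := sq _ a; have := sq _ b; rewrite !expr2 => ? ?; split; lra.
Qed.

Lemma half_le (R : realType) (s : R) : s <= 1 -> 2^-1 <= 1 - 2^-1 * s.
Proof. by move=> s1; lra. Qed.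

Lemma lt_dist (R : realType) (x y s e : R) : x < s -> y < s -> s - x < e -> s - y < e ->
  `|y - x| < e.
Proof. by move=> xs ys hx hy; rewrite ltr_norml; apply/andP; split; lra. Qed.

Lemma add_half_lt (R : realType) (x y t u s e : R) : x < e / 2 -> s - u < e / 2 -> t <= s ->
  y <= (t - u) * 1 -> y + x < e.
Proof. by move=> *; lra. Qed.

Section Sheet.
Context {R : realType} (S : surface R) (f : S -> 'rV[R]_4).
Hypothesis immf : immersion f.
Hypothesis hA : forall i x, sdom S i x -> normA2 (f \o spar i) x <= 1.
Hypothesis complf : complete_metric f.
Variables (p0 : S) (E0 E1 : 'rV[R]_4).
Hypotheses (E00 : dot E0 E0 = 1) (E11 : dot E1 E1 = 1) (E01 : dot E0 E1 = 0).

Local Notation fproj := (fproj f p0 E0 E1).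
Local Notation fratio := (fratio f E0 E1).
Local Notation local_section := (local_section f p0 E0 E1).
Local Notation ray_lift := (ray_lift f p0 E0 E1).
Hypothesis ratio0 : fratio p0 = 1.

Lemma fproj0 : fproj p0 = 0.
Proof. by rewrite /fproj subrr !(bil0l _ (@dot_bil R)). Qed.

Lemma ray_lift0 v : ray_lift v 0 (fun => p0).
Proof.
have s0 (s : R) : 0 <= s <= 0 -> s = 0 by rewrite -eq_le => /eqP.
split=> // [s /s0 ->|s _|s _ N nN]; first by rewrite scale0r fproj0.
  by rewrite ratio0.
by exists 1 => // *; exact: nbhs_singleton nN.
Qed.

Lemma ray_lift_eq v b g h : ray_lift v b g -> 0 <= b -> (forall s : R, 0 <= s <= b -> g s = h s) ->
  ray_lift v b h.
Proof.
move=> L b0 gh; split=> [|s sb|s sb|s sb N].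
- by have <- : g 0 = h 0; [apply: gh; rewrite lexx|exact: (lift_start L)].
- by rewrite -gh // (lift_proj L).
- by rewrite -gh // (lift_ratio L).
- rewrite -gh // => /(lift_cont L sb)[d d0 H]; exists d => // s' s'b s'd.
  by rewrite -gh //; exact: H.
Qed.

Lemma lift_ratio_half v b g : `|v| <= 8^-1 -> ray_lift v b g -> b <= 1 ->
  forall s, 0 <= s <= b -> 2^-1 <= fratio (g s).
Proof.
move=> vs L b1 s sb; have [v8 _] := small_bounds vs.
have h0 : 0 <= (2^-1 : R) by rewrite invr_ge0.
have := lift_ratio_ge immf hA E00 E11 E01 ratio0 h0 v8 L sb; apply: le_trans.
by case/andP: sb => _ sb; exact/half_le/(le_trans sb b1).
Qed.

Lemma ray_lift_extend v s g : `|v| <= 8^-1 -> 0 <= s -> ray_lift v s g ->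
  exists2 e, 0 < e & forall t, s < t < s + e -> exists h, ray_lift v t h.
Proof.
move=> vs s0 L; have sb : 0 <= s <= s by rewrite s0 lexx.
have [i [x0 [r [c [rho [gi ls]]]]]] := lift_local immf L sb.
have gE : fproj (g s) = s *: v := lift_proj L sb.
exists rho; first exact: (ls_rho ls).
move=> t /andP[st tr]; eexists; apply: (ray_lift_glue immf ls L (b := t)).
- by rewrite s0 ltW.
- move=> u /andP[su ut]; rewrite gE -scalerBl normrZ ger0_norm ?subr_ge0 //.
  apply: (@le_lt_trans _ _ ((u - s) * 1)).
    apply: ler_wpM2l; rewrite ?subr_ge0 // (le_trans vs) // invf_le1 // ler1n //.
  by rewrite mulr1 ltrBlDl (le_lt_trans ut).
- by rewrite -gE (sec_q ls).
Qed.

(** The one use of completeness: the lifts reach no end before s. The points at parameters tending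
    to s form a Cauchy sequence because the speed is bounded; at the limit the ratio is still at
    least 1/2 by continuity, so a local section exists there and carries the lift to s. *)
Lemma ray_lift_limit v s : `|v| <= 8^-1 -> 0 < s <= 1 ->
  (forall r, 0 <= r < s -> exists g, ray_lift v r g) -> exists g, ray_lift v s g.
Proof.
move=> vs /andP[s0 s1] ex.
have ex' r : exists g, 0 <= r < s -> ray_lift v r g.
  by have [/ex[g L]|h] := boolP (0 <= r < s); [exists g|exists (fun => p0)].
(* The diagonal of the lifts on shorter intervals; by uniqueness it is a lift on each of them. *)
have [G GP] := choice ex'; pose g t := G t t.
have Lg r : 0 <= r < s -> ray_lift v r g.
  move=> rs; have L := GP r rs; have r0 : 0 <= r by case/andP: rs.
  apply: (ray_lift_eq L r0) => t /andP[t0 tr]; apply/esym.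
  have ts : 0 <= t < s by rewrite t0 (le_lt_trans tr) //; case/andP: rs.
  by apply: (lift_unique immf (GP t ts) (lift_sub L tr)); rewrite t0 lexx.
pose u (n : nat) := s - s / n.+1%:R.
have u1 n : 0 <= u n < s.
  rewrite subr_ge0 ler_pdivrMr ?ltr0n // ler_peMr ?ler1n ?(ltW s0) //=.
  by rewrite ltrBlDr ltrDl divr_gt0 ?ltr0n.
have uN (e : R) : 0 < e -> exists N : nat, forall n : nat, (N <= n)%N -> s - u n < e.
  move=> e0; exists (Num.bound (s / e)); move=> n Nn; rewrite /u subKr.
  have := archi_boundP (ltW (divr_gt0 s0 e0)); rewrite ltr_pdivrMr // => h.
  rewrite ltr_pdivrMr ?ltr0n // mulrC (lt_le_trans h) // ler_wpM2r ?(ltW e0) //.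
  by rewrite ler_nat (leq_trans Nn).
have [_ v2] := small_bounds vs.
have cauchy (e : R) : 0 < e -> exists N : nat, forall m n : nat,
    (N <= m)%N -> (N <= n)%N -> (dist f (g (u m)) (g (u n)) < e%:E)%E.
  move=> e0; have [N NP] := uN e e0; exists N => m n Nm Nn.
  pose b := Num.max (u m) (u n).
  have bs : 0 <= b < s by rewrite le_max gt_max; move: (u1 m) (u1 n) => /andP[-> ->] /andP[_ ->].
  have [mb nb] : u m <= b /\ u n <= b by rewrite !le_max !lexx orbT.
  have [/andP[m0 ms] /andP[n0 ns]] := (u1 m, u1 n).
  have b1 : b <= 1 by case/andP: bs => _ /ltW/le_trans; exact.
  have [hm hn] := (NP m Nm, NP n Nn).
  apply: le_lt_trans (lift_dist immf hA E00 E11 E01 (L := 1) (Lg b bs) _ ler01 v2 _ _) _.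
  - exact: (lift_ratio_half vs (Lg b bs) b1).
  - by rewrite m0.
  - by rewrite n0.
  by rewrite lte_fin mul1r; exact: lt_dist ms ns hm hn.
have [q qP] := complf cauchy.
have qN N : nbhs q N -> exists n0, forall n, (n0 <= n)%N -> N (g (u n)).
  move=> /(dist_nbhs immf)[e e0 H]; have [n0 n0P] := qP e e0.
  by exists n0 => n /n0P/H.
have rq : 0 < fratio q.
  rewrite ltNge; apply/negP => rq.
  have rq' : fratio q < 2^-1 by apply: le_lt_trans rq _; rewrite invr_gt0.
  have nb : \forall p \near q, fratio p < 2^-1.
    by apply: (@ratio_continuous _ _ _ immf E0 E1 q [set y | y < 2^-1]); exact: lt_nbhsl.
  have [n nP] := qN _ nb; have := nP n (leqnn n); rewrite ltNge.
  have /andP[n0 ns] := u1 n.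
  rewrite (lift_ratio_half vs (Lg _ (u1 n))) ?n0 ?lexx //.
  exact: le_trans (ltW ns) s1.
have [i [x0 [r [c [rho [gi ls]]]]]] := exists_local_section immf p0 rq.
have rho0 := ls_rho ls; have rho2 : 0 < rho / 2 by rewrite divr_gt0.
have nb : \forall p \near q, (`|fproj p - fproj q| < rho /\ p = sec S i gi (fproj p))
    /\ `|fproj p - fproj q| < rho / 2.
  by apply: filterI; [exact: (near_sec immf ls)|exact: proj_near].
have [n1 n1P] := qN _ nb; have [n2 n2P] := uN _ rho2.
pose n := maxn n1 n2; have [[_ gs] gr] := n1P n (leq_maxl _ _).
have sr := n2P n (leq_maxr _ _).
have /andP[n0 ns] := u1 n.
have gu : fproj (g (u n)) = u n *: v by apply: (lift_proj (Lg _ (u1 n))); rewrite n0 lexx.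
rewrite gu in gs gr.
eexists; apply: (ray_lift_glue immf ls (Lg _ (u1 n)) (b := s)); rewrite ?n0 ?ltW //.
move=> t /andP[nt ts].
have -> : t *: v - fproj q = (t - u n) *: v + (u n *: v - fproj q) by rewrite scalerBl addrA subrK.
apply: le_lt_trans (ler_normD _ _) _; rewrite normrZ ger0_norm ?subr_ge0 //.
have yt : (t - u n) * `|v| <= (t - u n) * 1.
  by apply: ler_wpM2l; rewrite ?subr_ge0 // (le_trans vs) // invf_le1 // ler1n.
exact: add_half_lt gr sr ts yt.
Qed.

Lemma ray_lift_exists v : `|v| <= 8^-1 -> exists g, ray_lift v 1 g.
Proof.
move=> vs; suff P : forall s : R, 0 <= s <= 1 -> exists g, ray_lift v s g by apply: P; apply/andP.
apply: real_induction => [s /andP[s0 s1] ih|s /andP[s0 s1] ih].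
  have [->|sn] := eqVneq s 0; first by exists (fun => p0); exact: ray_lift0.
  by apply: ray_lift_limit => //; rewrite lt_def sn s0.
have [g L] := ih s (introT andP (conj s0 (lexx s))).
have [e e0 H] := ray_lift_extend vs s0 L.
by exists e => // r rs _; exact: H.
Qed.

Lemma near_sec_at q i x0 r c rho gi v : local_section q i x0 r c rho gi ->
  `|v - fproj q| < rho -> \forall p \near sec S i gi v,
    `|fproj p - fproj q| < rho /\ p = sec S i gi (fproj p).
Proof.
move=> ls vr; have [gr _] := ls_sec ls vr; have id := sec_dom ls vr.
have n1 := spar_ball_nbhs id gr.
have n2 : \forall p \near sec S i gi v, `|fproj p - fproj q| < rho.
  have d0 : 0 < rho - `|v - fproj q| by rewrite subr_gt0.
  apply: filterS (proj_near immf p0 E0 E1 (sec S i gi v) d0) => p.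
  rewrite (proj_sec ls vr) => pv; rewrite -[fproj p](subrK v) -addrA.
  by rewrite (le_lt_trans (ler_normD _ _)) // -ltrBrDr.
apply: filterS2 n1 n2 => p [x xr <-] pr; split=> //; rewrite /sec; congr (spar i _).
exact: (ls_uniq ls (ltW xr) pr erefl).
Qed.

Section SheetMap.
Variable G : R * R -> R -> S.
Hypothesis GP : forall v, `|v| <= 8^-1 -> ray_lift v 1 (G v).
Let sigma v := G v 1.

Let unit1 : 0 <= (1 : R) <= 1. Proof. by apply/andP. Qed.

Lemma sheet_scale v (s : R) : `|v| <= 8^-1 -> 0 <= s <= 1 -> sigma (s *: v) = G v s.
Proof.
move=> vs s01; have sv : `|s *: v| <= 8^-1.
  case/andP: s01 => s0 s1; rewrite normrZ ger0_norm // (le_trans _ vs) //.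
  by rewrite ler_piMl.
have := lift_unique immf (GP sv) (lift_scale (GP vs) s01) unit1.
by rewrite mulr1.
Qed.

Lemma sheet_proj v : `|v| <= 8^-1 -> fproj (sigma v) = v.
Proof. by move=> vs; rewrite (lift_proj (GP vs) unit1) scale1r. Qed.

Lemma sheet_ratio v : `|v| <= 8^-1 -> 0 < fratio (sigma v).
Proof. by move=> vs; exact: (lift_ratio (GP vs) unit1). Qed.

Lemma sheet0 : sigma 0 = p0.
Proof.
have z : `|0 : R * R| <= 8^-1 by rewrite normr0 invr_ge0.
have z1 : 0 <= (0 : R) <= 1 by rewrite lexx ler01.
by rewrite -(scale0r 0) (sheet_scale z z1) (lift_start (GP z)).
Qed.

Lemma near_small (v : R * R) : `|v| < 8^-1 -> \forall w \near v, `|w| < 8^-1.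
Proof.
move=> vs; have h : `|v - 0| < 8^-1 by rewrite subr0.
by apply: filterS (near_norm_lt h) => w; rewrite subr0.
Qed.

Lemma sheet_section v i x0 r c rho gi : `|v| < 8^-1 ->
  local_section (sigma v) i x0 r c rho gi -> {for v, continuous sigma} ->
  \forall w \near v, sigma w = sec S i gi w.
Proof.
move=> vs ls cv; have n1 := near_small vs.
have n2 : \forall w \near v, sigma w = sec S i gi (fproj (sigma w)).
  have n0 : \forall p \near sigma v, p = sec S i gi (fproj p).
    by apply: filterS (near_sec immf ls) => p [].
  exact: (cv _ n0).
by apply: filterS2 n1 n2 => w ws {1}->; rewrite sheet_proj // ltW.
Qed.

(* A section that agrees with the sheet near [k v] agrees with it near [v]:
   continue the lifted rays inside the section. *)
Lemma sheet_continue v q i x0 r c rho gi (k : R) : local_section q i x0 r c rho gi ->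
  `|v| < 8^-1 -> 0 < k <= 1 -> `|k *: v - fproj q| < rho -> `|v - fproj q| < rho ->
  (\forall w \near k *: v, sigma w = sec S i gi w) ->
  \forall w \near v, sigma w = sec S i gi w.
Proof.
move=> ls vs /andP[k0 k1] kr vr nk.
have ck : {for v, continuous (fun w : R * R => k *: w)} by exact: scaler_continuous.
have n1 : \forall w \near v, sigma (k *: w) = sec S i gi (k *: w) := ck _ nk.
have n2 : \forall w \near v, `|k *: w - fproj q| < rho := ck _ (near_norm_lt kr).
apply: filterS3 (near_small vs) (near_norm_lt vr) (filterI n1 n2) => w ws wr [sk kwr].
have kb : 0 <= k <= 1 by rewrite ltW.
have Lk := lift_sub (GP (ltW ws)) k1.
have nr (t : R) : k <= t <= 1 -> `|t *: w - fproj q| < rho.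
  by move=> kt; exact: convex_norm_lt kt kwr wr.
have gk : G w k = sec S i gi (k *: w).
  by rewrite -(sheet_scale (ltW ws) kb).
have := lift_unique immf (GP (ltW ws)) (ray_lift_glue immf ls Lk kb nr gk) unit1.
rewrite /sigma => ->; case: ifPn => [k1'|]; last by rewrite scale1r.
have kE : k = 1 by apply/eqP; rewrite eq_le k1.
by rewrite -kE gk kE scale1r.
Qed.

(** Continuity spreads along the ray from 0: at a limit parameter [sheet_continue] transports
    agreement with a section from a slightly smaller parameter, and beyond it the sheet coincides
    with a section on a neighbourhood. *)
Lemma sheet_continuous v : `|v| < 8^-1 -> {for v, continuous sigma}.
Proof.
move=> vs; suff P (s : R) : 0 <= s <= 1 -> {for s *: v, continuous sigma}.
  by rewrite -[v]scale1r; exact: P.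
have svs (t : R) : 0 <= t <= 1 -> `|t *: v| < 8^-1.
  move=> /andP[t0 t1]; rewrite normrZ ger0_norm // (le_lt_trans _ vs) //.
  by rewrite ler_piMl.
have secc w q i x0 r c rho gi : local_section q i x0 r c rho gi -> `|w - fproj q| < rho ->
    (\forall u \near w, sigma u = sec S i gi u) -> {for w, continuous sigma}.
  move=> ls wr nw; have cw := sec_continuous ls wr.
  have sw : sigma w = sec S i gi w by exact: nbhs_singleton nw.
  rewrite /prop_for /continuous_at sw; apply: cvg_trans cw; apply: near_eq_cvg.
  by apply: filterS nw => u ->.
move: s; apply: real_induction => [s s01 ih|s /andP[s0 s1] ih].
  have [->|sn] := eqVneq s 0.
    have r0 : 0 < fratio p0 by rewrite ratio0.
    have [i [x0 [r [c [rho [gi ls]]]]]] := exists_local_section immf p0 r0.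
    have rho0 := ls_rho ls; rewrite scale0r; apply: (secc _ _ _ _ _ _ _ _ ls).
      by rewrite fproj0 subrr normr0.
    have n0 : `|0 : R * R| < 8^-1 by rewrite normr0 invr_gt0.
    have n1 : `|0 - fproj p0| < rho by rewrite fproj0 subrr normr0.
    apply: filterS2 (near_small n0) (near_norm_lt n1) => w ws wr.
    have z1 : 0 <= (0 : R) <= 1 by rewrite lexx ler01.
    have nr (t : R) : 0 <= t <= 1 -> `|t *: w - fproj p0| < rho.
      by move=> t01; apply: convex_norm_lt t01 _ wr; rewrite scale0r.
    have g0 : p0 = sec S i gi (0 *: w) by rewrite scale0r -fproj0 (sec_q ls).
    rewrite /sigma (lift_unique immf (GP (ltW ws)) (ray_lift_glue immf ls (ray_lift0 w) z1 nr g0) unit1).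
    by rewrite ifF ?scale1r //; apply/negbTE; rewrite -ltNge.
  have sp : 0 < s by rewrite lt_def sn; case/andP: s01.
  have svp : G v s = sigma (s *: v) by rewrite sheet_scale // ltW.
  have [i [x0 [r [c [rho [gi ls]]]]]] := lift_local immf (GP (ltW vs)) s01.
  have [d d0 H] := lift_near immf (GP (ltW vs)) s01 ls.
  (* The shift by s / 2 keeps t strictly positive, hence the factor k = t / s below too. *)
  have [t [t0 ts td]] : exists t, [/\ 0 < t, t < s & `|t - s| < d].
    have s2 : 0 < s / 2 by rewrite divr_gt0.
    have [t [t0 ts td]] := exists_left_point s2 d0.
    exists (t + s / 2); split; first by rewrite ltr_wpDl.
      by rewrite [ltRHS]splitr ltrD2r.
    by rewrite [X in `|X|](_ : _ = t - s / 2) //; field.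
  have t01 : 0 <= t <= 1 by rewrite ltW // (le_trans (ltW ts)) //; case/andP: s01.
  have [tr gt] := H t t01 td.
  have [sr _] := H s s01 (eq_ind_r (fun x => `|x| < d) (eq_ind_r (fun x => x < d) d0 (normr0 _)) (subrr s)).
  apply: (secc _ _ _ _ _ _ _ _ ls sr).
  pose k := t / s.
  have kE : k *: (s *: v) = t *: v by rewrite scalerA /k divfK ?gt_eqF.
  apply: (sheet_continue (k := k) ls (svs s s01)) => //.
  - by rewrite divr_gt0 //= ler_pdivrMr // mul1r ltW.
  - by rewrite kE.
  - rewrite kE; have ct := ih t (introT andP (conj (ltW t0) ts)).
    have nt := near_sec_at ls tr; rewrite -gt in nt.
    have tE : G v t = sigma (t *: v) by rewrite sheet_scale // ltW.
    rewrite tE in nt.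
    have n2 : \forall w \near t *: v, `|fproj (sigma w) - fproj (G v s)| < rho /\
       sigma w = sec S i gi (fproj (sigma w)) := ct _ nt.
    apply: filterS2 n2 (near_small (svs t t01)) => w [_ {1}->] ws.
    by rewrite sheet_proj // ltW.
have s01 : 0 <= s <= 1 by rewrite s0 ltW.
have [i [x0 [r [c [rho [gi ls]]]]]] := exists_local_section immf p0 (sheet_ratio (ltW (svs s s01))).
have ns := sheet_section (svs s s01) ls (ih s (introT andP (conj s0 (lexx s)))).
have rho0 := ls_rho ls.
have sr : `|s *: v - fproj (sigma (s *: v))| < rho.
  by rewrite sheet_proj ?subrr ?normr0 // ltW // svs.
have cs : {for s, continuous (fun t : R => t *: v)} by exact: scalel_continuous.
have n3 : \forall w \near (s *: v : R * R), (\forall u \near w, sigma u = sec S i gi u) /\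
    `|(w : R * R) - fproj (sigma (s *: v))| < rho.
  by apply: filterI; [exact: nbhs_interior|exact: near_norm_lt].
have n4 : \forall t \near s, (\forall u \near t *: v, sigma u = sec S i gi u) /\
    `|t *: v - fproj (sigma (s *: v))| < rho := cs _ n3.
have /nbhs_ballP[e e0 H] := n4.
exists e => // t /andP[st te] t1.
have [|nt tr] := H t; first by rewrite -ball_normE /= distrC gtr0_norm ?subr_gt0 // ltrBlDl.
exact: secc ls tr nt.
Qed.

End SheetMap.

(** The last clause says that the sheet fills a neighbourhood of each of its points, so that a
    maximum over the sheet is a local maximum on the surface. *)
Theorem exists_sheet : exists sigma : R * R -> S, sigma 0 = p0 /\
  forall v, `|v| < 8^-1 -> [/\ fproj (sigma v) = v, {for v, continuous sigma} &
    \forall p \near sigma v, p = sigma (fproj p)].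
Proof.
have ex v : exists g, `|v| <= 8^-1 -> ray_lift v 1 g.
  by have [/ray_lift_exists[g L]|h] := boolP (`|v| <= 8^-1); [exists g|exists (fun => p0)].
have [G GP] := choice ex.
exists (fun v => G v 1); split; first exact: sheet0.
move=> v vs; have cv := sheet_continuous GP vs; split=> //.
  exact: sheet_proj (ltW vs).
have [i [x0 [r [c [rho [gi ls]]]]]] := exists_local_section immf p0 (sheet_ratio GP (ltW vs)).
have ns := sheet_section GP vs ls cv.
have nv : \forall p \near G v 1, G (fproj p) 1 = sec S i gi (fproj p).
  have /nbhs_ballP[e e0 H] := ns.
  apply: filterS (proj_near immf p0 E0 E1 (G v 1) e0) => p.
  by rewrite (sheet_proj GP (ltW vs)) => pv; apply: H; apply/ball_prod.
by apply: filterS2 (near_sec immf ls) nv => p [_ h1] h2; rewrite h2.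
Qed.

End Sheet.

(** * The maximum principle *)

Lemma exists_tangent_frame (R : realType) (S : surface R) (f : S -> 'rV[R]_4) (p0 : S) : immersion f ->
  exists E0 E1, [/\ dot E0 E0 = 1, dot E1 E1 = 1, dot E0 E1 = 0 & fratio f E0 E1 p0 = 1].
Proof.
move=> immf; have [x ix <-] := chart_ofP p0; move: (chart_of p0) ix => i ix.
have [l [l0 lon _]] := @exists_onframe _ (dpar (f \o spar i) ^~ x) (row_free_dpar ((immf i).2 x ix)).
pose E k := \sum_a l k a *: dpar (f \o spar i) a x.
have EE k k' : dot (E k) (E k') = (k == k')%:R := lon k k'.
exists (E 0), (E 1); split; [exact: (EE 0 0)|exact: (EE 1 1)|exact: (EE 0 1)|].
rewrite (ratioE immf) // /chart_ratio.
have E0E : E 0 = l 0 0 *: dpar (f \o spar i) 0 x + l 0 1 *: dpar (f \o spar i) 1 x by rewrite /E sum2.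
have E1E : E 1 = l 1 0 *: dpar (f \o spar i) 0 x + l 1 1 *: dpar (f \o spar i) 1 x by rewrite /E sum2.
have dl : l 0 0 * l 1 1 - l 0 1 * l 1 0 != 0 by rewrite -det_mx2.
rewrite -(proj_ratio_frame (E 0) (E 1) _ _ dl) -E0E -E1E /proj_ratio /proj_det.
have e00 := EE 0 0; have e11 := EE 1 1; have e01 := EE 0 1.
rewrite /= in e00 e11 e01; rewrite (dotC (E 1) (E 0)) e00 e11 e01.
by rewrite !mulr0 !mulr1 !subr0 expr1n expr0n subr0 divr1.
Qed.

(** * The test function in space-time *)

Section FlowLocal.
Context {R : realType} (S : surface R) (F : R -> S -> 'rV[R]_4).
Local Notation space_time := (R * (R * R))%type.
Hypothesis hmcf : ancient_mcf F.
Hypothesis hlag : forall t : R, t <= 0 -> lagrangian (F t).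
Hypothesis hac : forall t : R, t <= 0 -> almost_calibrated (F t).
Hypothesis hA1 : forall t i x, t <= 0 -> sdom S i x -> normA2 (F t \o spar i) x <= 1.

Definition flow_q (t : R) (p : S) : R :=
  normH2 (F t \o spar (chart_of p)) (scoord (chart_of p) p).
Definition flow_T (t : R) (p : S) : R :=
  tan_angle (F t \o spar (chart_of p)) (scoord (chart_of p) p).

Lemma flow_qE t i x : t < 0 -> sdom S i x -> flow_q t (spar i x) = normH2 (F t \o spar i) x.
Proof.
move=> t0 ix; have [y jy yE] := chart_ofP (spar i x : S).
by rewrite /flow_q (scoord_chart_of yE jy) /normH2 (mean_curv_chart hmcf t0 jy ix yE).
Qed.

Lemma flow_TE t i x : t <= 0 -> sdom S i x -> flow_T t (spar i x) = tan_angle (F t \o spar i) x.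
Proof.
move=> t0 ix; have [y jy yE] := chart_ofP (spar i x : S).
by rewrite /flow_T (scoord_chart_of yE jy) (tan_angle_chart hmcf t0 jy ix yE).
Qed.

Lemma stmap_flow i t x : stdom S i (t, x) ->
  'D_((1, 0) : space_time) (stmap F i) (t, x) = mean_curv (fun y => stmap F i (t, y)) x.
Proof.
move=> [t0 ix]; rewrite -derive_slice_time.
by have [_] := flow_der hmcf t0 ix.
Qed.

Lemma stmap_ReOmega_gt0 i t x : stdom S i (t, x) ->
  0 < ReOmega (dpar (fun y => stmap F i (t, y)) 0 x) (dpar (fun y => stmap F i (t, y)) 1 x).
Proof. by move=> [t0 ix]; have [c []] := flow_angle hmcf hlag hac (ltW t0) ix. Qed.

Lemma Cn_on_dpar_st i a n :
  Cn_on n (stdom S i) (fun y : space_time => dpar (fun x => stmap F i (y.1, x)) a y.2).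
Proof.
have -> : (fun y : space_time => dpar (fun x => stmap F i (y.1, x)) a y.2) =
    'D_((0, e_ a) : space_time) (stmap F i).
  by apply/funext => -[t x] /=; rewrite /dpar derive_slice.
by have [_] := Cn_on_stmap hmcf n.+1 i; exact.
Qed.

(** By the flow equation H is the time derivative of the smooth map [stmap F i], hence jointly
    continuous in time and space. *)
Lemma normH2_continuous i z : stdom S i z ->
  {for z, continuous (fun y : space_time => normH2 (fun x => stmap F i (y.1, x)) y.2)}.
Proof.
have oA := @open_stdom R S i; apply: Cn_on_continuous.
have cH : Cn_on 0 (stdom S i) ('D_((1, 0) : space_time) (stmap F i)).
  by have [_] := Cn_on_stmap hmcf 1 i; exact.
apply: (Cn_on_eq oA _ (Cn_on_bil (@dot_bil R) oA cH cH)) => -[t x] Az.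
by rewrite stmap_flow.
Qed.

Lemma tan_angle_continuous i z : stdom S i z ->
  {for z, continuous (fun y : space_time => tan_angle (fun x => stmap F i (y.1, x)) y.2)}.
Proof.
have oA := @open_stdom R S i; apply: Cn_on_continuous.
apply: (Cn_onM oA); first exact: (Cn_on_bil (@ImOmega_bil R) oA (Cn_on_dpar_st i 0 0) (Cn_on_dpar_st i 1 0)).
apply: (Cn_onV oA) => [[t x] Az|]; first by rewrite gt_eqF //; exact: stmap_ReOmega_gt0.
exact: (Cn_on_bil (@ReOmega_bil R) oA (Cn_on_dpar_st i 0 0) (Cn_on_dpar_st i 1 0)).
Qed.

(** The subsolution u with the barrier of centre [P] and the drift in time that force its maximum
    off the parabolic boundary. *)
Definition flow_w (a k l : R) (P : 'rV[R]_4) (t : R) (p : S) : R :=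
  a / 2 * flow_q t p + 2^-1 * ln (1 + flow_T t p ^+ 2) - k * dot (F t p - P) (F t p - P) + l * t.

Lemma flow_w_eq a k l P t p q T : flow_q t p = q -> flow_T t p = T ->
  flow_w a k l P t p = a / 2 * q + 2^-1 * ln (1 + T ^+ 2) - k * dot (F t p - P) (F t p - P) + l * t.
Proof. by move=> <- <-. Qed.

Lemma flow_w_continuous a k l P i z : stdom S i z ->
  {for z, continuous (fun y : space_time => flow_w a k l P y.1 (spar i y.2))}.
Proof.
move=> Az; have oA := @open_stdom R S i.
have cq := normH2_continuous Az; have cT := tan_angle_continuous Az.
have cF : {for z, continuous (fun y => dot (stmap F i y - P) (stmap F i y - P))}.
  have cS : Cn_on 0 (stdom S i) (fun y => stmap F i y - P).
    exact: (Cn_onD oA (Cn_on_stmap hmcf 0 i) (Cn_on_cst 0 _ (- P))).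
  exact: (Cn_on_continuous (Cn_on_bil (@dot_bil R) oA cS cS)).
pose h (y : space_time) := a / 2 * normH2 (fun x => stmap F i (y.1, x)) y.2 +
  2^-1 * ln (1 + tan_angle (fun x => stmap F i (y.1, x)) y.2 ^+ 2) -
  k * dot (stmap F i y - P) (stmap F i y - P) + l * y.1.
have ch : {for z, continuous h}.
  apply: cvgD; last by apply: cvgM; [exact: cvg_cst|exact: cvg_fst].
  apply: cvgB; last by apply: cvgM; [exact: cvg_cst|exact: cF].
  apply: cvgD; first by apply: cvgM; [exact: cvg_cst|exact: cq].
  apply: cvgM; first exact: cvg_cst.
  apply: (cvg_comp (fun y : space_time => 1 + tan_angle (fun x => stmap F i (y.1, x)) y.2 ^+ 2) (@ln R)).
    by apply: cvgD; [exact: cvg_cst|apply: cvgM; exact: cT].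
  by apply: continuous_ln; rewrite ltr_pwDl // sqr_ge0.
have wh y : stdom S i y -> flow_w a k l P y.1 (spar i y.2) = h y.
  by case: y => t x [t0 ix]; exact: flow_w_eq (flow_qE t0 ix) (flow_TE (ltW t0) ix).
apply: (cvg_trans _ (eq_ind_r (fun c => h y @[y --> z] --> c) ch (wh z Az))).
apply: near_eq_cvg; apply: filterS (open_nbhs_nbhs (conj oA Az)) => y Ay.
exact: esym (wh y Ay).
Qed.

Lemma flow_w_local_max a k l P i t x : stdom S i (t, x) -> 0 <= a ->
  (\forall y \near ((t, x) : space_time), y.1 <= t -> flow_w a k l P y.1 (spar i y.2) <= flow_w a k l P t (spar i x)) ->
  (1 - a) * flow_q t (spar i x) <= 4 * k + l.
Proof.
move=> Az a0 nm; have oA := @open_stdom R S i.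
have [t0 ix] := Az; rewrite (flow_qE t0 ix).
have immP (s : R) y : stdom S i (s, y) -> row_free (differential (fun y => stmap F i (s, y)) y).
  by move=> [s0 iy]; exact: ((flow_immersion hmcf (ltW s0) i).2 y iy).
have lagP (s : R) y : stdom S i (s, y) -> lagrangian_at (fun y => stmap F i (s, y)) y.
  by move=> [s0 iy]; exact: (hlag (ltW s0) iy).
have wh y : stdom S i y -> flow_w a k l P y.1 (spar i y.2) =
   a / 2 * normH2 (fun x => stmap F i (y.1, x)) y.2 +
  2^-1 * ln (1 + tan_angle (fun x => stmap F i (y.1, x)) y.2 ^+ 2) -
  k * dot (stmap F i y - P) (stmap F i y - P) + l * y.1.
  by case: y => s y [s0 iy]; exact: flow_w_eq (flow_qE s0 iy) (flow_TE (ltW s0) iy).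
apply: (chart_local_max_bound oA (fun n => Cn_on_stmap hmcf n i) immP lagP (@stmap_flow i)
  (@stmap_ReOmega_gt0 i) (z := (t, x)) (p := P) Az _ a0).
  exact: (hA1 (ltW t0) ix).
have le2 (A : bool) (b c b' c' : R) : b = b' -> c = c' -> (A -> b <= c) -> A -> b' <= c' by move=> -> ->.
apply: filterS2 (open_nbhs_nbhs (conj oA Az)) nm => y Ay.
exact: le2 _ _ _ _ _ (wh y Ay) (wh (t, x) Az).
Qed.

End FlowLocal.

(** The maximum of the test function is at least its value at (p0, t0), so k d + l (t0 - t) is at
    most the defect e. With these k and l this gives d <= 1/2048 and t0 - t <= 1/128, below the
    height 1/64 of the cylinder. *)
Lemma barrier_arith (R : realType) (u0 uq e d t t0 k l : R) : 0 < e -> 0 <= d ->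
  u0 + l * t0 <= uq - k * d + l * t -> uq <= u0 + e -> t <= t0 ->
  k = 2048 * e -> l = 128 * e ->
  [/\ u0 <= uq, t0 - 64^-1 < t & d <= 2048^-1].
Proof.
move=> e0 d0 h um tt kE lE; rewrite kE lE in h.
have ed : 0 <= e * d by rewrite mulr_ge0 // ltW.
have et : 0 <= e * (t0 - t) by rewrite mulr_ge0 ?subr_ge0 // ltW.
have et2 : e * (128 * (t0 - t)) <= e * 1 by lra.
have ed2 : e * (2048 * d) <= e * 1 by lra.
rewrite ler_pM2l // in et2; rewrite ler_pM2l // in ed2.
by split; lra.
Qed.

(** On the lateral boundary the squared distance to [P] at time t0 is at least 1/256, while the
    triangle inequality and the speed bound would make it at most 2/2048 + 4/64^2 = 1/512. *)
Lemma barrier_exit (R : realType) (v : R * R) (X2 XY Y2 t t0 : R) : 16^-1 <= `|v| ->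
  v.1 ^+ 2 + v.2 ^+ 2 <= X2 -> X2 <= 2 * XY + 2 * Y2 -> Y2 <= 2 * (t0 - t) ^+ 2 ->
  t0 - 64^-1 < t -> t <= t0 -> ~ XY <= 2048^-1.
Proof.
move=> rv X2P XYP Y2P tlow tt dlow.
have sq (x : R) : 16^-1 <= `|x| -> (16^-1) ^+ 2 <= x ^+ 2.
  by move=> h; rewrite -[x ^+ 2]real_normK ?num_real // ler_pXn2r // ?nnegrE ?invr_ge0.
have h1 : (16^-1) ^+ 2 <= v.1 ^+ 2 + v.2 ^+ 2.
  move: rv; rewrite normP le_max => /orP[] /sq h; apply: le_trans h _.
    by rewrite lerDl sqr_ge0.
  by rewrite lerDr sqr_ge0.
have h2 : (t0 - t) ^+ 2 <= (64^-1) ^+ 2.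
  by rewrite ler_pXn2r // ?nnegrE ?subr_ge0 ?invr_ge0 //; lra.
by move: h1 h2; rewrite !expr2 => h1 h2; lra.
Qed.

(** * The localized maximum principle *)

Section Barrier.
Context {R : realType} (S : surface R) (F : R -> S -> 'rV[R]_4).
Local Notation space_time := (R * (R * R))%type.
Hypothesis hmcf : ancient_mcf F.
Hypothesis hcomplete : forall t : R, t <= 0 -> complete_metric (F t).
Hypothesis hlag : forall t : R, t <= 0 -> lagrangian (F t).
Hypothesis hac : forall t : R, t <= 0 -> almost_calibrated (F t).
Hypothesis hA1 : forall t i x, t <= 0 -> sdom S i x -> normA2 (F t \o spar i) x <= 1.

Local Notation flow_w := (flow_w F).

Lemma flow_w_joint_continuous a k l P (t : R) q : t < 0 ->
  {for ((t, q) : R * S), continuous (fun y : R * S => flow_w a k l P y.1 y.2)}.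
Proof.
move=> t0; have [x ix <-] := chart_ofP q; move: (chart_of q) ix => i ix.
have im : simg S i (spar i x) by exists x.
have Az : stdom S i (t, x) by [].
have cw := @flow_w_continuous _ _ _ hmcf hlag hac a k l P i (t, x) Az.
have c2 : scoord i y.2 @[y --> ((t, spar i x) : R * S)] --> x.
  apply: (cvg_comp (fun y : R * S => y.2) (scoord i)); first exact: cvg_snd.
  have cs := scoord_continuous im; rewrite /prop_for /continuous_at sparK // in cs; exact: cs.
have cp : (y.1, scoord i y.2) @[y --> ((t, spar i x) : R * S)] --> ((t, x) : space_time).
  by apply: (@cvg_pair _ _ _ _ (nbhs t) (nbhs x) _ _ _ (fun y : R * S => y.1) (fun y : R * S => scoord i y.2)); [exact: cvg_fst|exact: c2].
have cc := cvg_comp (fun y : R * S => (y.1, scoord i y.2)) _ cp cw.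
apply: cvg_trans cc; apply: near_eq_cvg.
have ns : nbhs (spar i x : S) (simg S i).
  by apply: open_nbhs_nbhs; split=> //; exact: simg_open.
have n2 : \forall y \near ((t, spar i x) : R * S), simg S i y.2 by exact: (cvg_snd ns).
by apply: filterS n2 => y [z iz zE]; rewrite /comp /= -zE sparK.
Qed.

Definition flow_u a t q := a / 2 * flow_q F t q + 2^-1 * ln (1 + flow_T F t q ^+ 2).

Lemma flow_w0 a k l t p : flow_w a k l (F t p) t p = flow_u a t p + l * t.
Proof. by rewrite /flow_w subrr (bil0l _ (@dot_bil R)) mulr0 subr0. Qed.

Lemma dist_split (X Y : 'rV[R]_4) : dot X X <= 2 * dot (X - Y) (X - Y) + 2 * dot Y Y.
Proof.
have dB := @dot_bil R; have := dot_ge0 (X - 2 *: Y).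
rewrite !(bilBl _ _ _ dB) !(bilBr _ _ _ dB) !(bilZl dB) !(bilZr dB) (dotC Y X).
by move: (dot X X) (dot X Y) (dot Y Y) => *; lra.
Qed.

Lemma flow_speed (s t : R) q : s <= t -> t < 0 ->
  dot (F t q - F s q) (F t q - F s q) <= 2 * (t - s) ^+ 2.
Proof.
rewrite le_eqVlt => /orP[/eqP ->|st] t0.
  by rewrite !subrr (bil0l _ (@dot_bil R)) mulr_ge0 ?sqr_ge0.
have [x ix <-] := chart_ofP q; apply: (flow_displacement hmcf st t0 ix) => r /andP[_ rt].
by apply: (flow_normH2_le hmcf hA1) => //; exact: ltW (le_lt_trans rt t0).
Qed.

(** The sheet is built once, at time t0, and its points are followed to earlier times. The bound
    8320 e is 4 k + l. *)
Lemma flow_near_max (a e t0 : R) p0 : t0 < 0 -> 0 <= a -> 0 < e ->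
  (forall t q, t < 0 -> flow_u a t q <= flow_u a t0 p0 + e) ->
  exists t q, [/\ t < 0, flow_u a t0 p0 <= flow_u a t q & (1 - a) * flow_q F t q <= 8320 * e].
Proof.
move=> t00 a0 e0 umax; have im0 := flow_immersion hmcf (ltW t00).
have [E0 [E1 [E00 E11 E01 r1]]] := exists_tangent_frame p0 im0.
have [sigma [s0 sP]] := exists_sheet im0 (fun i x ix => hA1 (ltW t00) ix) (hcomplete (ltW t00)) E00 E11 E01 r1.
pose P := F t0 p0; pose k := 2048 * e; pose l := 128 * e.
(* The closed disc of radius 1/16 lies inside the open disc of radius 1/8 where the sheet is
   continuous. No lower limit on time stands in the way, the flow being ancient. *)
pose rho : R := 16^-1; pose tau : R := 64^-1.
pose W (y : space_time) := flow_w a k l P y.1 (sigma y.2).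
pose K : set space_time := `[t0 - tau, t0]%classic `*` [set v | `|v - 0| <= rho].
have cK : compact K by apply: compact_setX; [exact: segment_compact|exact: closed_ball_compact].
have rho8 : rho < 8^-1 by rewrite ltf_pV2 ?posrE ?ltr0n // ltr_nat.
have tau0 : 0 < tau by rewrite invr_gt0.
have rho0 : 0 < rho by rewrite invr_gt0.
have KP y : K y -> [/\ t0 - tau <= y.1, y.1 <= t0 & `|y.2| <= rho].
  by move=> [/=]; rewrite in_itv /= subr0 => /andP[].
have K0 : K (t0, 0) by split=> /=; [rewrite in_itv /= lexx gerBl ltW|rewrite subrr normr0 ltW].
have WK : {within K, continuous W}.
  apply: continuous_in_subspaceT => y /set_mem/KP[_ yt yr].
  have y0 := le_lt_trans yt t00; have [_ cs _] := sP _ (le_lt_trans yr rho8).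
  have c2 : sigma z.2 @[z --> y] --> sigma y.2 by apply: (cvg_comp (fun z : space_time => z.2) sigma); [exact: cvg_snd|exact: cs].
  have cp : (z.1, sigma z.2) @[z --> y] --> ((y.1, sigma y.2) : R * S).
    by apply: (@cvg_pair _ _ _ _ (nbhs y.1) (nbhs (sigma y.2)) _ _ _ (fun z : space_time => z.1) (fun z : space_time => sigma z.2)); [exact: cvg_fst|exact: c2].
  have cw := @flow_w_joint_continuous a k l P y.1 (sigma y.2) y0.
  have cc := cvg_comp (fun z : space_time => (z.1, sigma z.2)) _ cp cw.
  exact: cc.
have [[t v] /set_mem Kt max] := compact_EVT_max (ex_intro _ _ K0) cK WK.
have [/= tt0 t0t vr] := KP _ Kt; have tn := le_lt_trans t0t t00.
have [pv cs nsv] := sP v (le_lt_trans vr rho8).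
set q := sigma v in pv nsv.
have h : flow_w a k l P t0 (sigma 0) <= flow_w a k l P t q := max _ (mem_set K0).
have w0E : flow_w a k l P t0 (sigma 0) = flow_u a t0 p0 + l * t0 by rewrite s0; exact: flow_w0.
rewrite w0E in h.
have key : flow_u a t0 p0 + l * t0 <= flow_u a t q - k * dot (F t q - P) (F t q - P) + l * t := h.
have d0 := dot_ge0 (F t q - P).
have Y2 := flow_speed q t0t t00.
have [ulow tlow dlow] := barrier_arith e0 d0 key (umax t q tn) t0t erefl erefl.
have tgt : t0 - tau < t by [].
have vlt : `|v| < rho.
  rewrite ltNge; apply/negP => rv.
  have X2 := bessel (F t0 q - P) E00 E11 E01.
  have e1 : dot (F t0 q - P) E0 = v.1 by rewrite -[in RHS]pv.
  have e2 : dot (F t0 q - P) E1 = v.2 by rewrite -[in RHS]pv.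
  rewrite e1 e2 in X2.
  have XY := dist_split (F t0 q - P) (F t0 q - F t q).
  have XYE : (F t0 q - P) - (F t0 q - F t q) = F t q - P by rewrite opprB addrC addrA subrK.
  rewrite XYE in XY.
  exact: barrier_exit rv X2 XY Y2 tlow t0t dlow.
have [x ix xE] := chart_ofP q; move: (chart_of q) ix xE => i ix xE.
exists t, q; split=> //.
have -> : 8320 * e = 4 * k + l by rewrite /k /l; ring.
have Az : stdom S i (t, x) by [].
rewrite -xE; apply: (flow_w_local_max hmcf hlag hac hA1 (P := P) Az a0); rewrite xE.
(* Every surface point near q is a point of the sheet above the disc of radius [rho], because v is
   strictly inside it; so the maximum over [K] is a local maximum in the chart, for times up to
   t. *)
have n1 : \forall p \near q, p = sigma (fproj (F t0) p0 E0 E1 p) /\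
    `|fproj (F t0) p0 E0 E1 p - fproj (F t0) p0 E0 E1 q| < rho - `|v|.
  by apply: filterI; [exact: nsv|apply: (proj_near im0); rewrite subr_gt0].
rewrite -xE in n1.
have n2 : \forall y \near x, spar i y = sigma (fproj (F t0) p0 E0 E1 (spar i y)) /\
    `|fproj (F t0) p0 E0 E1 (spar i y) - fproj (F t0) p0 E0 E1 (spar i x)| < rho - `|v| :=
  spar_continuous ix n1.
have n3 : \forall y \near ((t, x) : space_time), spar i y.2 = sigma (fproj (F t0) p0 E0 E1 (spar i y.2)) /\
    `|fproj (F t0) p0 E0 E1 (spar i y.2) - fproj (F t0) p0 E0 E1 (spar i x)| < rho - `|v|.
  exact: (cvg_snd n2).
have n4 : \forall y \near ((t, x) : space_time), t0 - tau < y.1.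
  exact: (cvg_fst (lt_nbhsr tgt)).
apply: filterS2 n3 n4 => -[s y] /= [yE yr] st sle.
have Ky : K (s, fproj (F t0) p0 E0 E1 (spar i y)).
  split=> /=; first by rewrite in_itv /= (ltW st) (le_trans sle t0t).
  rewrite subr0 ltW // -[fproj _ _ _ _ _](subrK v) (le_lt_trans (ler_normD _ _)) //.
  by rewrite xE pv in yr; rewrite -ltrBrDr.
have m : flow_w a k l P s (sigma (fproj (F t0) p0 E0 E1 (spar i y))) <= flow_w a k l P t q := max _ (mem_set Ky).
by rewrite yE.
Qed.

End Barrier.

Lemma cvg_le_bound (R : realType) (T : Type) (G : set_system T) (f : T -> R) (l x : R) :
  ProperFilter G -> f z @[z --> G] --> l -> (\forall z \near G, f z <= x) -> l <= x.
Proof.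
move=> PG cf nf; rewrite -(cvg_lim (@Rhausdorff R) cf).
by apply: limr_le => //; exact: cvgP cf.
Qed.

Lemma dot_sub_continuous (R : realType) (c u : 'rV[R]_4) :
  {for u, continuous (fun w : 'rV[R]_4 => dot (w - c) (w - c))}.
Proof.
have c1 : Cn_on 0 [set: 'rV[R]_4] (fun w : 'rV[R]_4 => w - c).
  exact: (Cn_onD openT (Cn_on_id 0 _) (Cn_on_cst 0 _ (- c))).
exact: (Cn_on_continuous (Cn_on_bil (@dot_bil R) openT c1 c1)).
Qed.

Lemma le_of_slack (R : realType) (x y : R) : (forall e, 0 < e -> x <= y + e) -> x <= y.
Proof.
move=> h; rewrite leNgt; apply/negP => yx.
have d0 : 0 < (x - y) / 2 by rewrite divr_gt0 // subr_gt0.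
by have := h _ d0; lra.
Qed.

(** As a / 2 <= 1/2, the bound on q costs at most 4160 e, and the defect of the near-maximum one
    more e. *)
Lemma slack_arith (R : realType) (a e U d u u' q psi : R) : 0 <= a -> a < 1 -> 0 < e ->
  U - e <= u -> u <= u' -> u' = a / 2 * q + psi -> psi <= d -> (1 - a) * q <= 8320 * e ->
  (1 - a) * (U - d) <= 4161 * e.
Proof.
move=> a0 a1 e0 h1 h2 h3 h4 h5.
have a1' : 0 <= 1 - a by rewrite subr_ge0 ltW.
have h6 : (1 - a) * (U - d) <= (1 - a) * (a / 2 * q + e).
  by apply: ler_wpM2l => //; move: h1 h2 h3 h4; move: (a / 2 * q) => y; clear => *; lra.
have h7 : a / 2 * ((1 - a) * q) <= 2^-1 * (8320 * e).
  apply: (@le_trans _ _ (a / 2 * (8320 * e))); first by apply: ler_wpM2l; rewrite ?divr_ge0.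
  apply: ler_wpM2r; first by apply: mulr_ge0; [exact: ler0n|exact: ltW].
  by rewrite ler_pdivrMr ?ltr0n // mulVf ?pnatr_eq0 // ltW.
have h8 : (1 - a) * e <= 1 * e by apply: ler_wpM2r; [exact: ltW|rewrite gerBl].
apply: le_trans h6 _.
have -> : (1 - a) * (a / 2 * q + e) = a / 2 * ((1 - a) * q) + (1 - a) * e by ring.
by move: h7 h8; move: (a / 2 * _) ((1 - a) * e) => y z; clear => *; lra.
Qed.

Lemma slack_fraction (R : realType) (e : R) : 0 < e ->
  exists a : R, [/\ 0 <= a, a < 1 & (1 - a) * 2 <= e].
Proof.
move=> e0; have [e2|e2] := Order.TotalTheory.leP e 2.
  by exists (1 - e / 2); split; lra.
by exists 0; split; lra.
Qed.

Lemma slack_fraction_arith (R : realType) (a e x p d : R) : a < 1 -> x <= 2 -> 0 <= p ->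
  (1 - a) * 2 <= e -> a / 2 * x + p <= d -> x <= 2 * d + e.
Proof.
move=> a1 x2 p0 ae h; have h1 : (1 - a) * x <= (1 - a) * 2 by apply: ler_wpM2l; rewrite // subr_ge0 ltW.
have h2 : a / 2 * x = 2^-1 * x - 2^-1 * ((1 - a) * x) by field.
by rewrite h2 in h; move: ((1 - a) * x) ((1 - a) * 2) h1 ae h => y z *; lra.
Qed.

(** * Removal of the slack and the final time *)

Section FlowBound.
Context {R : realType} (S : surface R) (F : R -> S -> 'rV[R]_4).
Hypothesis hmcf : ancient_mcf F.
Hypothesis hcomplete : forall t : R, t <= 0 -> complete_metric (F t).
Hypothesis hlag : forall t : R, t <= 0 -> lagrangian (F t).
Hypothesis hac : forall t : R, t <= 0 -> almost_calibrated (F t).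
Hypothesis hA1 : forall t i x, t <= 0 -> sdom S i x -> normA2 (F t \o spar i) x <= 1.
Variable delta : R.
Hypothesis delta0 : 0 < delta.
Hypothesis delta_le : forall t c, t <= 0 -> cos_angles (F t) c -> delta <= c.

Lemma flow_psi t q : t < 0 ->
  0 <= 2^-1 * ln (1 + flow_T F t q ^+ 2) <= - ln delta.
Proof.
move=> t0; have [x ix <-] := chart_ofP q; move: (chart_of q) ix => i ix.
rewrite (flow_TE hmcf (ltW t0) ix); have [c [cP c0 _ cE]] := flow_angle hmcf hlag hac (ltW t0) ix.
apply/andP; split; last first.
  by rewrite cE lerN2 ler_ln ?posrE //; exact: delta_le (ltW t0) cP.
by rewrite mulr_ge0 ?invr_ge0 // ln_ge0 // lerDl sqr_ge0.
Qed.

Lemma flow_q_bounds t q : t < 0 -> 0 <= flow_q F t q <= 2.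
Proof.
move=> t0; have [x ix <-] := chart_ofP q; move: (chart_of q) ix => i ix.
rewrite (flow_qE hmcf t0 ix) (flow_normH2_le hmcf hA1 (ltW t0) ix) andbT.
exact: dot_ge0.
Qed.

Lemma flow_u_le a t q : 0 <= a -> a < 1 -> t < 0 -> flow_u F a t q <= - ln delta.
Proof.
move=> a0 a1 t0; pose A := [set u | exists t q, t < 0 /\ u = flow_u F a t q].
have uA s p : s < 0 -> A (flow_u F a s p) by move=> s0; exists s, p.
have supA : has_sup A.
  split; first by exists (flow_u F a t q); exact: uA.
  (* The crude bounds |H|^2 <= 2 and psi <= - ln delta make the supremum finite. *)
  exists (a / 2 * 2 - ln delta) => _ [s [p [s0 ->]]].
  have /andP[_ pd] := flow_psi p s0; have /andP[_ q2] := flow_q_bounds p s0.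
  by apply: lerD => //; rewrite ler_wpM2l // divr_ge0.
have le_sup s p : s < 0 -> flow_u F a s p <= sup A by move=> s0; apply: sup_upper_bound => //; exact: uA.
apply: le_trans (le_sup t q t0) _; set U := sup A.
have key e : 0 < e -> (1 - a) * (U + ln delta) <= 4161 * e.
  move=> e0; have [_ [s [p [s0 ->]]] hU] := sup_adherent e0 supA.
  have near t' q' : t' < 0 -> flow_u F a t' q' <= flow_u F a s p + e.
    by move=> /le_sup/le_trans; apply; rewrite -lerBlDr ltW.
  have [t' [q' [t'0 h1 h2]]] := flow_near_max hmcf hcomplete hlag hac hA1 s0 a0 e0 near.
  have /andP[_ pd] := flow_psi q' t'0.
  have := slack_arith a0 a1 e0 (ltW hU) h1 erefl pd h2; by rewrite opprK.
have : (1 - a) * (U + ln delta) <= 0.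
  apply: le_of_slack => e e0; rewrite add0r.
  have e1 : 0 < e / 4161 by apply: divr_gt0; rewrite ?ltr0n.
  by apply: le_trans (key _ e1) _; rewrite mulrCA divff ?mulr1 ?pnatr_eq0.
by rewrite pmulr_rle0 ?subr_gt0 // -lerBrDr sub0r.
Qed.

(** The limit a -> 1 with an explicit error: because |H|^2 <= 2, the missing part (1 - a) |H|^2 is
    at most e. *)
Lemma flow_q_le t q : t < 0 -> flow_q F t q <= 2 * - ln delta.
Proof.
move=> t0; apply: le_of_slack => e e0; have /andP[q0 q2] := flow_q_bounds q t0.
have [a [a0 a1 ae]] := slack_fraction e0.
have /andP[p0 _] := flow_psi q t0.
exact: slack_fraction_arith a1 q2 p0 ae (flow_u_le q a0 a1 t0).
Qed.

(** The bound at negative times limits displacements, |F 0 - F s|^2 <= B s^2 for s < 0. Dividing by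
    s^2 and letting s tend to 0 from the left gives the bound for the velocity H at time 0. *)
Lemma normH2_final i x : sdom S i x -> normH2 (F 0 \o spar i) x <= 2 * - ln delta.
Proof.
move=> ix; set B := 2 * - ln delta; pose p : S := spar i x; have [_ _ fl] := hmcf.
have cD : s^-1 *: (F s p - F 0 p) @[s --> (0 : R)^'-] --> mean_curv (F 0 \o spar i) x.
  move=> P nP; have h0 : \forall s \near (0 : R), s != 0 -> 0 + s <= 0 ->
    P (s^-1 *: (F (0 + s) (spar i x) - F 0 (spar i x))) := fl 0 i x (lexx 0) ix P nP.
  suff : \forall s \near (0 : R), s < 0 -> P (s^-1 *: (F s p - F 0 p)) by [].
  apply: filterS h0 => s h s0; have := h (ltr0_neq0 s0).
  by rewrite add0r => h'; exact: h' (ltW s0).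
(* Continuity of the trajectory at time 0 is read off from its difference quotients. *)
have cF : F s p @[s --> (0 : R)^'-] --> F 0 p.
  have c0 : s @[s --> (0 : R)^'-] --> (0 : R) by exact: (@cvg_at_left_filter _ _ (@idfun R) (0 : R) 0 cvg_id).
  have h : F 0 p + s *: (s^-1 *: (F s p - F 0 p)) @[s --> (0 : R)^'-] -->
      F 0 p + 0 *: mean_curv (F 0 \o spar i) x.
    by apply: cvgD; [exact: cvg_cst|exact: cvgZ].
  rewrite scale0r addr0 in h.
  apply: (cvg_trans _ h).
  apply: near_eq_cvg; near=> s; have s0 : s != 0 by rewrite lt_eqF //; near: s; exact: nbhs_left_lt.
  by rewrite /= scalerA divff // scale1r addrC subrK.
have disp (s : R) : s < 0 -> dot (F 0 p - F s p) (F 0 p - F s p) <= B * s ^+ 2.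
  move=> s0; have cdot := cvg_comp _ _ cF (@dot_sub_continuous R (F s p) (F 0 p)).
  apply: (cvg_le_bound _ cdot); near=> r.
  have [sr r0] : s < r /\ r < 0 by split; near: r; [exact: nbhs_left_gt|exact: nbhs_left_lt].
  apply: le_trans (flow_displacement hmcf (B := B) sr r0 ix _) _.
    move=> u /andP[_ ur]; have u0 := le_lt_trans ur r0.
    by rewrite -(flow_qE hmcf u0 ix); exact: flow_q_le.
  apply: ler_wpM2l.
    have /andP[l0 l1] := flow_psi p s0; by rewrite /B mulr_ge0 // (le_trans l0).
  by rewrite -[leRHS]sqrrN ler_pXn2r // ?nnegrE; lra.
have cH := cvg_comp _ _ cD (@dot_sub_continuous R 0 (mean_curv (F 0 \o spar i) x)).
rewrite /normH2 -[mean_curv _ _]subr0.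
apply: (cvg_le_bound _ cH); near=> s; rewrite /= !subr0.
have s0 : s < 0 by near: s; exact: nbhs_left_lt.
have dB := @dot_bil R; rewrite (bilZl dB) (bilZr dB) mulrA -expr2 exprVn mulrC.
have s2 : 0 < s ^+ 2 by rewrite exprn_even_gt0 //= lt_eqF.
rewrite ler_pdivrMr //.
have d := disp s s0; have e : F 0 p - F s p = - (F s p - F 0 p) by rewrite opprB.
rewrite e (bilNl _ _ dB) (bilNr _ _ dB) opprK in d; exact: d.
Unshelve. all: by end_near. Qed.

Lemma flow_normH2_bound t i x : t <= 0 -> sdom S i x ->
  normH2 (F t \o spar i) x <= 2 * - ln delta.
Proof.
rewrite le_eqVlt => /orP[/eqP ->|t0] ix; first exact: normH2_final.
by rewrite -(flow_qE hmcf t0 ix); exact: flow_q_le.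
Qed.

End FlowBound.

Theorem theorem2 (R : realType) (S : surface R) (F : R -> S -> 'rV[R]_4)
    (c C : R)
    (hmcf : ancient_mcf F)
    (hcomplete : forall t : R, t <= 0 -> complete_metric (F t))
    (hlag : forall t : R, t <= 0 -> lagrangian (F t))
    (hac : forall t : R, t <= 0 -> almost_calibrated (F t))
    (hc : 0 < c) (hcC : c < C)
    (harea : forall t r : R, t <= 0 -> 0 < r ->
       ((c * r ^+ 2)%:E <= area (F t) (F t @^-1` eball r))%E /\
       (area (F t) (F t @^-1` eball r) <= (C * r ^+ 2)%:E)%E)
    (hA : sup_normA2 F = 1%:E) :
  (inf_cos_angle F * expeR (sup_normH2 F * (2^-1)%:E) <= 1%:E)%E.
Proof.
have hA1 t i x : t <= 0 -> sdom S i x -> normA2 (F t \o spar i) x <= 1.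
  by move=> t0 ix; rewrite -lee_fin -hA; apply: ereal_sup_ubound; exists t, i, x.
(* Over an empty surface the supremum would be -oo and not 1. The point found makes the infimum of
   cos theta finite. *)
have [t0 [i [x [t00 ix]]]] : exists (t : R) i x, t <= 0 /\ sdom S i x.
  have [[_ [t [i [x [t0 ix _]]]]]|none] := pselect ([set a | exists t i x,
      [/\ t <= 0, sdom S i x & a = (normA2 (F t \o spar i) x)%:E]] !=set0).
    by exists t, i, x.
  have : sup_normA2 F = -oo%E.
    by rewrite /sup_normA2; move/set0P/negP/negPn/eqP: none => ->; rewrite ereal_sup0.
  by rewrite hA.
have [c0 [c0P _ _ _]] := flow_angle hmcf hlag hac t00 ix.
have inf_ge0 : (0%:E <= inf_cos_angle F)%E.
  by apply: le_ereal_inf_tmp => _ [t [b [tn bP ->]]]; rewrite lee_fin ltW //; exact: hac _ tn _ bP.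
have inf_le t b : t <= 0 -> cos_angles (F t) b -> (inf_cos_angle F <= b%:E)%E.
  by move=> tn bP; apply: ereal_inf_lbound; exists t, b.
have := inf_le t0 c0 t00 c0P.
case: (inf_cos_angle F) inf_ge0 inf_le => [delta|//|//] d0 dle _.
(* If the infimum is 0 the extended product is 0; otherwise [delta] is positive and the previous
   bounds apply. *)
rewrite lee_fin le_eqVlt in d0; case/orP: d0 => [/eqP <-|d0]; first by rewrite mul0e lee01.
have dle' t b : t <= 0 -> cos_angles (F t) b -> delta <= b by move=> tn bP; rewrite -lee_fin (dle t b).
have supH : (sup_normH2 F <= (2 * - ln delta)%:E)%E.
  apply: ge_ereal_sup => _ [t [j [y [tn jy ->]]]]; rewrite lee_fin.
  exact: (flow_normH2_bound hmcf hcomplete hlag hac hA1 d0 dle').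
have expH : (expeR (sup_normH2 F * (2^-1)%:E) <= (delta^-1)%:E)%E.
  have -> : (delta^-1)%:E = expeR ((2 * - ln delta)%:E * (2^-1)%:E).
    by rewrite -EFinM mulrC mulKf ?pnatr_eq0 //= expRN lnK.
  by rewrite lee_expeR lee_wpmul2r // lee_fin invr_ge0.
apply: (@le_trans _ _ (delta%:E * (delta^-1)%:E)%E).
  by apply: lee_wpmul2l => //; rewrite lee_fin ltW.
by rewrite -EFinM divff // gt_eqF.
Qed.
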